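(* Fix an integer $m\ge1$. Assume that the two-sided process $\{Z_k\}_{k\in\mathbb Z}$ is a stationary and positive Harris chain such that conditions A1' and A2' (stated in the context) hold. Assume also that the reversed-time chain $\{\bar Z_k\}_{k\ge0}$, $\bar Z_k=Z_{-k}$, is Harris recurrent. Then there exist a finite $\sigma(X_{-\infty:0})$-measurable random variable $C_0$ and $\alpha\in(0,1)$ such that for all integers $l\ge s>0$ $$\sup_{n\ge0}\ \|\nu^0_{-l:n;m}-\nu^0_{-s:n;m}\|_{\rm TV}\le C_0\,\alpha^{s},\quad\text{a.s.}$$ There also exist a finite $\sigma(X_{m-1:\infty})$-measurable random variable $\bar C_{m-1}$ and $\bar\alpha\in(0,1)$ such that for all integers $s,l$ with $m\le s\le l$ $$\sup_{n\ge0}\ \|\nu^0_{-n:l;m}-\nu^0_{-n:s;m}\|_{\rm TV}\le \bar C_{m-1}\,\bar\alpha^{\,s-(m-1)},\quad\text{a.s.}$$ Here $\nu^t_{l:n;m}(v)=P(Y_{t:t+m-1}=v\mid X_{l:n})$, $v\in\mathcal Y^m$.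
   Context: Setting. $\mathcal X$ is a Polish space with Borel $\sigma$-field, $\mathcal Y=\{1,\dots,|\mathcal Y|\}$ is a finite set, $\mathcal Z=\mathcal X\times\mathcal Y$ with $\sigma$-field $\mathcal B(\mathcal Z)=\mathcal B(\mathcal X)\otimes2^{\mathcal Y}$. $\mu$ is a $\sigma$-finite measure on $\mathcal B(\mathcal X)$ and $c$ is the counting measure on $2^{\mathcal Y}$. $q:\mathcal Z^2\to[0,\infty)$, $(z',z)\mapsto q(z'|z)$, is measurable and for each $z$, $z'\mapsto q(z'|z)$ is a probability density with respect to $\mu\times c$. $\{Z_k\}_{k\in\mathbb Z}=\{(X_k,Y_k)\}_{k\in\mathbb Z}$ is a two-sided stationary Markov chain on $(\Omega,\mathcal F,\mathbf P)$ with transition kernel $P(Z_2\in C\mid Z_1=z)=\int_Cq(z'|z)(\mu\times c)(dz')$, and $Z_1$ has a density $p(z_1)=p(x_1,y_1)$ with respect to $\mu\times c$. ''a.s.'' refers to $\mathbf P$. $a_{l:n}$ denotes $(a_l,\dots,a_n)$, infinite indices allowed. $\|\xi\|_{\rm TV}=\sum_i|\xi(i)|$. $P_z$ is the law of the chain started at $z$. The density of $Z_{1:n}$ with respect to $(\mu\times c)^n$ is $p(x_{1:n},y_{1:n})=p(x_1,y_1)\prod_{k=2}^nq(x_k,y_k|x_{k-1},y_{k-1})$. Put $$\mathcal Y^*(x_{1:n})=\{(y_1,y_n): \exists\,y_{2:n-1}\text{ with }p(x_{1:n},y_{1:n})>0\},$$ and for a set $A$ of pairs let $A_{(1)},A_{(2)}$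 be its two coordinate projections. A1': There exists a measurable set $E\subset\mathcal X^r$, $r>1$, such that $\mathcal Y^*:=\mathcal Y^*(x_{1:r})\ne\emptyset$ is the same for all $x_{1:r}\in E$, and $\mathcal Y^*=\mathcal Y^*_{(1)}\times\mathcal Y^*_{(2)}$. A2': $\mu^r(E)>0$ (for the same $E$). Chain terminology. A chain is $\varphi$-irreducible, for a $\sigma$-finite measure $\varphi$, if $\varphi(A)>0$ implies that from every starting point $z$ the set $A$ is visited at some later time with positive probability; $\psi$ denotes the maximal irreducibility measure (dominating all others). The chain is Harris recurrent if it is $\psi$-irreducible and $\psi(A)>0$ implies that $A$ is visited infinitely often with $P_z$-probability 1 for every $z\in\mathcal Z$; positive if its kernel has an invariant probability measure; positive Harris if both. *)

(* Defs.v *)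
From HB Require Import structures.
From mathcomp Require Import all_boot all_order all_algebra.
From mathcomp Require Import all_classical all_reals all_analysis.
From mathcomp Require Import measurable_realfun.

Set Implicit Arguments.
Unset Strict Implicit.
Unset Printing Implicit Defensive.

Import Order.TTheory GRing.Theory Num.Theory.
Import numFieldNormedType.Exports.

Local Open Scope classical_set_scope.
Local Open Scope ring_scope.
Local Open Scope ereal_scope.

(* Completely metrizable and separable. *)
Definition polish_space (R : realType) (X : topologicalType) : Prop :=
  (exists dist : X -> X -> R,
    [/\ (forall x y, (dist x y = 0)%R <-> x = y),
        (forall x y, dist x y = dist y x),
        (forall x y z, (dist x z <= dist x y + dist y z)%R),
        (forall x, nbhs x = filter_from [set e : R | (0 < e)%R]
                              (fun e => [set y | (dist x y < e)%R]))
      & (forall u : nat -> X,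
           (forall e : R, (0 < e)%R -> exists N : nat, forall i j : nat,
              (N <= i)%N -> (N <= j)%N -> (dist (u i) (u j) < e)%R) ->
           exists l : X, u @ \oo --> l)]) /\
  (exists2 D : set X, countable D & dense D).

Notation borel X := (g_sigma_algebraType (@open X)).

(* The finite set {1, ..., N + 1}, numbered from 0, with the discrete
   sigma-algebra. It is nonempty because it carries random variables. *)
Definition label (N : nat) : Type := 'I_N.+1.

HB.instance Definition _ (N : nat) := Finite.on (label N).
HB.instance Definition _ (N : nat) := isPointed.Build (label N) (@ord0 N).
HB.instance Definition _ (N : nat) :=
  @isMeasurable.Build default_measure_display (label N)
    (@discrete_measurable (label N)) (@discrete_measurable0 (label N))
    (@discrete_measurableC (label N)) (@discrete_measurableU (label N)).

(* The library's sigma-finiteness instance for counting is tied to nat. *)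
Definition label_counting (N : nat) (R : realType) : set (label N) -> \bar R :=
  counting.

HB.instance Definition _ (N : nat) (R : realType) :=
  Measure.copy (@label_counting N R) (@counting (label N) R).

Lemma sigma_finite_label_counting (N : nat) (R : realType) :
  sigma_finite setT (@label_counting N R).
Proof.
exists (fun=> setT); first by rewrite bigcup_const.
move=> _; split => //.
by rewrite /label_counting /counting asboolT ?ltry//; exact: finite_finset.
Qed.

HB.instance Definition _ (N : nat) (R : realType) :=
  @Measure_isSigmaFinite.Build _ _ _ (@label_counting N R)
    (@sigma_finite_label_counting N R).

(* The reference measure on X * {1, ..., N + 1}: mu times counting. *)
Notation ref_measure mu N := (mu \x @label_counting N _).

(* The n-fold product measure mu^n, as an iterated integral. *)
Fixpoint pow_measure d (T : measurableType d) (R : realType)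
    (mu : {measure set T -> \bar R}) (n : nat) : set (n.-tuple T) -> \bar R :=
  match n with
  | 0 => fun E => (\1_E [tuple])%:E
  | n'.+1 => fun E =>
      \int[mu]_x pow_measure mu [set t : n'.-tuple T | E [tuple of x :: t]]
  end.

(* <<s coord_events W D >> is the sigma-algebra generated by (W k), k in D. *)
Definition coord_events (I Omega : Type) d (T : measurableType d)
    (W : I -> Omega -> T) (D : set I) : set (set Omega) :=
  [set A | exists2 k, D k & exists2 B, measurable B & A = W k @^-1` B].

(* f is a version of the conditional probability of A given <<s G >>. *)
Definition cond_prob_version d (Omega : measurableType d) (R : realType)
    (P : probability Omega R) (G : set (set Omega)) (A : set Omega)
    (f : Omega -> \bar R) : Prop :=
  [/\ measurable_fun (setT : set (g_sigma_algebraType G)) f,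
      P.-integrable setT f
    & forall B, <<s G >> B -> \int[P]_(w in B) f w = P (A `&` B)].

Section chains.
Context d (T : measurableType d) (R : realType).
Implicit Types (K : R.-pker T ~> T) (A : set T) (z : T).

Definition markov_step d' (Omega : measurableType d') (P : probability Omega R)
    (G : set (set Omega)) (W W' : Omega -> T) K : Prop :=
  forall C, measurable C ->
    cond_prob_version P G (W' @^-1` C) (fun w => K (W w) C).

Definition markov_chain d' (Omega : measurableType d') (P : probability Omega R)
    (W : nat -> Omega -> T) K : Prop :=
  (forall n, measurable_fun setT (W n)) /\
  forall n, markov_step P (coord_events W [set i | (i <= n)%N])
                          (W n) (W n.+1) K.

Definition two_sided_markov_chain d' (Omega : measurableType d')
    (P : probability Omega R) (W : int -> Omega -> T) K : Prop :=
  (forall k, measurable_fun setT (W k)) /\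
  forall k : int, markov_step P (coord_events W [set i : int | (i <= k)%R])
                                (W k) (W (k + 1)%R) K.

Definition stationary d' (Omega : measurableType d') (P : probability Omega R)
    (W : int -> Omega -> T) : Prop :=
  forall (n : nat) (i h : int) (C : set (n.-tuple T)), measurable C ->
    P [set w | C [tuple W (i + h + j%:Z)%R w | j < n]] =
    P [set w | C [tuple W (i + j%:Z)%R w | j < n]].

Definition path_coord (n : nat) (w : nat -> T) : T := w n.

Definition path_space : Type := g_sigma_algebraType (coord_events path_coord setT).

HB.instance Definition _ := Measurable.on path_space.

(* Q is the law P_z of the chain with kernel K started at z. *)
Definition chain_law K z (Q : probability path_space R) : Prop :=
  markov_chain Q path_coord K /\
  forall C, measurable C -> Q [set w | C (w 0%N)] = \d_z C.

Definition visits_later A : set path_space :=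
  \bigcup_(n in [set n | (0 < n)%N]) [set w | A (w n)].

Definition visits_io A : set path_space :=
  lim_sup_set (fun n => [set w | A (w n)]).

(* The zero measure is excluded: every chain would be irreducible for it. *)
Definition irreducible_for (Pz : T -> probability path_space R)
    (phi : {sigma_finite_measure set T -> \bar R}) : Prop :=
  0 < phi setT /\
  forall A, measurable A -> 0 < phi A -> forall z, 0 < Pz z (visits_later A).

Definition maximal_irreducibility (Pz : T -> probability path_space R)
    (psi : {sigma_finite_measure set T -> \bar R}) : Prop :=
  irreducible_for Pz psi /\
  forall phi : {sigma_finite_measure set T -> \bar R},
    irreducible_for Pz phi -> phi `<< psi.

(* The laws P_z exist (Ionescu-Tulcea) and are determined by K, so that
   quantifying over them existentially is only a way of naming them; likewise
   any two maximal irreducibility measures have the same null sets. *)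
Definition harris_recurrent K : Prop :=
  exists2 Pz : T -> probability path_space R,
    (forall z, chain_law K z (Pz z)) &
    exists2 psi : {sigma_finite_measure set T -> \bar R},
      maximal_irreducibility Pz psi &
      forall A, measurable A -> 0 < psi A -> forall z, Pz z (visits_io A) = 1.

Definition positive_kernel K : Prop :=
  exists pi : probability T R,
    forall A, measurable A -> \int[pi]_z K z A = pi A.

Definition positive_harris K : Prop := harris_recurrent K /\ positive_kernel K.

(* A transition kernel of a process is determined only almost everywhere;
   the process is Harris recurrent when some version of it is. *)
Definition harris_recurrent_process d' (Omega : measurableType d')
    (P : probability Omega R) (W : nat -> Omega -> T) : Prop :=
  exists2 K, markov_chain P W K & harris_recurrent K.

End chains.

Section model.
Context d (X : measurableType d) (N : nat) (R : realType).
Local Notation Y := (label N).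
Local Notation Z := (X * label N)%type.
Implicit Types (p : Z -> R) (q : Z -> Z -> R).

(* p(z_1) q(z_2|z_1) ... q(z_n|z_(n-1)), where q z' z stands for q(z'|z). *)
Definition path_density p q (s : seq Z) : R :=
  if s is z :: s' then
    (p z * \prod_(c <- pairmap (fun a b => q b a) z s') c)%R
  else 1%R.

Definition Ystar p q (n : nat) (x : n.-tuple X) : set (Y * Y) :=
  [set yy | exists y : n.-tuple Y,
     [/\ yy = (head point y, last point y) & (0 < path_density p q (zip x y))%R]].

Definition conditionA1' p q (r : nat) (E : set (r.-tuple X)) : Prop :=
  measurable E /\
  exists S : set (Y * Y),
    [/\ (forall x, E x -> Ystar p q x = S),
        S !=set0
      & S = (fst @` S) `*` (snd @` S)].

Definition conditionA2' (mu : {measure set X -> \bar R})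
    (r : nat) (E : set (r.-tuple X)) : Prop :=
  0 < pow_measure mu E.

(* nu t l n w v is a version of P(Y_(t:t+m-1) = v | X_(l:n))(w). *)
Definition smoothing_versions d' (Omega : measurableType d')
    (P : probability Omega R) (W : int -> Omega -> Z) (m : nat)
    (nu : int -> int -> int -> Omega -> m.-tuple Y -> R) : Prop :=
  forall (t l n : int) (v : m.-tuple Y), (l <= n)%R ->
    cond_prob_version P
      (coord_events (fun k w => (W k w).1) [set k : int | (l <= k <= n)%R])
      [set w | [tuple (W (t + j%:Z)%R w).2 | j < m] = v]
      (fun w => (nu t l n w v)%:E).

End model.

Definition tv_norm (R : realType) (V : finType) (xi : V -> R) : R :=
  (\sum_(v : V) `|xi v|)%R.

(* Main.v *)
Require Import Defs.
From HB Require Import structures.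
From mathcomp Require Import all_boot all_order all_algebra.
From mathcomp Require Import all_classical all_reals all_analysis.
From mathcomp Require Import measurable_realfun.
From mathcomp Require Import lra ring zify.

(** The smoothing probability of a word v of labels is a quotient of two sums over
    hidden words: the joint density of observations and labels, summed over the words
    that pass through v, and summed over all words (smoothing_formula).  Changing one
    end of the observation window only changes the vector with which a fixed vector of
    such sums is paired.  For a time
    between v and that end, let b be the vector, indexed by the label at that time, of
    the unconstrained sums over the labels on the side of v, and g the one in which the
    words through v carry signs.  As the time moves away from v, both follow the same
    linear recursion with nonnegative coefficients, the transition densities along the
    observations, so the ratios g / b stay in an interval [c, d] that can only shrink,
    and both smoothing probabilities differ in total variation by at most d - c
    (tv_le_of_signed).

    The interval shrinks strictly over good blocks.  For observations in the set E the
    product of the transition matrices has a fixed product support; on an event of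
    positive probability its positive entries are comparable up to a factor eps
    (good_block_exists), and then the length of [c, d] is multiplied by 1 - eps
    (pinched_contracts).  Charging overlapping blocks 1 - eps / L each, the distance
    after s steps is at most 2 gam ^ (number of good blocks) (past_forgetting and
    future_forgetting).

    It remains to show that the number of good blocks grows linearly, up to a random
    additive constant (linear_visits).  Harris recurrence enters through
    irreducibility: an event of the stationary chain that is invariant under the shift
    is determined by the initial state (invariant_initial), the states that determine
    it and their complement are both almost absorbing, and the irreducibility measure
    cannot live on two disjoint absorbing sets (absorbing_trivial); hence such events
    have probability 0 or 1 (zero_one).  If k P(good) > 1, the maximal ergodic inequality
    excludes that time outruns k times the number of good blocks by an unbounded amount
    with probability 1, so this almost never happens.  The reversed chain gives the
    blocks of the past, the chain itself those of the future.  Finally the least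
    constant in the resulting geometric bound is a supremum over s of functions of the
    observed blocks, which makes it measurable with respect to the required observations
    (dominating_variable). *)

Set Implicit Arguments.
Unset Strict Implicit.
Unset Printing Implicit Defensive.

Import Order.TTheory GRing.Theory Num.Theory.
Import numFieldNormedType.Exports.

Local Open Scope classical_set_scope.
Local Open Scope ring_scope.
Local Open Scope ereal_scope.

(** * Integrals as monotone functionals *)

Section ge0_functional.
Context d (T : measurableType d) (R : realType) (m : {measure set T -> \bar R}).
Variable Phi : (T -> \bar R) -> \bar R.
Hypothesis Phi_indic : forall A, measurable A ->
  Phi (fun x => (\1_A x)%:E) = m A.
Hypothesis PhiZ : forall (k : R) f, (0 <= k)%R -> measurable_fun setT f ->
  (forall x, 0 <= f x) -> Phi (fun x => k%:E * f x) = k%:E * Phi f.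
Hypothesis PhiD : forall f g, measurable_fun setT f -> measurable_fun setT g ->
  (forall x, 0 <= f x) -> (forall x, 0 <= g x) ->
  Phi (fun x => f x + g x) = Phi f + Phi g.
Hypothesis Phi_lim : forall f : nat -> T -> \bar R,
  (forall n, measurable_fun setT (f n)) -> (forall n x, 0 <= f n x) ->
  (forall x, {homo f^~ x : n n' / (n <= n')%N >-> n <= n'}) ->
  Phi (fun x => limn (f^~ x)) = limn (fun n => Phi (f n)).

Import HBNNSimple.

Lemma ge0_functional_nnsfun (f : {nnsfun T >-> R}) :
  Phi (fun x => (f x)%:E) = \int[m]_x (f x)%:E.
Proof.
pose F y x := (y * \1_(f @^-1` [set y]) x)%R.
have F0 y x : 0 <= (F y x)%:E by rewrite /F EFinM nnfun_muleindic_ge0.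
have mF y : measurable_fun setT (fun x => (F y x)%:E).
  exact/measurable_EFinP/measurableT_comp.
pose s : seq R := finmap.enum_fset (fset_set (range f)).
have fE x : (f x)%:E = \sum_(y <- s) (F y x)%:E.
  by rewrite fimfunE fsbig_finite//= sumEFin.
have -> : (fun x => (f x)%:E) = fun x => \sum_(y <- s) (F y x)%:E by exact/funext.
have s0 y : y \in s -> (0 <= y)%R.
  by rewrite [y \in s]in_fset_set// inE => -[x _ <-].
have PhiF y : (0 <= y)%R -> Phi (fun x => (F y x)%:E) = \int[m]_x (F y x)%:E.
  move=> y0; have my : measurable (f @^-1` [set y]) by [].
  rewrite integralZl_indic_nnsfun// -[in RHS](setTI (f @^-1` _)).
  rewrite setTI integral_indic// setIT -Phi_indic// -PhiZ//.
  exact/measurable_EFinP/measurable_indic.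
rewrite ge0_integral_sum//.
elim: s s0 {fE} => [|y l ih] s0.
  have -> : (fun x => \sum_(y <- [::]) (F y x)%:E) = fun x : T => (\1_(@set0 T) x)%:E.
    by apply/funext => x; rewrite big_nil indic0.
  by rewrite Phi_indic// measure0 big_nil.
under eq_fun do rewrite big_cons.
rewrite PhiD//.
- rewrite big_cons ih ?PhiF ?s0 ?mem_head// => z zl.
  by apply: s0; rewrite inE zl orbT.
- by apply: emeasurable_sum => i; exact: mF.
- by move=> x; apply: sume_ge0.
Qed.

(** The standard machine, packaged once: a positively homogeneous, additive and
    monotonically continuous functional is determined by its values on indicators,
    because nonnegative measurable functions are increasing limits of simple
    ones. *)
Lemma ge0_functionalE f : measurable_fun setT f -> (forall x, 0 <= f x) ->
  Phi f = \int[m]_x f x.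
Proof.
move=> mf f0; pose g := nnsfun_approx measurableT mf.
have fE : f = fun x => limn (fun n => (g n x)%:E).
  by apply/funext => x; apply/esym/cvg_lim => //; exact: cvg_nnsfun_approx.
have mg n : measurable_fun setT (fun x => (g n x)%:E) by exact/measurable_EFinP.
have g0 n x : 0 <= (g n x)%:E by rewrite lee_fin.
have ndg x : {homo (fun n => (g n x)%:E) : n n' / (n <= n')%N >-> n <= n'}.
  by move=> a b ab; rewrite lee_fin; exact/lefP/nd_nnsfun_approx.
rewrite fE (@Phi_lim (fun n x => (g n x)%:E))// monotone_convergence//.
by congr (limn _); apply/funext => n; exact: ge0_functional_nnsfun.
Qed.

End ge0_functional.

Lemma ge0_integral_density d (T : measurableType d) (R : realType)
    (m l : {measure set T -> \bar R}) (g : T -> R) :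
  measurable_fun setT g -> (forall x, 0 <= g x)%R ->
  (forall A, measurable A -> m A = \int[l]_(x in A) (g x)%:E) ->
  forall f, measurable_fun setT f -> (forall x, 0 <= f x) ->
  \int[m]_x f x = \int[l]_x ((g x)%:E * f x).
Proof.
move=> mg g0 mE f mf f0; apply/esym.
have mge : measurable_fun setT (EFin \o g) by exact/measurable_EFinP.
pose Phi := fun f => \int[l]_x ((g x)%:E * f x).
apply: (@ge0_functionalE _ _ _ m Phi) => // {f mf f0}.
- move=> A mA; rewrite /Phi mE// [RHS]integral_mkcond; apply: eq_integral => x _.
  by rewrite patchE indicE; case: ifPn => [|]/= xA; rewrite ?mule1 ?mule0.
- move=> k f k0 mf f0; rewrite /Phi -ge0_integralZl//.
  + by apply: eq_integral => x _; rewrite muleCA.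
  + exact: emeasurable_funM.
  + by move=> x _; rewrite mule_ge0 ?lee_fin.
- move=> f h mf mh f0 h0; rewrite /Phi -ge0_integralD//.
  + by apply: eq_integral => x _; rewrite ge0_muleDr.
  + by move=> x _; rewrite mule_ge0 ?lee_fin.
  + exact: emeasurable_funM.
  + by move=> x _; rewrite mule_ge0 ?lee_fin.
  + exact: emeasurable_funM.
- move=> f mf f0 ndf; rewrite /Phi -monotone_convergence//.
  + apply: eq_integral => x _; apply/esym/cvg_lim => //.
    apply: cvgeZl => //.
    by apply: ereal_nondecreasing_is_cvgn => a b; exact: ndf.
  + by move=> n; exact: emeasurable_funM.
  + by move=> n x _; rewrite mule_ge0 ?lee_fin.
  + by move=> x _ a b ab; rewrite lee_wpmul2l ?lee_fin// ndf.
Qed.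

(** If k is a conditional law of U given V on rectangles, it disintegrates every
    nonnegative function of the pair (V, U): both sides are measures in the
    indicator of a set, they agree on the rectangles, which generate the product
    sigma-algebra and are stable under intersection. *)
Lemma ge0_integral_disintegration d d1 d2 (O : measurableType d)
    (S : measurableType d1) (T : measurableType d2) (R : realType)
    (P : {measure set O -> \bar R}) (k : R.-sfker O ~> T)
    (V : O -> S) (U : O -> T) :
  measurable_fun setT V -> measurable_fun setT U -> P setT < +oo ->
  (forall A B, measurable A -> measurable B ->
     P ((V @^-1` A) `&` (U @^-1` B)) = \int[P]_(w in V @^-1` A) k w B) ->
  forall f : S * T -> \bar R, measurable_fun setT f -> (forall x, 0 <= f x) ->
  \int[P]_w f (V w, U w) = \int[P]_w \int[k w]_z f (V w, z).
Proof.
move=> mV mU Pfin PE f mf f0.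
have mVU : measurable_fun setT (fun w => (V w, U w)) by exact: measurable_fun_pair.
pose m := pushforward P (fun w => (V w, U w)).
have mVs (h : S * T -> \bar R) : measurable_fun setT h ->
    measurable_fun setT (fun wz : O * T => h (V wz.1, wz.2)).
  move=> mh; apply: (measurableT_comp mh); apply: measurable_fun_pair => //.
  exact: measurableT_comp.
have mi (h : S * T -> \bar R) : measurable_fun setT h -> (forall x, 0 <= h x) ->
    measurable_fun setT (fun w => \int[k w]_z h (V w, z)).
  move=> mh h0.
  exact: (measurable_fun_integral_sfinite_kernel
    (fun wz : O * T => h (V wz.1, wz.2)) k (fun _ => h0 _) (mVs _ mh)).
have mp (h : S * T -> \bar R) w : measurable_fun setT h ->
    measurable_fun setT (fun z => h (V w, z)).
  by move=> mh; apply: (measurableT_comp mh); exact: pair1_measurable.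
pose Phi := fun h : S * T -> \bar R => \int[P]_w \int[k w]_z h (V w, z).
have PhiZ (c : R) h : (0 <= c)%R -> measurable_fun setT h ->
  (forall x, 0 <= h x) -> Phi (fun x => c%:E * h x) = c%:E * Phi h.
  move=> c0 mh h0; rewrite /Phi -ge0_integralZl//.
  - by apply: eq_integral => w _; rewrite ge0_integralZl//; exact: mp.
  - exact: mi.
  - by move=> w _; exact: integral_ge0.
have PhiD h h' : measurable_fun setT h -> measurable_fun setT h' ->
  (forall x, 0 <= h x) -> (forall x, 0 <= h' x) ->
  Phi (fun x => h x + h' x) = Phi h + Phi h'.
  move=> mh mh' h0 h'0; rewrite /Phi -ge0_integralD//.
  - by apply: eq_integral => w _; rewrite ge0_integralD//; exact: mp.
  - by move=> w _; exact: integral_ge0.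
  - exact: mi.
  - by move=> w _; exact: integral_ge0.
  - exact: mi.
have Phi_lim (h : nat -> S * T -> \bar R) :
  (forall n, measurable_fun setT (h n)) -> (forall n x, 0 <= h n x) ->
  (forall x, {homo h^~ x : n n' / (n <= n')%N >-> n <= n'}) ->
  Phi (fun x => limn (h^~ x)) = limn (fun n => Phi (h n)).
  move=> mh h0 ndh; rewrite /Phi -monotone_convergence//.
  - apply: eq_integral => w _; rewrite -monotone_convergence//.
    by move=> n; exact: mp.
  - by move=> n; exact: mi.
  - by move=> n w _; exact: integral_ge0.
  - move=> w _ a b ab; apply: ge0_le_integral => //; try exact: mp.
    by move=> z _; exact: ndh.
pose m2 := fun A : set (S * T) => Phi (fun x => (\1_A x)%:E).
have mI (A : set (S * T)) : measurable A -> measurable_fun setT (fun x => (\1_A x)%:E : \bar R).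
  by move=> mA; exact/measurable_EFinP/measurable_indic.
have m20 : m2 set0 = 0.
  rewrite /m2 /Phi; under eq_integral => w _.
    under eq_integral do rewrite indic0. rewrite integral0; over.
  by rewrite integral0.
have m2_ge0 A : 0 <= m2 A.
  by apply: integral_ge0 => w _; apply: integral_ge0 => z _; rewrite lee_fin.
have m2_add : semi_sigma_additive m2.
  move=> F mF tF mUF.
  rewrite [X in _ --> X](_ : _ = \sum_(i <oo) m2 (F i)); last first.
    have sumE n : Phi (fun x => \sum_(0 <= i < n) (\1_(F i) x)%:E) =
        \sum_(0 <= i < n) m2 (F i).
      elim: n => [|n ih].
        rewrite big_geq// -[RHS]m20; congr Phi; apply/funext => x.
        by rewrite big_geq// indic0.
      rewrite big_nat_recr//= -ih -PhiD//.
      - by congr Phi; apply/funext => x; rewrite big_nat_recr.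
      - by apply: emeasurable_sum => i; exact: mI.
      - exact: mI.
      - by move=> x; apply: sume_ge0 => i _; rewrite lee_fin.
    transitivity (Phi (fun x => limn (fun n => \sum_(0 <= i < n) (\1_(F i) x)%:E))).
      by congr Phi; apply/funext => x; rewrite (indic_bigcup _ tF).
    rewrite (Phi_lim (fun n x => \sum_(0 <= i < n) (\1_(F i) x)%:E))//.
    - by rewrite (_ : (fun n => _) = (fun n => \sum_(0 <= i < n) m2 (F i)))//; apply/funext => n; exact: sumE.
    - by move=> n; apply: emeasurable_sum => i; exact: mI.
    - by move=> n x; apply: sume_ge0 => i _; rewrite lee_fin.
    - by move=> x a b ab; apply: lee_sum_nneg_natr => // i _ _; rewrite lee_fin.
  by apply: is_cvg_nneseries => i _ _; exact: m2_ge0.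
pose m2isM := isMeasure.Build _ _ _ m2 m20 m2_ge0 m2_add.
pose m2m : {measure set (S * T) -> \bar R} := HB.pack m2 m2isM.
have mE A : measurable A -> m A = m2m A.
  apply: (measure_unique [set A `*` B | A in @measurable _ S & B in @measurable _ T]
    (fun _ => setT)).
  - exact: measurable_prod_measurableType.
  - move=> _ _ [A1 mA1 [B1 mB1 <-]] [A2 mA2 [B2 mB2 <-]].
    exists (A1 `&` A2); first exact: measurableI.
    by exists (B1 `&` B2); [exact: measurableI|rewrite setXI].
  - by move=> _; exists setT => //; exists setT => //; rewrite setXTT.
  - by rewrite bigcup_const.
  - move=> _ [A1 mA1 [B1 mB1 <-]] /=.
    rewrite /m /pushforward /m2 /Phi /=.
    rewrite [X in P X](_ : _ = (V @^-1` A1) `&` (U @^-1` B1)) // PE//.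
    rewrite [LHS]integral_mkcond; apply: eq_integral => w _.
    rewrite patchE; case: ifPn => wA.
      rewrite -[B1 in LHS]setIT -integral_indic//; apply: eq_integral => z _.
      congr (_ %:E); rewrite !indicE; congr (_ %:R); congr nat_of_bool.
      apply/idP/idP; rewrite !inE//=; last by case.
      by move=> zB; split => //; move: wA; rewrite inE.
    rewrite integral0_eq// => z _.
    rewrite indicE; case: (boolP (_ \in _)) => // /[!inE] -[/= VA _].
    by move/negP: wA; rewrite inE; elim.
  - by [].
transitivity (\int[m]_x f x).
  by rewrite /m [RHS]ge0_integral_pushforward//.
transitivity (\int[m2m]_x f x).
  by apply: eq_measure_integral => A mA _; exact: mE.
by apply/esym; exact: (@ge0_functionalE _ _ _ m2m Phi).
Qed.

(** * Trajectories and one step of a Markov chain *)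

Section kernel_precomposition.
Context d d1 d2 (O : measurableType d) (S : measurableType d1)
  (T : measurableType d2) (R : realType) (K : R.-pker S ~> T) (f : O -> S).
Hypothesis mf : measurable_fun setT f.

(** The measurability proof is an argument so that the kernel instance below can be
    found from the term alone. *)
Definition kprecomp (_ : measurable_fun setT f) : O -> {measure set T -> \bar R} :=
  fun w => K (f w).

Let measurable_kprecomp U : measurable U ->
  measurable_fun setT (kprecomp mf ^~ U).
Proof. by move=> mU; exact: (measurableT_comp (measurable_kernel K U mU)). Qed.

HB.instance Definition _ := isKernel.Build _ _ O T R (kprecomp mf)
  measurable_kprecomp.

Let kprecomp_prob w : kprecomp mf w setT = 1.
Proof. exact: prob_kernel. Qed.

HB.instance Definition _ := Kernel_isProbability.Build _ _ O T R (kprecomp mf)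
  kprecomp_prob.

End kernel_precomposition.

Section paths.
Context d (T : measurableType d).
Implicit Types x y : path_space T.

Definition drop_path (n : nat) x : path_space T := fun k => x (n + k)%N.
Definition upd_path (n : nat) x (z : T) : path_space T :=
  fun k => if k == n then z else x k.
(** F is a function of the first n + 1 coordinates; stated as invariance, it applies
    to functions and to sets of trajectories alike. *)
Definition upto (U : Type) (n : nat) (F : path_space T -> U) :=
  forall x y, (forall k, (k <= n)%N -> x k = y k) -> F x = F y.

Lemma measurable_coord n : measurable_fun setT (fun x : path_space T => x n).
Proof.
move=> _ A mA; rewrite setTI; apply: sub_sigma_algebra.
by exists n => //; exists A.
Qed.

Lemma measurable_path d' (O : measurableType d') (f : O -> path_space T) :
  (forall n, measurable_fun setT (fun w => f w n)) -> measurable_fun setT f.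
Proof.
move=> mf.
have mE : @measurable _ (path_space T) = <<s coord_events (@path_coord _ T) setT >>.
  by [].
apply: (measurability _ mE).
move=> _ [_ [n _ [B mB ->]] <-].
by rewrite setTI; have := mf n measurableT B mB; rewrite setTI.
Qed.

Lemma measurable_path_tuple n (f : nat -> nat) :
  measurable_fun setT (fun x : path_space T => [tuple x (f j) | j < n]).
Proof.
apply/measurable_fun_tnthP => i.
rewrite (_ : _ \o _ = fun x : path_space T => x (f i)); first exact: measurable_coord.
by apply/funext => x; rewrite /= tnth_mktuple.
Qed.

Lemma measurable_drop_path n : measurable_fun setT (drop_path n).
Proof. by apply: measurable_path => k; apply: measurable_coord. Qed.

Lemma measurable_upd_path n :
  measurable_fun setT (fun xz : path_space T * T => upd_path n xz.1 xz.2).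
Proof.
apply: measurable_path => k; rewrite /upd_path.
case: (k == n).
  exact: measurable_snd.
exact: (measurableT_comp (measurable_coord k) measurable_fst).
Qed.

Lemma drop_path0 x : drop_path 0 x = x. Proof. by apply/funext => k; rewrite /drop_path add0n. Qed.

Lemma drop_pathD m n x : drop_path m (drop_path n x) = drop_path (n + m) x.
Proof. by apply/funext => k; rewrite /drop_path addnA. Qed.

Lemma upto_leq U m n (F : path_space T -> U) : (m <= n)%N -> upto m F -> upto n F.
Proof. by move=> mn Fm x y xy; apply: Fm => k km; apply/xy/(leq_trans km). Qed.

Lemma upto_drop U m n (F : path_space T -> U) :
  upto m F -> upto (n + m) (F \o drop_path n).
Proof.
by move=> Fm x y xy; apply: Fm => k km; apply: xy; rewrite leq_add2l.
Qed.

(** A set of trajectories that ignores the times after n is the preimage of itself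
    under the trajectory stopped at time n, which only looks at the coordinates up
    to n. *)
Lemma upto_sigma d' (O : measurableType d') (W : nat -> O -> T) n
    (A : set (path_space T)) : measurable A -> upto n A ->
  <<s coord_events W [set i | (i <= n)%N] >> ((fun w => (W ^~ w) : path_space T) @^-1` A).
Proof.
move=> mA An.
pose V w : path_space T := fun k => W (minn k n) w.
have -> : (fun w => (W ^~ w) : path_space T) @^-1` A = V @^-1` A.
  apply/funext => w; apply: An => k kn.
  by rewrite /V (minn_idPl kn).
pose O' := g_sigma_algebraType (coord_events W [set i | (i <= n)%N]).
have mV : measurable_fun (setT : set O') (V : O' -> path_space T).
  apply: measurable_path => k _ B mB; rewrite setTI.
  apply: sub_sigma_algebra; exists (minn k n) => /=; first exact: geq_minr.
  by exists B.
by have := mV measurableT A mA; rewrite setTI.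
Qed.

End paths.

Section one_step.
Context d d' (T : measurableType d) (O : measurableType d') (R : realType)
  (P : probability O R) (W : nat -> O -> T) (K : R.-pker T ~> T).
Hypothesis WK : markov_chain P W K.

Definition path_of (w : O) : path_space T := W ^~ w.

Lemma measurable_path_of : measurable_fun setT path_of.
Proof. by apply: measurable_path => n; exact: WK.1. Qed.

(** The Markov property for arbitrary nonnegative functions of the trajectory: given
    the past up to time n, the coordinate n + 1 is resampled from the kernel. *)
Lemma markov_one_step n (F : path_space T -> \bar R) :
  measurable_fun setT F -> (forall x, 0 <= F x) -> upto n.+1 F ->
  \int[P]_w F (path_of w) = \int[P]_w \int[K (W n w)]_z F (upd_path n.+1 (path_of w) z).
Proof.
move=> mF F0 Fn.
pose V w : path_space T := fun k => W (minn k n) w.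
have mV : measurable_fun setT V by apply: measurable_path => k; exact: WK.1.
have mf : measurable_fun setT (fun xz : path_space T * T => F (upd_path n.+1 xz.1 xz.2)).
  exact: (measurableT_comp mF (measurable_upd_path _)).
have FV w z : F (upd_path n.+1 (path_of w) z) = F (upd_path n.+1 (V w) z).
  apply: Fn => k kn; rewrite /upd_path; case: eqP => // /eqP kn1.
  rewrite /V /path_of (minn_idPl _)//.
  by move: kn; rewrite leq_eqVlt (negbTE kn1).
have FW w : F (path_of w) = F (upd_path n.+1 (V w) (W n.+1 w)).
  rewrite -FV; congr F; apply/funext => k; rewrite /upd_path /path_of.
  by case: eqP => // ->.
under eq_integral do rewrite FW.
under [RHS]eq_integral do under eq_integral do rewrite FV.
apply: (@ge0_integral_disintegration _ _ _ _ _ _ _ P (kprecomp K (WK.1 n)) V (W n.+1) _ _ _ _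
  (fun xz => F (upd_path n.+1 xz.1 xz.2))) => //.
- exact: WK.1.
- by rewrite [X in X < _](_ : _ = 1) ?ltry//; exact: probability_setT.
move=> A B mA mB.
have [_ _ /(_ (V @^-1` A))] := WK.2 n B mB.
rewrite setIC => -> //.
have -> : V @^-1` A = path_of @^-1` [set x | A (fun k => x (minn k n))].
  by [].
apply: upto_sigma.
  have mg : measurable_fun setT (fun x : path_space T => (fun k => x (minn k n)) : path_space T).
    by apply: measurable_path => k; exact: measurable_coord.
  by have := mg measurableT A mA; rewrite setTI.
move=> x y xy /=; congr A; apply/funext => k; apply: xy.
exact: geq_minr.
Qed.

End one_step.

(** * Almost absorbing sets of states *)

Section ergodicity.
Context d (T : measurableType d) (R : realType) (K : R.-pker T ~> T).
Variable M : probability (path_space T) R.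
Hypothesis M_shift : forall A, measurable A -> M (drop_path 1 @^-1` A) = M A.
Hypothesis M_step : forall n (F : path_space T -> \bar R),
  measurable_fun setT F -> (forall x, 0 <= F x) -> upto n.+1 F ->
  \int[M]_x F x = \int[M]_x \int[K (x n)]_z F (upd_path n.+1 x z).

Definition at_time (n : nat) (A : set T) : set (path_space T) := [set x | A (x n)].

Lemma measurable_at_time n A : measurable A -> measurable (at_time n A).
Proof. by move=> mA; have := measurable_coord n measurableT mA; rewrite setTI. Qed.

Hint Resolve measurable_at_time : core.

Lemma M_at_time n A : measurable A -> M (at_time n A) = M (at_time 0 A).
Proof.
move=> mA; elim: n => // n <-.
by rewrite -[RHS]M_shift//; exact: measurable_at_time.
Qed.

Lemma M_pair A B : measurable A -> measurable B ->
  M (at_time 0 A `&` at_time 1 B) = \int[M]_(x in at_time 0 A) K (x 0%N) B.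
Proof.
move=> mA mB.
have mAB : measurable (at_time 0 A `&` at_time 1 B) by apply: measurableI; exact: measurable_at_time.
rewrite -[at_time 0 A `&` _]setIT -integral_indic// (@M_step 0%N)//.
- rewrite [RHS]integral_mkcond; apply: eq_integral => x _.
  rewrite patchE; case: ifPn => xA.
    rewrite -[B in RHS]setIT -integral_indic//; apply: eq_integral => z _.
    congr (_ %:E); rewrite !indicE; congr (_ %:R); congr nat_of_bool.
    apply/idP/idP; rewrite !inE//=; first by case.
    by move=> zB; split => //; move: xA; rewrite inE.
  rewrite integral0_eq// => z _.
  rewrite indicE; case: (boolP (_ \in _)) => // /[!inE] -[/= xA' _].
  by move/negP: xA; rewrite inE; elim.
- exact/measurable_EFinP/measurable_indic.
- move=> x y xy; rewrite !indicE; congr (_ %:R %:E); congr nat_of_bool.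
  by apply/idP/idP; rewrite !inE /at_time /= !xy.
Qed.

(** Repeatedly discard the states from which the current set is left with positive
    probability: each round discards a null set, and the intersection of the rounds
    is absorbing from every one of its points. *)
Lemma absorbing_core A : measurable A -> M (at_time 0 A `&` at_time 1 (~` A)) = 0 ->
  exists A', [/\ measurable A', A' `<=` A, M (at_time 0 (A `\` A')) = 0 &
    forall z, A' z -> K z (~` A') = 0].
Proof.
move=> mA A0.
have mK B : measurable B -> measurable_fun setT (fun z => K z B).
  exact: measurable_kernel.
pose next B := B `&` [set z | K z (~` B) = 0].
pose A_ n := iter n next A.
have mA_ n : measurable (A_ n).
  elim: n => // n ih; apply: measurableI => //.
  by have := mK _ (measurableC ih) measurableT _ (emeasurable_set1 0); rewrite setTI.
have step n : M (at_time 0 (A_ n) `&` at_time 1 (~` A_ n)) = 0 ->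
    M (at_time 0 (A_ n `\` A_ n.+1)) = 0.
  rewrite M_pair//; last exact: measurableC.
  move=> i0.
  have mf : measurable_fun (at_time 0 (A_ n)) (fun x => K (x 0%N) (~` A_ n)).
    apply: measurable_funTS; apply: (measurableT_comp (mK _ (measurableC (mA_ n)))).
    exact: measurable_coord.
  have /(ae_eq_integral_abs _ (measurable_at_time 0 (mA_ n)) mf) :
      \int[M]_(x in at_time 0 (A_ n)) `|K (x 0%N) (~` A_ n)| = 0.
    by rewrite -[RHS]i0; apply: eq_integral => x _; rewrite gee0_abs.
  move=> [N [mN N0 sN]].
  apply: (@subset_measure0 _ _ _ M _ N) => //.
    by apply: measurable_at_time; exact: measurableD.
  move=> x [/= xn xn1]; apply: sN => /= /(_ xn) xK; apply: xn1.
  by split.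
have all0 n : M (at_time 0 (A_ n) `&` at_time 1 (~` A_ n)) = 0.
  elim: n => // n ih.
  have mD : measurable (at_time 1 (A_ n `\` A_ n.+1)).
    by apply: measurable_at_time; exact: measurableD.
  have mC : measurable (at_time 0 (A_ n) `&` at_time 1 (~` A_ n)).
    by apply: measurableI; apply: measurable_at_time => //; exact: measurableC.
  apply/eqP; rewrite eq_le measure_ge0 andbT.
  rewrite (@le_trans _ _ (M ((at_time 0 (A_ n) `&` at_time 1 (~` A_ n)) `|`
     at_time 1 (A_ n `\` A_ n.+1))))//.
    apply: le_measure; rewrite ?inE//.
    - by apply: measurableI; apply: measurable_at_time => //; exact: measurableC.
    - exact: measurableU.
    move=> x [/= [xn _] xn1].
    by case: (pselect (A_ n (x 1%N))) => xn'; [right|left].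
  apply: (le_trans (measureU2 _ _ _)) => //.
  have m1 : M (at_time 1 (A_ n `\` A_ n.+1)) = 0.
    by rewrite M_at_time ?step//; exact: measurableD.
  by rewrite [X in X + _](_ : _ = 0)// [X in _ + X](_ : _ = 0)// adde0.
exists (\bigcap_n A_ n); split.
- exact: bigcap_measurable.
- by move=> z /(_ 0%N I).
- have -> : at_time 0 (A `\` \bigcap_n A_ n) = \bigcup_n at_time 0 (A_ n `\` A_ n.+1).
    apply/seteqP; split => x /=; last first.
      move=> [n _ [xn xn1]]; split; last by move=> /(_ n.+1 I).
      by elim: n xn {xn1} => // n ih [+ _]; exact: ih.
    move=> [xA xnA]; apply: contrapT => nx; apply: xnA => n _.
    elim: n => // n xn; apply: contrapT => xn1; apply: nx.
    by exists n.
  apply/negligibleP; first by apply: bigcup_measurable => n _; apply: measurable_at_time; exact: measurableD.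
  apply: negligible_bigcup => n; apply/negligibleP; last exact: step.
  by apply: measurable_at_time; exact: measurableD.
- move=> z zA; rewrite setC_bigcap.
  apply/negligibleP; first by apply: bigcup_measurable => n _; exact: measurableC.
  apply: negligible_bigcup => n; apply/negligibleP; first exact: measurableC.
  by have [] := zA n.+1 I.
Qed.

Lemma absorbing_avoids z (Q : probability (path_space T) R) A :
  measurable A -> chain_law K z Q -> (forall z, A z -> K z (~` A) = 0) -> A z ->
  Q (visits_later (~` A)) = 0.
Proof.
move=> mA [QK Q0] KA zA.
have mCA := measurableC mA.
have mQ n : measurable (at_time n (~` A)) by exact: measurable_at_time.
have Qn n : Q (at_time n (~` A)) = 0.
  elim: n => [|n ih].
    by rewrite /at_time (Q0 _ mCA) /= diracE memNset.
  rewrite -[at_time n.+1 _]setIT -integral_indic//.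
  rewrite (markov_one_step QK (n := n) (F := fun x => (\1_(at_time n.+1 (~` A)) x)%:E))//.
  - transitivity (\int[Q]_x K (x n) (~` A)).
      apply: eq_integral => x _; rewrite -[~` A in RHS]setIT -integral_indic//.
      apply: eq_integral => y _; congr (_ %:E); rewrite !indicE; congr (_ %:R); congr nat_of_bool.
      by apply/idP/idP; rewrite !inE /at_time /= /upd_path eqxx.
    transitivity (\int[Q]_x (cst 0 x)); last by rewrite integral0.
    apply: ge0_ae_eq_integral => //.
    - by apply: (measurableT_comp (measurable_kernel K _ mCA)); exact: measurable_coord.
    - exists (at_time n (~` A)); split => // x /=; apply: contra_notP.
      by rewrite /at_time /= => xA _; rewrite KA//; exact: contrapT.
  - exact/measurable_EFinP/measurable_indic.
  - move=> x y xy; rewrite !indicE; congr (_ %:R %:E); congr nat_of_bool.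
    by apply/idP/idP; rewrite !inE /at_time /= !xy.
apply/negligibleP.
  by apply: bigcup_measurable => n _; exact: mQ.
apply: (@negligibleS _ _ _ _ (\bigcup_n at_time n (~` A))).
  by move=> x [n _ xn]; exists n.
apply: negligible_bigcup => n; apply/negligibleP; [exact: mQ|exact: Qn].
Qed.

(** By stationarity the flow out of A equals the flow into A, so that the complement
    of A is almost absorbing as soon as A is.  The absorbing cores of the two sets
    are disjoint; if both were nonempty, irreducibility would make the complement of
    each null for the irreducibility measure, which would then vanish. *)
Lemma absorbing_trivial A : harris_recurrent K -> measurable A ->
  M (at_time 0 A `&` at_time 1 (~` A)) = 0 ->
  M (at_time 0 A) = 0 \/ M (at_time 0 (~` A)) = 0.
Proof.
move=> [Pz Pz_law [psi [[psi0 psi_irr] _] _]] mA A0.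
have mCA := measurableC mA.
have CA0 : M (at_time 0 (~` A) `&` at_time 1 A) = 0.
  have m0 := measurable_at_time 0 mA; have m1 := measurable_at_time 1 mA.
  have mC0 := measurable_at_time 0 mCA; have mC1 := measurable_at_time 1 mCA.
  have e1 : M (at_time 1 A) = M (at_time 0 A `&` at_time 1 A) + M (at_time 0 (~` A) `&` at_time 1 A).
    rewrite -measureU//; try exact: measurableI.
      congr (M _); apply/seteqP; split => x.
        by move=> x1; case: (pselect (A (x 0%N))) => x0; [left|right].
      by move=> [[]|[]].
    by apply/seteqP; split => x //= -[[/= x0 _] [/= nx0 _]].
  have e0 : M (at_time 0 A) = M (at_time 0 A `&` at_time 1 A) + M (at_time 0 A `&` at_time 1 (~` A)).
    rewrite -measureU//; try exact: measurableI.
      congr (M _); apply/seteqP; split => x.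
        by move=> x1; case: (pselect (A (x 1%N))) => x0; [left|right].
      by move=> [[]|[]].
    by apply/seteqP; split => x //= -[[/= _ x0] [/= _ nx0]].
  move: e1; rewrite M_at_time// e0 A0 adde0.
  have fin C : measurable C -> M C \is a fin_num by move=> mC; exact: fin_num_measure.
  rewrite -(fineK (fin _ (measurableI _ _ m0 m1))) -(fineK (fin _ (measurableI _ _ mC0 m1))).
  rewrite -EFinD => -[] xx; congr (_ %:E).
  by move/eqP: xx; rewrite -subr_eq0 opprD addNKr oppr_eq0 => /eqP.
have [A1 [mA1 A1A MA1 KA1]] := absorbing_core mA A0.
have [A2 [mA2 A2A MA2 KA2]] : exists A', [/\ measurable A', A' `<=` ~` A, M (at_time 0 (~` A `\` A')) = 0 &
    forall z, A' z -> K z (~` A') = 0].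
  by apply: absorbing_core => //; rewrite setCK.
have psi_null B : measurable B -> (forall z, B z -> K z (~` B) = 0) -> B !=set0 -> psi (~` B) = 0.
  move=> mB KB [z Bz]; apply: contrapT => /eqP psiB.
  have /(psi_irr _ (measurableC mB))/(_ z) : 0 < psi (~` B) by rewrite lt0e psiB measure_ge0.
  by rewrite (absorbing_avoids mB (Pz_law z) KB Bz) ltxx.
have M_null B B' : measurable B -> measurable B' -> B' `<=` B -> M (at_time 0 (B `\` B')) = 0 ->
    B' = set0 -> M (at_time 0 B) = 0.
  by move=> mB mB' BB' + B'0; rewrite B'0 setD0.
have [A10|A1n] := eqVneq A1 set0; first by left; exact: (M_null A A1).
have [A20|A2n] := eqVneq A2 set0; first by right; exact: (M_null _ A2).
have p1 := psi_null _ mA1 KA1 ((set0P _).1 A1n).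
have p2 := psi_null _ mA2 KA2 ((set0P _).1 A2n).
suff : psi setT = 0 by move=> E; move: psi0; rewrite E ltxx.
apply/negligibleP => //.
apply: (@negligibleS _ _ _ _ (~` A1 `|` ~` A2)).
  move=> z _; case: (pselect (A z)) => zA; [right|left] => zA'.
    exact: A2A zA' zA.
  exact/zA/A1A.
by apply: negligibleU; apply/negligibleP => //; exact: measurableC.
Qed.

End ergodicity.

(** * The zero-one law for shift-invariant events *)

Section real_probability.
Context d (O : measurableType d) (R : realType) (M : probability O R).

(** Probabilities as real numbers, so that linear arithmetic applies to them. *)
Definition rprob (A : set O) : R := fine (M A).

Lemma rprobE A : measurable A -> M A = (rprob A)%:E.
Proof. by move=> mA; rewrite /rprob fineK//; exact: fin_num_measure. Qed.

Lemma rprob_le A B : measurable A -> measurable B -> A `<=` B ->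
  (rprob A <= rprob B)%R.
Proof.
by move=> mA mB AB; rewrite -lee_fin -!rprobE//; apply: le_measure; rewrite ?inE.
Qed.

Lemma rprobU A B : measurable A -> measurable B ->
  (rprob (A `|` B) <= rprob A + rprob B)%R.
Proof.
move=> mA mB; rewrite -lee_fin EFinD -!rprobE//; last exact: measurableU.
exact: measureU2.
Qed.

Lemma rprob_leU A B C : measurable A -> measurable B -> measurable C ->
  A `<=` B `|` C -> (rprob A <= rprob B + rprob C)%R.
Proof.
move=> mA mB mC ABC; apply: (le_trans _ (rprobU mB mC)).
by apply: rprob_le => //; exact: measurableU.
Qed.

Lemma rprobT : rprob setT = 1%R.
Proof. by rewrite /rprob probability_setT. Qed.

End real_probability.

Section zero_one.
Context d (T : measurableType d) (R : realType) (K : R.-pker T ~> T).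
Variable M : probability (path_space T) R.
Hypothesis M_shift : forall A, measurable A -> M (drop_path 1 @^-1` A) = M A.
Hypothesis M_step : forall n (F : path_space T -> \bar R),
  measurable_fun setT F -> (forall x, 0 <= F x) -> upto n.+1 F ->
  \int[M]_x F x = \int[M]_x \int[K (x n)]_z F (upd_path n.+1 x z).

Local Notation m := (rprob M).

Definition approximable (B : set (path_space T)) := forall e : R, (0 < e)%R ->
  exists n F, [/\ measurable F, upto n F, (m (B `\` F) <= e)%R & (m (F `\` B) <= e)%R].

Lemma measurable_approximable (B : set (path_space T)) :
  measurable B -> approximable B.
Proof.
move=> mB; suff : @measurable _ (path_space T) `<=` [set B | measurable B /\ approximable B].
  by move=> /(_ _ mB)[].
have -> : @measurable _ (path_space T) = <<s coord_events (@path_coord _ T) setT >> by [].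
have apC A : measurable A /\ approximable A -> measurable (~` A) /\ approximable (~` A).
  move=> [mA aA]; split; first exact: measurableC.
  move=> e e0; have [n [F [mF Fn F1 F2]]] := aA e e0.
  exists n, (~` F); split => //.
  - exact: measurableC.
  - by move=> x y xy; rewrite /setC/= (Fn x y xy).
  - by rewrite setDE setCK setIC -setDE.
  - by rewrite setDE setCK setIC -setDE.
have apU A1 A2 : measurable A1 /\ approximable A1 -> measurable A2 /\ approximable A2 ->
    measurable (A1 `|` A2) /\ approximable (A1 `|` A2).
  move=> [mA1 aA1] [mA2 aA2]; split; first exact: measurableU.
  move=> e e0; have e20 : (0 < e / 2)%R by rewrite divr_gt0.
  have [n1 [F1 [mF1 Fn1 E11 E12]]] := aA1 _ e20.
  have [n2 [F2 [mF2 Fn2 E21 E22]]] := aA2 _ e20.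
  have mFU := measurableU _ _ mF1 mF2; have mAU := measurableU _ _ mA1 mA2.
  exists (maxn n1 n2), (F1 `|` F2); split => //.
  - move=> x y xy; rewrite /setU/= (upto_leq (leq_maxl n1 n2) Fn1 xy).
    by rewrite (upto_leq (leq_maxr n1 n2) Fn2 xy).
  - rewrite (splitr e); apply: le_trans (lerD E11 E21).
    apply: rprob_leU; do ?[exact: measurableD].
    by move=> x [[?|?] /not_orP[? ?]]; [left|right].
  - rewrite (splitr e); apply: le_trans (lerD E12 E22).
    apply: rprob_leU; do ?[exact: measurableD].
    by move=> x [[?|?] /not_orP[? ?]]; [left|right].
have ap0 : measurable (@set0 (path_space T)) /\ approximable set0.
  split => // e e0; exists 0%N, set0; split => //;
  by rewrite setD0 /rprob measure0 ltW.
suff sa : sigma_algebra setT ([set A | measurable A /\ approximable A] : set (set (path_space T))).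
  apply: smallest_sub sa _ => _ [n _ [A mA ->]]; split.
    by have := measurable_coord n measurableT mA; rewrite setTI.
  move=> e e0; exists n, (at_time n A); split => //.
  - exact: measurable_at_time.
  - by move=> x y xy; rewrite /at_time/= xy.
  - by rewrite setDv /rprob measure0 ltW.
  - by rewrite setDv /rprob measure0 ltW.
split => //; first by move=> A; rewrite setTD; exact: apC.
move=> A aA; have mA n := (aA n).1.
have mU : measurable (\bigcup_k A k) by exact: bigcup_measurable.
split => // e e0; have e20 : (0 < e / 2)%R by rewrite divr_gt0.
pose B_ n := \big[setU/set0]_(i < n) A i.
have aB n : measurable (B_ n) /\ approximable (B_ n).
  elim: n => [|n ih]; first by rewrite /B_ big_ord0.
  by rewrite /B_ big_ord_recr /=; exact: (apU _ _ ih (aA n)).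
have mAB n : measurable (\bigcup_k A k `\` B_ n) := measurableD mU (aB n).1.
have [n Bn] : exists n, (m (\bigcup_k A k `\` B_ n) <= e / 2)%R.
  have : (M \o (fun n => \bigcup_k A k `\` B_ n)) x @[x --> \oo] --> M (\bigcap_n (\bigcup_k A k `\` B_ n)).
    apply: nonincreasing_cvg_mu.
    - by apply: (le_lt_trans (probability_le1 M _)); rewrite ?ltry.
    - exact: mAB.
    - by apply: bigcapT_measurable => n; exact: mAB.
    - by move=> i j ij; apply/subsetPset; apply: setDS; exact: subset_bigsetU.
  have -> : \bigcap_n (\bigcup_k A k `\` B_ n) = set0.
    apply/seteqP; split => // x; move=> /[dup] /(_ 0%N I)[[k _ Akx] _] /(_ k.+1 I)[_]; apply.
    by rewrite /B_ big_ord_recr; right.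
  rewrite measure0 => /fine_cvgP[_ /cvgrPdist_le /(_ _ e20)[n _ /(_ n (leqnn n))]] /=.
  rewrite sub0r normrN => h; exists n; apply: le_trans h.
  exact: ler_norm.
have [k [F [mF Fk F1 F2]]] := (aB n).2 _ e20.
exists k, F; split => //.
- rewrite (splitr e); apply: le_trans (lerD Bn F1).
  apply: rprob_leU; do ?[exact: measurableD].
  + exact: mAB.
  + by apply: measurableD => //; exact: (aB n).1.
  + by move=> x [Ax Fx]; case: (pselect (B_ n x)) => ?; [right|left].
- apply: (@le_trans _ _ (m (F `\` B_ n))).
    apply: rprob_le; do ?[exact: measurableD].
    + by apply: measurableD => //; exact: (aB n).1.
    + by apply: setDS; exact: bigsetU_bigcup.
  by apply: (le_trans F2); rewrite ler_pdivrMr// ler_peMr ?ler1n// ltW.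
Qed.

(** Induction on k integrates out the last coordinate; one function phi serves all
    times n because the chain is homogeneous. *)
Lemma markov_future k (F : path_space T -> \bar R) :
  measurable_fun setT F -> (forall x, 0 <= F x) -> upto k F ->
  exists phi : T -> \bar R, [/\ measurable_fun setT phi, forall z, 0 <= phi z &
    forall n (A : set (path_space T)), measurable A -> upto n A ->
      \int[M]_(x in A) F (drop_path n x) = \int[M]_(x in A) phi (x n)].
Proof.
elim: k F => [|k ih] F mF F0 Fk.
  exists (fun z => F (fun _ => z)); split => //.
    have mc : measurable_fun setT (fun z : T => (fun _ => z) : path_space T).
      by apply: measurable_path => n; exact: measurable_id.
    exact: (measurableT_comp mF mc).
  move=> n A mA An; apply: eq_integral => x _; apply: Fk => j.
  by rewrite leqn0 => /eqP ->; rewrite /drop_path addn0.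
pose G (x : path_space T) := \int[K (x k)]_z F (upd_path k.+1 x z).
have mFu : measurable_fun setT (fun xz : path_space T * T => F (upd_path k.+1 xz.1 xz.2)).
  exact: (measurableT_comp mF (measurable_upd_path _)).
have mG : measurable_fun setT G.
  by apply: (measurable_fun_integral_sfinite_kernel
    (fun xz : path_space T * T => F (upd_path k.+1 xz.1 xz.2)) (kprecomp K (measurable_coord k))).
have G0 x : 0 <= G x by exact: integral_ge0.
have Gk : upto k G.
  move=> x y xy; rewrite /G (xy k)//; apply: eq_integral => z _; apply: Fk => j jk.
  rewrite /upd_path; case: eqP => // /eqP jk1; apply: xy.
  by move: jk; rewrite leq_eqVlt (negbTE jk1).
have [phi [mphi phi0 phiE]] := ih G mG G0 Gk.
exists phi; split => // n A mA An; rewrite -phiE//.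
pose H x := F (drop_path n x) * (\1_A x)%:E.
have mI : measurable_fun setT (fun x => (\1_A x)%:E : \bar R).
  exact/measurable_EFinP/measurable_indic.
have intE (f : path_space T -> \bar R) : \int[M]_(x in A) f x = \int[M]_x (f x * (\1_A x)%:E).
  rewrite integral_mkcond; apply: eq_integral => x _.
  by rewrite patchE indicE; case: ifPn => _; rewrite ?mule1 ?mule0.
rewrite !intE (@M_step (n + k)%N H).
- apply: eq_integral => x _.
  have iA z : \1_A (upd_path (n + k).+1 x z) = \1_A x :> R.
    rewrite !indicE; congr (_ %:R); congr nat_of_bool.
    apply/idP/idP; rewrite !inE (An _ x)// => j jn; rewrite /upd_path;
    by case: eqP => // jE; move: jn; rewrite jE ltnNge leq_addr.
  rewrite /H; under eq_integral do rewrite iA.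
  have dE z : drop_path n (upd_path (n + k).+1 x z) = upd_path k.+1 (drop_path n x) z.
    apply/funext => j; rewrite /drop_path /upd_path -addnS eqn_add2l.
    by case: eqP.
  under eq_integral do rewrite dE.
  rewrite ge0_integralZr ?lee_fin//.
  exact: (measurableT_comp mFu (pair1_measurable (drop_path n x : path_space T))).
- apply: emeasurable_funM => //; apply: (measurableT_comp mF); exact: measurable_drop_path.
- by move=> x; rewrite mule_ge0// lee_fin.
- move=> x y xy; rewrite /H.
  have -> : F (drop_path n x) = F (drop_path n y).
    by have := @upto_drop _ _ _ _ n _ Fk x y; apply => j; rewrite addnS; exact: xy.
  congr (_ * _%:E); rewrite !indicE (_ : (x \in A) = (y \in A))//.
  apply/idP/idP; rewrite !inE (An x y)// => j jn; apply: xy;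
  by rewrite (leq_trans jn)// ltnW// ltnS leq_addr.
Qed.

Lemma drop_path_setD n (A B : set (path_space T)) : drop_path n @^-1` (A `\` B) =
  (drop_path n @^-1` A) `\` (drop_path n @^-1` B).
Proof. by []. Qed.

Lemma M_drop n A : measurable A -> M (drop_path n @^-1` A) = M A.
Proof.
move=> mA; elim: n => [|n ih].
  by congr (M _); apply/seteqP; split => x /=; rewrite drop_path0.
rewrite -ih -[RHS]M_shift; last first.
  by have := measurable_drop_path n measurableT mA; rewrite setTI.
by congr (M _); apply/seteqP; split => x /=; rewrite drop_pathD add1n.
Qed.

(** Let F approximate the invariant event B and only depend on the times up to n.
    The event F' that F occurs after time n also approximates B, by invariance, and
    given the past up to n it has probability phi of the state at time n.  As F and
    F' almost coincide, B is close to the event that phi > 1/2 at time n: on the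
    part of F where phi <= 1/2 at least half of the mass lies outside F', and on the
    part outside F where phi > 1/2 at least half lies in F'.  Shifting back by n, B is
    close to the event that the initial state satisfies phi > 1/2. *)
Lemma invariant_initial_approx B : measurable B -> drop_path 1 @^-1` B = B ->
  forall e : R, (0 < e)%R -> exists D, [/\ measurable D,
    (m (B `\` at_time 0 D) <= e)%R & (m (at_time 0 D `\` B) <= e)%R].
Proof.
move=> mB invB e e0; have e50 : (0 < e / 5)%R by rewrite divr_gt0.
have [n [F [mF Fn F1 F2]]] := measurable_approximable mB e50.
have invBn k : drop_path k @^-1` B = B.
  elim: k => [|k ih].
    by apply/seteqP; split => x /=; rewrite drop_path0.
  rewrite -[RHS]ih -[in RHS]invB.
  by apply/seteqP; split => x /=; rewrite drop_pathD addn1.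
have mI : measurable_fun setT (fun x => (\1_F x)%:E : \bar R).
  exact/measurable_EFinP/measurable_indic.
have mdrop A : measurable A -> measurable (drop_path n @^-1` A).
  by move=> mA; have := measurable_drop_path n measurableT mA; rewrite setTI.
have [|| phi [mphi phi0 phiE]] := @markov_future n (fun x => (\1_F x)%:E) mI.
- by move=> x; rewrite lee_fin.
- move=> x y xy; rewrite !indicE (_ : (x \in F) = (y \in F))//.
  by apply/idP/idP; rewrite !inE (Fn x y).
pose F' := drop_path n @^-1` F.
have mF' : measurable F' by exact: mdrop.
have {}phiE (A : set (path_space T)) : measurable A -> upto n A ->
    (m (A `&` F'))%:E = \int[M]_(x in A) phi (x n).
  move=> mA An; rewrite -phiE// -rprobE; last exact: measurableI.
  by rewrite setIC -integral_indic.
pose D := [set z | (2^-1)%:E < phi z].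
have mD : measurable D.
  by rewrite /D -[X in measurable X]setTI; exact: emeasurable_fun_o_infty.
have mDn := measurable_at_time n mD.
have mD0 := measurable_at_time 0 mD.
have mphin A : measurable_fun A (fun x : path_space T => phi (x n)).
  by apply: measurable_funTS; apply: (measurableT_comp mphi); exact: measurable_coord.
exists D; split => //.
- have E : drop_path n @^-1` (B `\` at_time 0 D) = B `\` at_time n D.
    by rewrite drop_path_setD invBn; congr (_ `\` _); apply/seteqP; split => x; rewrite /at_time /= /drop_path addn0.
  rewrite /rprob -(M_drop n); last exact: measurableD.
  rewrite E -/(m _).
  pose A := F `\` at_time n D.
  have mA : measurable A by exact: measurableD.
  have An : upto n A.
    by move=> x y xy; rewrite /A /setD /at_time /= (Fn x y xy) xy.
  have A1 : (m (A `&` F') <= m A / 2)%R.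
    rewrite -lee_fin phiE// mulrC EFinM -rprobE// -integral_cst//.
    apply: ge0_le_integral => //.
    by move=> x [_ /negP]; rewrite -leNgt.
  have A2 : (m A <= m (A `&` F') + m (F `\` F'))%R.
    apply: rprob_leU => //; do ?[exact: measurableI|exact: measurableD].
    by move=> x Ax; case: (pselect (F' x)) => Fx; [left|right; split => //; case: Ax].
  have A3 : (m (F `\` F') <= m (F `\` B) + m (B `\` F'))%R.
    apply: rprob_leU => //; do ?[exact: measurableD].
    by move=> x [Fx F'x]; case: (pselect (B x)) => Bx; [right|left].
  have A4 : (m (B `\` F') <= e / 5)%R.
    rewrite -[X in m (X `\` _)](invBn n) /F' -drop_path_setD /rprob M_drop//.
    exact: measurableD.
  have A5 : (m (B `\` at_time n D) <= m (B `\` F) + m A)%R.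
    apply: rprob_leU => //; do ?[exact: measurableD].
    by move=> x [Bx Dx]; case: (pselect (F x)) => Fx; [right|left].
  by lra.
- have E : drop_path n @^-1` (at_time 0 D `\` B) = at_time n D `\` B.
    by rewrite drop_path_setD invBn; congr (_ `\` _); apply/seteqP; split => x; rewrite /at_time /= /drop_path addn0.
  rewrite /rprob -(M_drop n); last exact: measurableD.
  rewrite E -/(m _).
  pose A := at_time n D `\` F.
  have mA : measurable A by exact: measurableD.
  have An : upto n A.
    by move=> x y xy; rewrite /A /setD /at_time /= (Fn x y xy) xy.
  have A1 : (m A / 2 <= m (A `&` F'))%R.
    rewrite -lee_fin phiE// mulrC EFinM -rprobE// -integral_cst//.
    apply: ge0_le_integral => //.
    - by move=> x _; rewrite lee_fin.
    - by move=> x [xD _]; exact: ltW.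
  have A2 : (m (A `&` F') <= m (F' `\` F))%R.
    apply: rprob_le => //; do ?[exact: measurableI|exact: measurableD].
    by move=> x [[]].
  have A3 : (m (F' `\` F) <= m (F' `\` B) + m (B `\` F))%R.
    apply: rprob_leU => //; do ?[exact: measurableD].
    by move=> x [Fx F'x]; case: (pselect (B x)) => Bx; [right|left].
  have A4 : (m (F' `\` B) <= e / 5)%R.
    rewrite -[X in m (_ `\` X)](invBn n) /F' -drop_path_setD /rprob M_drop//.
    exact: measurableD.
  have A5 : (m (at_time n D `\` B) <= m A + m (F `\` B))%R.
    apply: rprob_leU => //; do ?[exact: measurableD].
    by move=> x [Bx Dx]; case: (pselect (F x)) => Fx; [right|left].
  by lra.
Qed.

(** Approximations with summable errors: by Borel-Cantelli the upper limit of the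
    approximating sets of states works exactly. *)
Lemma invariant_initial B : measurable B -> drop_path 1 @^-1` B = B ->
  exists D, [/\ measurable D, M (B `\` at_time 0 D) = 0 & M (at_time 0 D `\` B) = 0].
Proof.
move=> mB invB.
have e_gt0 k : (0 < 1 / (2 ^ k.+1)%:R :> R)%R by rewrite divr_gt0// ltr0n expn_gt0.
pose D k := projT1 (cid (invariant_initial_approx mB invB (e_gt0 k))).
have DP k : [/\ measurable (D k), (m (B `\` at_time 0 (D k)) <= 1 / (2 ^ k.+1)%:R)%R &
    (m (at_time 0 (D k) `\` B) <= 1 / (2 ^ k.+1)%:R)%R].
  by rewrite /D; case: cid.
have mD k : measurable (D k) by have [] := DP k.
have mDk k := measurable_at_time 0 (mD k).
have limsup0 (F : nat -> set (path_space T)) : (forall k, measurable (F k)) ->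
    (forall k, (m (F k) <= 1 / (2 ^ k.+1)%:R)%R) -> M (lim_sup_set F) = 0.
  move=> mF Fk; apply: lim_sup_set_cvg0 => //.
  apply: (@le_lt_trans _ _ (\sum_(0 <= k <oo) (1 / (2 ^ k.+1)%:R)%:E)).
    by apply: lee_nneseries => // k _; have := Fk k; rewrite -lee_fin -rprobE.
  by apply: le_lt_trans (epsilon_trick0 _ _) (ltry _).
have mls (F : nat -> set (path_space T)) : (forall k, measurable (F k)) -> measurable (lim_sup_set F).
  move=> mF; apply: bigcapT_measurable => n.
  by apply: bigcup_measurable.
exists (lim_sup_set D); split.
- by apply: bigcapT_measurable => n; apply: bigcup_measurable.
- have /(subset_measure0 _ _ _) : M (lim_sup_set (fun k => B `\` at_time 0 (D k))) = 0.
    by apply: limsup0 => k; [exact: measurableD|have [] := DP k].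
  apply.
  + apply: measurableD => //; apply: measurable_at_time.
    by apply: bigcapT_measurable => n; apply: bigcup_measurable.
  + by apply: mls => k; exact: measurableD.
  + move=> x [Bx]; rewrite /at_time /= => nD n _.
    have [n0 nDn0] : exists n0, forall k, (n0 <= k)%N -> ~ D k (x 0%N).
      apply: contrapT => h; apply: nD => n0 _.
      apply: contrapT => h'; apply: h; exists n0 => k n0k Dk; apply: h'; by exists k.
    exists (maxn n n0); first by rewrite /= leq_maxl.
    by split => //; apply: nDn0; exact: leq_maxr.
- have /(subset_measure0 _ _ _) : M (lim_sup_set (fun k => at_time 0 (D k) `\` B)) = 0.
    by apply: limsup0 => k; [exact: measurableD|have [] := DP k].
  apply.
  + apply: measurableD => //; apply: measurable_at_time.
    by apply: bigcapT_measurable => n; apply: bigcup_measurable.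
  + by apply: mls => k; exact: measurableD.
  + move=> x [Dx nB] n _; have [k nk Dk] := Dx n I.
    by exists k.
Qed.

(** The set D of initial states that determines B is almost absorbing, since B is
    invariant. *)
Lemma zero_one B : harris_recurrent K -> measurable B -> drop_path 1 @^-1` B = B ->
  M B = 0 \/ M (~` B) = 0.
Proof.
move=> KH mB invB.
have [D [mD D1 D2]] := invariant_initial mB invB.
have mD0 := measurable_at_time 0 mD; have mD1 := measurable_at_time 1 mD.
have mCD := measurableC mD.
have mCD0 := measurable_at_time 0 mCD; have mCD1 := measurable_at_time 1 mCD.
have mBD := measurableD mB mD0; have mDB := measurableD mD0 mB.
have nU (A A1 A2 : set (path_space T)) : measurable A -> measurable A1 -> measurable A2 -> M A1 = 0 -> M A2 = 0 ->
    A `<=` A1 `|` A2 -> M A = 0.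
  move=> mA mA1 mA2 A10 A20 AA; apply/negligibleP => //.
  by apply: (negligibleS AA); apply: negligibleU; apply/negligibleP.
have [|Z0|Z0] := @absorbing_trivial _ _ _ K M M_shift M_step D KH mD.
- apply: (nU _ (at_time 0 D `\` B) (drop_path 1 @^-1` (B `\` at_time 0 D))) => //.
  + exact: measurableI.
  + by have := measurable_drop_path 1 measurableT mBD; rewrite setTI.
  + by rewrite M_shift.
  + move=> x [x0 x1]; case: (pselect (B x)) => Bx; [right|left] => //.
    split; first by rewrite -[B]invB in Bx.
    by [].
- left; apply: (nU _ _ _ mB mBD mD0) => //.
  by move=> x Bx; case: (pselect (D (x 0%N))) => ?; [right|left].
- right; apply: (nU _ _ _ (measurableC mB) mDB mCD0) => //.
  by move=> x Bx; case: (pselect (D (x 0%N))) => ?; [left|right].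
Qed.

End zero_one.

(** * Linear growth of visit counts *)

Section visits.
Context d (T : measurableType d) (R : realType).
Variable M : probability (path_space T) R.
Hypothesis M_shift : forall A, measurable A -> M (drop_path 1 @^-1` A) = M A.
Variable e : set (path_space T).
Hypothesis me : measurable e.
Variable k : nat.

Local Notation m := (rprob M).

Definition visit_count n (x : path_space T) : R := (\sum_(i < n) \1_e (drop_path i x))%R.

Lemma visit_countS n x :
  visit_count n.+1 x = (\1_e x + visit_count n (drop_path 1 x))%R.
Proof.
by rewrite /visit_count big_ord_recl drop_path0.
Qed.

Lemma measurable_visit_count n : measurable_fun setT (visit_count n).
Proof.
apply: measurable_sum => i.
have mi : measurable_fun setT (\1_e : path_space T -> R) by exact: measurable_indic.
exact: (measurableT_comp mi (measurable_drop_path i)).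
Qed.

Definition deficit n x : R := (n%:R - k%:R * visit_count n x)%R.

Lemma deficitS n x : deficit n.+1 x = (1 - k%:R * \1_e x + deficit n (drop_path 1 x))%R.
Proof. by rewrite /deficit visit_countS -natr1; ring. Qed.

Lemma measurable_deficit n : measurable_fun setT (deficit n).
Proof.
by apply: measurable_funB => //; apply: measurable_funM => //; exact: measurable_visit_count.
Qed.

(** The maximum of the deficits up to time n, in the recursive form that makes
    Garsia's argument a comparison of two integrals. *)
Fixpoint max_deficit n (x : path_space T) : R :=
  if n is n'.+1 then (Num.max 0 (1 - k%:R * \1_e x + max_deficit n' (drop_path 1 x)))%R
  else 0%R.

Lemma max_deficit_ge0 n x : (0 <= max_deficit n x)%R.
Proof. by case: n => //= n; rewrite le_max lexx. Qed.

Lemma max_deficit_le n x : (max_deficit n x <= n%:R)%R.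
Proof.
elim: n x => //= n ih x; rewrite ge_max ler0n /= -natr1 addrC.
apply: lerD; first exact: ih.
by rewrite lerBlDr lerDl mulr_ge0.
Qed.

Lemma max_deficit_nd n x : (max_deficit n x <= max_deficit n.+1 x)%R.
Proof.
elim: n x => [|n ih] x; first exact: max_deficit_ge0.
rewrite /= ge_max le_max lexx /= le_max; apply/orP; right.
by rewrite lerD2l; exact: ih.
Qed.

Lemma deficit_le_max n x : (deficit n x <= max_deficit n x)%R.
Proof.
elim: n x => [|n ih] x.
  by rewrite /deficit /visit_count big_ord0 mulr0 subr0.
by rewrite deficitS /= le_max lerD2l ih orbT.
Qed.

Lemma measurable_max_deficit n : measurable_fun setT (max_deficit n).
Proof.
elim: n => //= n ih; apply: measurable_maxr => //.
apply: measurable_funD; last exact: (measurableT_comp ih (measurable_drop_path 1)).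
by apply: measurable_funB => //; apply: measurable_funM => //; exact: measurable_indic.
Qed.

Definition deficit_positive n : set (path_space T) := [set x | (0 < max_deficit n x)%R].

Lemma measurable_deficit_positive n : measurable (deficit_positive n).
Proof.
have := measurable_fun_ltr (measurable_cst (0 : R)%R) (measurable_max_deficit n).
have mtrue : measurable [set true] by [].
by move=> /(_ measurableT _ mtrue); rewrite setTI.
Qed.

Lemma integral_drop (f : path_space T -> \bar R) : measurable_fun setT f ->
  (forall x, 0 <= f x) -> \int[M]_x f (drop_path 1 x) = \int[M]_x f x.
Proof.
move=> mf f0.
pose D : {mfun path_space T >-> path_space T} :=
  HB.pack (@drop_path _ T 1) (isMeasurableFun.Build _ _ _ _ _ (@measurable_drop_path _ T 1)).
transitivity (\int[distribution M D]_x f x).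
  by rewrite ge0_integral_pushforward.
by apply: (eq_measure_integral M) => A mA _; exact: M_shift.
Qed.

(** The maximal ergodic inequality for the function 1 - k * 1_e, by Garsia's proof:
    where the maximum is positive it equals 1 - k * 1_e plus the previous maximum
    seen from time 1, elsewhere it is 0; now integrate, use that the shift preserves
    the measure and that the maxima increase with n. *)
Lemma maximal_inequality n :
  (k%:R * m (e `&` deficit_positive n.+1) <= m (deficit_positive n.+1))%R.
Proof.
have mA := measurable_deficit_positive n.+1.
set A := deficit_positive n.+1.
have mE n' : measurable_fun setT (fun x => (max_deficit n' x)%:E).
  by apply/measurable_EFinP; exact: measurable_max_deficit.
have meA : measurable (e `&` A) by exact: measurableI.
have mI (B : set (path_space T)) : measurable B -> measurable_fun setT (fun x => (\1_B x)%:E : \bar R).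
  by move=> mB; apply/measurable_EFinP; exact: measurable_indic.
have fin n' : \int[M]_x (max_deficit n' x)%:E \is a fin_num.
  rewrite ge0_fin_numE; last by apply: integral_ge0 => x _; rewrite lee_fin max_deficit_ge0.
  apply: (@le_lt_trans _ _ (\int[M]_x (n'%:R)%:E)).
    apply: ge0_le_integral => //.
    - by move=> x _; rewrite lee_fin max_deficit_ge0.
    - by move=> x _; rewrite lee_fin max_deficit_le.
  by rewrite integral_cst// [X in _ * X](_ : _ = 1) ?mule1 ?ltry//; exact: probability_setT.
have : \int[M]_x ((max_deficit n.+1 x)%:E + (k%:R)%:E * (\1_(e `&` A) x)%:E) <=
       \int[M]_x ((\1_A x)%:E + (max_deficit n (drop_path 1 x))%:E).
  apply: ge0_le_integral => //.
  - by move=> x _; rewrite -EFinM -EFinD lee_fin addr_ge0 ?max_deficit_ge0 ?mulr_ge0.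
  - apply: emeasurable_funD; first exact: mE.
    by apply: emeasurable_funM => //; exact: mI.
  - apply: emeasurable_funD; first exact: mI.
    exact: (measurableT_comp (mE n) (measurable_drop_path 1)).
  - move=> x _; rewrite -EFinM -!EFinD lee_fin indicI /=.
    case: (ltP 0 (max_deficit n.+1 x))%R => x0.
      have -> : (\1_A x = 1 :> R)%R by rewrite indicE mem_set.
      rewrite mulr1; move: x0 => /=; set u := (1 - _ + _)%R => u0.
      have -> : Num.max 0%R u = u.
        by move: u0; rewrite lt_max ltxx /= => /ltW /max_idPr.
      by rewrite /u; lra.
    have -> : (\1_A x = 0 :> R)%R by rewrite indicE memNset// /A /deficit_positive /= => /lt_geF; rewrite x0.
    by rewrite mulr0 mulr0 addr0 add0r (le_trans x0)// max_deficit_ge0.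
have mZ : measurable_fun setT (fun x => (k%:R : R)%:E * (\1_(e `&` A) x)%:E).
  by apply: emeasurable_funM => //; exact: mI.
have mD : measurable_fun setT (fun x => (max_deficit n (drop_path 1 x))%:E).
  exact: (measurableT_comp (mE n) (measurable_drop_path 1)).
have g0 n' x : 0 <= (max_deficit n' x)%:E by rewrite lee_fin max_deficit_ge0.
have i0 x : 0 <= (k%:R : R)%:E * (\1_(e `&` A) x)%:E by rewrite -EFinM lee_fin mulr_ge0.
rewrite ge0_integralD//.
rewrite [in leRHS]ge0_integralD//; last exact: mI.
rewrite (integral_drop (mE n)); last by move=> x; rewrite lee_fin max_deficit_ge0.
rewrite ge0_integralZl//; last exact: mI.
have I1 (B : set (path_space T)) : measurable B -> \int[M]_x (\1_B x)%:E = (m B)%:E.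
  by move=> mB; rewrite integral_indic// setIT; exact: rprobE.
rewrite !I1//.
have le1 : \int[M]_x (max_deficit n x)%:E <= \int[M]_x (max_deficit n.+1 x)%:E.
  apply: ge0_le_integral => //.
  - by move=> x _; rewrite lee_fin max_deficit_nd.
move: le1; rewrite -(fineK (fin n)) -(fineK (fin n.+1)) -EFinM -!EFinD !lee_fin.
lra.
Qed.

Definition unbounded_deficit : set (path_space T) :=
  [set x | forall C : nat, exists n, (C%:R < deficit n x)%R].

Lemma measurable_unbounded_deficit : measurable unbounded_deficit.
Proof.
have -> : unbounded_deficit = \bigcap_C \bigcup_n [set x | (C%:R < deficit n x)%R].
  apply/seteqP; split => x.
    by move=> h C _; have [n] := h C; exists n.
  by move=> h C; have [n _] := h C I; exists n.
apply: bigcapT_measurable => C; apply: bigcupT_measurable => n.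
have := measurable_fun_ltr (measurable_cst (C%:R : R)%R) (measurable_deficit n).
have mtrue : measurable [set true] by [].
by move=> /(_ measurableT _ mtrue); rewrite setTI.
Qed.

Lemma unbounded_deficit_drop : drop_path 1 @^-1` unbounded_deficit = unbounded_deficit.
Proof.
have i1 x : (0 <= (k%:R : R) * \1_e x <= k%:R)%R.
  by rewrite mulr_ge0//= ler_piMr// indicE; case: (_ \in _).
apply/seteqP; split => x h C.
  have [n hn] := h (C + k)%N; exists n.+1; rewrite deficitS.
  by move: hn (i1 x); rewrite natrD; lra.
have [[|n] hn] := h C.+1; last first.
  by exists n; move: hn (i1 x); rewrite deficitS -natr1; lra.
move: hn; rewrite /deficit /visit_count big_ord0 mulr0 subr0 => hn.
by exfalso; move: hn; rewrite ltr_nat.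
Qed.

(** If the deficit were a.s. unbounded, it would a.s. be positive at some time, and
    letting n tend to infinity in the maximal inequality would give k P(e) <= 1. *)
Lemma bounded_deficit_ae : (1 < k%:R * m e)%R ->
  M unbounded_deficit = 0 \/ M (~` unbounded_deficit) = 0 -> M unbounded_deficit = 0.
Proof.
move=> k1 [//|B0]; exfalso.
have mB := measurable_unbounded_deficit.
have mA := measurable_deficit_positive.
have k0 : (0 < k%:R :> R)%R.
  by rewrite ltr0n lt0n; apply: contraTneq k1 => ->; rewrite mul0r -leNgt.
have mCA n : measurable (~` deficit_positive n.+1) by apply: measurableC; exact: mA.
have : (M \o (fun n => ~` deficit_positive n.+1)) x @[x --> \oo] -->
    M (\bigcap_n ~` deficit_positive n.+1).
  apply: nonincreasing_cvg_mu => //.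
  - by apply: (le_lt_trans (probability_le1 M _)); rewrite ?ltry.
  - exact: bigcapT_measurable.
  - apply/nonincreasing_seqP => n; apply/subsetPset; apply: subsetC => x.
    by move=> /lt_le_trans; apply; exact: max_deficit_nd.
have -> : M (\bigcap_n ~` deficit_positive n.+1) = 0.
  apply: (subset_measure0 _ _ _ B0) => //.
  - exact: bigcapT_measurable.
  - exact: measurableC.
  - move=> x nA /(_ 0%N)[n hn]; apply: (nA n I).
    apply: (lt_le_trans hn); apply: (le_trans (deficit_le_max _ _)).
    exact: max_deficit_nd.
set del : R := ((k%:R * m e - 1) / k%:R)%R.
have del0 : (0 < del)%R by rewrite divr_gt0// subr_gt0.
move=> /fine_cvgP[_ /cvgrPdist_lt /(_ _ del0)[n _ /(_ n (leqnn n))]] /=.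
rewrite sub0r normrN => /(le_lt_trans (ler_norm _)) hn.
have h1 := maximal_inequality n.
have h2 : (m (deficit_positive n.+1) <= 1)%R.
  by rewrite -(rprobT M); apply: rprob_le.
have h3 : (m e <= m (e `&` deficit_positive n.+1) + m (~` deficit_positive n.+1))%R.
  apply: rprob_leU => //; first exact: measurableI.
  by move=> x ex; case: (pselect (deficit_positive n.+1 x)) => ?; [left|right].
have h4 : (k%:R * m (~` deficit_positive n.+1) < k%:R * m e - 1)%R.
  by rewrite mulrC -ltr_pdivlMr.
have h5 : (k%:R * m e <= k%:R * (m (e `&` deficit_positive n.+1) + m (~` deficit_positive n.+1)))%R.
  by rewrite ler_pM2l.
by rewrite mulrDr in h5; lra.
Qed.

End visits.

Section linear_visits.
Context d d' (T : measurableType d) (O : measurableType d') (R : realType)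
  (P : probability O R) (W : nat -> O -> T) (K : R.-pker T ~> T).
Hypothesis WK : markov_chain P W K.
Hypothesis W_shift : forall A : set (path_space T), measurable A ->
  P [set w | A (drop_path 1 (path_of W w))] = P [set w | A (path_of W w)].

(** A one-sided, quantitative substitute for the ergodic theorem: it suffices that
    the deficit is bounded for one integer k > 1/P(e), and the event that it is
    unbounded is shift-invariant. *)
Lemma linear_visits (e : set (path_space T)) : harris_recurrent K -> measurable e ->
  0 < P [set w | e (path_of W w)] ->
  exists k : nat, {ae P, forall w, exists C : nat, forall n : nat,
    (n%:R <= k%:R * visit_count R e n (path_of W w) + C%:R :> R)%R}.
Proof.
move=> KH me e0.
have mW := measurable_path_of WK.
pose W' : {mfun O >-> path_space T} := HB.pack (path_of W) (isMeasurableFun.Build _ _ _ _ _ mW).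
pose M : probability (path_space T) R := distribution P W'.
have ME A : M A = P [set w | A (path_of W w)] by [].
have M_shift A : measurable A -> M (drop_path 1 @^-1` A) = M A.
  by move=> mA; exact: W_shift.
have M_int (F : path_space T -> \bar R) : measurable_fun setT F -> (forall x, 0 <= F x) ->
    \int[M]_x F x = \int[P]_w F (path_of W w).
  by move=> mF F0; rewrite ge0_integral_pushforward.
have M_step n (F : path_space T -> \bar R) :
    measurable_fun setT F -> (forall x, 0 <= F x) -> upto n.+1 F ->
    \int[M]_x F x = \int[M]_x \int[K (x n)]_z F (upd_path n.+1 x z).
  move=> mF F0 Fn; rewrite !M_int//.
  - exact: (markov_one_step WK).
  - apply: (measurable_fun_integral_sfinite_kernel
      (fun xz : path_space T * T => F (upd_path n.+1 xz.1 xz.2)) (kprecomp K (measurable_coord n))) => //.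
    exact: (measurableT_comp mF (measurable_upd_path _)).
  - by move=> x; exact: integral_ge0.
have re0 : (0 < rprob M e)%R by rewrite -lte_fin -rprobE.
have [k k1] : exists k : nat, (1 < k%:R * rprob M e)%R.
  exists (Num.truncn (rprob M e)^-1).+1.
  by rewrite -ltr_pdivrMr// div1r truncnS_gt.
exists k.
have mB := measurable_unbounded_deficit R me k.
have := bounded_deficit_ae M_shift me k1 (zero_one M_shift M_step KH mB (unbounded_deficit_drop R e k)).
rewrite ME => B0; exists [set w | unbounded_deficit R e k (path_of W w)]; split => //.
  by have := mW measurableT _ mB; rewrite setTI.
move=> w /= nw C; apply: contrapT => h; apply: nw; exists C => n.
rewrite leNgt; apply/negP => lt; apply: h; exists n.
by rewrite /deficit ltrBrDr addrC.
Qed.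

End linear_visits.

(** * The joint law of observations and labels *)

Lemma measurable_fun_labelP d (S : measurableType d) d' (U : measurableType d') (N : nat)
    (f : label N * S -> U) :
  (forall j, measurable_fun setT (fun s => f (j, s))) -> measurable_fun setT f.
Proof.
move=> mf _ A mA; rewrite setTI.
have -> : f @^-1` A = \bigcup_(j in [set: label N]) ([set j] `*` ((fun s => f (j, s)) @^-1` A)).
  apply/seteqP; split => [[j s] fA|[j s] [j' _ [/= -> //]]].
  by exists j.
apply: fin_bigcup_measurable => [|j _]; first exact: finite_finset.
apply: measurableX => //.
by have := mf j measurableT A mA; rewrite setTI.
Qed.

Lemma ge0_integral_label (R : realType) (N : nat) (f : label N -> \bar R) :
  (forall j, 0 <= f j) ->
  \int[@label_counting N R]_j f j = \sum_(j : label N) f j.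
Proof.
move=> f0.
have -> : [set: label N] = \big[setU/set0]_(j <- index_enum (label N)) [set j].
  by rewrite -bigcup_seq; apply/seteqP; split => // j _; exists j => //=; rewrite mem_index_enum.
rewrite ge0_integral_bigsetU//.
- apply: eq_bigr => j _.
  rewrite (@eq_integral _ _ _ _ _ (cst (f j))); last by move=> x /[!inE] ->.
  rewrite integral_cst// [X in _ * X](_ : _ = 1) ?mule1//.
  by rewrite /= /label_counting /counting asboolT// fset_set1 finmap.cardfs1.
- exact: index_enum_uniq.
- by move=> i j _ _ [x [/= -> ->]].
Qed.

Section resampling.
Context d (X : measurableType d) (R : realType) (mu : {sigma_finite_measure set X -> \bar R}).
Implicit Types (F G : path_space X -> \bar R) (x : path_space X).

Definition resample1 (k : nat) F x := \int[mu]_u F (upd_path k x u).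

(** The iterated integral over the coordinates k, ..., k + t - 1.  Keeping functions
    on the whole path space avoids products of t copies of X. *)
Fixpoint resample (k t : nat) F : path_space X -> \bar R :=
  if t is t'.+1 then resample1 k (resample k.+1 t' F) else F.

Lemma measurable_upd k F : measurable_fun setT F ->
  measurable_fun setT (fun xu : path_space X * X => F (upd_path k xu.1 xu.2)).
Proof. by move=> mF; exact: (measurableT_comp mF (measurable_upd_path _)). Qed.

Lemma measurable_upd_r k F x : measurable_fun setT F ->
  measurable_fun setT (fun u : X => F (upd_path k x u)).
Proof. by move=> mF; exact: (measurableT_comp (measurable_upd k mF) (pair1_measurable x)). Qed.

Lemma resample_ge0 k t F : (forall x, 0 <= F x) -> forall x, 0 <= resample k t F x.
Proof. by elim: t k => // t ih k F0 x; apply: integral_ge0 => u _; exact: ih. Qed.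

Lemma measurable_resample k t F : measurable_fun setT F -> (forall x, 0 <= F x) ->
  measurable_fun setT (resample k t F).
Proof.
elim: t k => // t ih k mF F0.
apply: (measurable_fun_fubini_tonelli_F (fun xu : path_space X * X =>
  resample k.+1 t F (upd_path k xu.1 xu.2))).
  by apply: measurable_upd; exact: ih.
by move=> xu; exact: resample_ge0.
Qed.

Lemma upto_resample k t F : upto (k + t) F -> upto k (resample k.+1 t F).
Proof.
elim: t k => [|t ih] k Fkt /=; first by rewrite addn0 in Fkt.
have {}ih : upto k.+1 (resample k.+2 t F) by apply: ih; rewrite addSnnS.
move=> x y xy; rewrite /resample1; apply: eq_integral => u _; apply: ih => j jk.
rewrite /upd_path; case: eqP => // /eqP jk1; apply: xy.
by move: jk; rewrite leq_eqVlt (negbTE jk1).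
Qed.

Lemma eq_resample k t F G : (forall x, F x = G x) -> forall x, resample k t F x = resample k t G x.
Proof. by move=> FG x; congr (resample _ _ _ x); apply/funext. Qed.

Lemma upto_upd k (U : Type) (a : path_space X -> U) x u : upto k a -> a (upd_path k.+1 x u) = a x.
Proof.
move=> ak; apply: ak => j jk; rewrite /upd_path; case: eqP => // jE.
by move: jk; rewrite jE ltnn.
Qed.

Lemma resampleZ k t (a : path_space X -> R) F : measurable_fun setT F -> (forall x, 0 <= F x) ->
  (forall x, 0 <= a x)%R -> upto k a -> forall x,
  resample k.+1 t (fun x => (a x)%:E * F x) x = (a x)%:E * resample k.+1 t F x.
Proof.
move=> mF F0 a0; elim: t k => //= t ih k ak x; rewrite /resample1.
have ak1 : upto k.+1 a by apply: upto_leq ak; exact: leqnSn.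
rewrite -ge0_integralZl//.
- apply: eq_integral => u _; rewrite (ih k.+1)//.
  by rewrite upto_upd.
- by apply: measurable_upd_r; exact: measurable_resample.
- by move=> u _; exact: resample_ge0.
- by rewrite lee_fin.
Qed.

Lemma resample_sum k t (I : eqType) (s : seq I) (F : I -> path_space X -> \bar R) :
  (forall i, measurable_fun setT (F i)) -> (forall i x, 0 <= F i x) -> forall x,
  resample k t (fun x => \sum_(i <- s) F i x) x = \sum_(i <- s) resample k t (F i) x.
Proof.
move=> mF F0; elim: t k => //= t ih k x; rewrite /resample1.
rewrite -ge0_integral_sum//.
- by apply: eq_integral => u _; exact: ih.
- by move=> i; apply: measurable_upd_r; exact: measurable_resample.
- by move=> i u _; exact: resample_ge0.
Qed.

(** Domination of null sets passes through iterated integrals; it turns statements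
    about the density of the observations into almost sure statements. *)
Lemma resample_eq0 k t F G : measurable_fun setT F -> measurable_fun setT G ->
  (forall x, 0 <= F x) -> (forall x, 0 <= G x) ->
  (forall x, F x = 0 -> G x = 0) ->
  forall x, resample k t F x = 0 -> resample k t G x = 0.
Proof.
move=> mF mG F0 G0 FG; elim: t k => //= t ih k x; rewrite /resample1 => iF.
have mrF := measurable_upd_r k x (measurable_resample k.+1 t mF F0).
have mrG := measurable_upd_r k x (measurable_resample k.+1 t mG G0).
have : ae_eq mu setT (fun u => resample k.+1 t F (upd_path k x u)) (cst 0).
  apply/(ae_eq_integral_abs _ measurableT mrF); rewrite -[RHS]iF.
  by apply: eq_integral => u _; rewrite gee0_abs//; exact: resample_ge0.
move=> Fae.
transitivity (\int[mu]_u (cst 0 u)); last by rewrite integral0.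
apply: ge0_ae_eq_integral => //.
  by move=> u _; exact: resample_ge0.
by apply: filterS Fae => u /= h _; apply: ih; exact: h.
Qed.

End resampling.

Section weights.
Context d (X : measurableType d) (N : nat) (R : realType).
Local Notation Y := (label N).
Local Notation Z := (X * label N)%type.
Variables (p : Z -> R) (q : Z -> Z -> R).
Implicit Types (cs : seq (pred Y)) (x : path_space X) (h : seq (pred Y) -> Z -> R).

(** Labels beyond the end of the list of constraints are free, whence the default. *)
Definition first_constraint cs : Y -> R := fun j => (head xpredT cs j)%:R.

Fixpoint obeys cs (y : nat -> Y) : bool :=
  if cs is c :: cs' then c (y 0%N) && obeys cs' (fun k => y k.+1) else true.

Lemma obeys_behead cs y :
  obeys cs y = head xpredT cs (y 0%N) && obeys (behead cs) (fun k => y k.+1).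
Proof. by case: cs. Qed.

(** The transition density read along an observed trajectory. *)
Definition trans i j x : R := q (x 1%N, j) (x 0%N, i).

(** The sum, over the label words of length t that satisfy the constraints, of the
    product of the transition densities from label i along x, with a terminal
    function h of the remaining constraints and of the state reached at time t. *)
Fixpoint weight h t cs i x : R :=
  if t is t'.+1 then
    (\sum_j trans i j x * first_constraint cs j * weight h t' (behead cs) j (drop_path 1 x))%R
  else h cs (x 0%N, i).

Definition init_weight h t cs x : R :=
  (\sum_i p (x 0%N, i) * first_constraint cs i * weight h t (behead cs) i x)%R.

Hypothesis q_measurable : measurable_fun setT (fun zz : Z * Z => q zz.1 zz.2).
Hypothesis q_ge0 : forall z' z, (0 <= q z' z)%R.
Hypothesis p_measurable : measurable_fun setT p.
Hypothesis p_ge0 : forall z, (0 <= p z)%R.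

Lemma measurable_coord_label d' (O : measurableType d') (f : O -> X) (i : Y) :
  measurable_fun setT f -> measurable_fun setT (fun w => (f w, i)).
Proof. by move=> mf; apply: measurable_fun_pair => //; exact: measurable_cst. Qed.

Lemma measurable_trans i j : measurable_fun setT (trans i j).
Proof.
have mz : measurable_fun setT (fun x : path_space X => ((x 1%N, j), (x 0%N, i))).
  by apply: measurable_fun_pair; apply: measurable_coord_label; exact: measurable_coord.
exact: (measurableT_comp q_measurable mz).
Qed.

Lemma first_constraint_ge0 cs j : (0 <= first_constraint cs j)%R.
Proof. exact: ler0n. Qed.

Lemma trans_ge0 i j x : (0 <= trans i j x)%R. Proof. exact: q_ge0. Qed.

Lemma measurable_weight h t cs i : (forall cs, measurable_fun setT (h cs)) ->
  measurable_fun setT (weight h t cs i).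
Proof.
move=> mh; elim: t cs i => [|t ih] cs i /=.
  exact: (measurableT_comp (mh cs) (measurable_coord_label i (measurable_coord 0%N))).
apply: measurable_sum => j; apply: measurable_funM.
  by apply: measurable_funM => //; exact: measurable_trans.
exact: (measurableT_comp (ih _ _) (measurable_drop_path 1)).
Qed.

Lemma weight_ge0 h t cs i x : (forall cs z, (0 <= h cs z)%R) -> (0 <= weight h t cs i x)%R.
Proof.
move=> h0; elim: t cs i x => [|t ih] cs i x /=; first exact: h0.
by apply: sumr_ge0 => j _; rewrite !mulr_ge0 ?trans_ge0 ?first_constraint_ge0.
Qed.

Lemma upto_weight h t cs i : upto t (weight h t cs i).
Proof.
elim: t cs i => [|t ih] cs i x y xy /=; first by rewrite xy.
apply: eq_bigr => j _; rewrite /trans !xy//; congr (_ * _)%R.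
by apply: ih => k kt; rewrite /drop_path xy// add1n.
Qed.

Lemma measurable_init_weight h t cs : (forall cs, measurable_fun setT (h cs)) ->
  measurable_fun setT (init_weight h t cs).
Proof.
move=> mh; apply: measurable_sum => j; apply: measurable_funM; last exact: measurable_weight.
apply: measurable_funM => //.
exact: (measurableT_comp p_measurable (measurable_coord_label j (measurable_coord 0%N))).
Qed.

Lemma init_weight_ge0 h t cs x : (forall cs z, (0 <= h cs z)%R) -> (0 <= init_weight h t cs x)%R.
Proof.
move=> h0; apply: sumr_ge0 => j _.
by rewrite !mulr_ge0 ?first_constraint_ge0 ?weight_ge0 ?p_ge0.
Qed.

Lemma upto_init_weight h t cs : upto t (init_weight h t cs).
Proof.
move=> x y xy; apply: eq_bigr => j _; rewrite xy//; congr (_ * _)%R.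
exact: upto_weight.
Qed.

End weights.

Section law.
Context d (X : measurableType d) (N : nat) (R : realType).
Local Notation Y := (label N).
Local Notation Z := (X * label N)%type.
Context d' (Omega : measurableType d') (P : probability Omega R)
  (mu : {sigma_finite_measure set X -> \bar R}).
Variables (p : Z -> R) (q : Z -> Z -> R) (Q : R.-pker Z ~> Z) (W : nat -> Omega -> Z).
Hypothesis q_measurable : measurable_fun setT (fun zz : Z * Z => q zz.1 zz.2).
Hypothesis q_ge0 : forall z' z, (0 <= q z' z)%R.
Hypothesis p_measurable : measurable_fun setT p.
Hypothesis p_ge0 : forall z, (0 <= p z)%R.
Hypothesis Q_kernel : forall z C, measurable C ->
  Q z C = \int[ref_measure mu N]_(z' in C) (q z' z)%:E.
Hypothesis W0_density : forall C, measurable C ->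
  P (W 0%N @^-1` C) = \int[ref_measure mu N]_(z in C) (p z)%:E.
Hypothesis WQ : markov_chain P W Q.

Lemma ge0_integral_ref (g : Z -> R) (m : {measure set Z -> \bar R}) :
  measurable_fun setT g -> (forall z, 0 <= g z)%R ->
  (forall C, measurable C -> m C = \int[ref_measure mu N]_(z in C) (g z)%:E) ->
  forall f, measurable_fun setT f -> (forall z, 0 <= f z) ->
  \int[m]_z f z = \int[mu]_u \sum_j ((g (u, j))%:E * f (u, j)).
Proof.
move=> mg g0 mE f mf f0.
rewrite (ge0_integral_density (l := ref_measure mu N) mg)//.
have mgf : measurable_fun setT (fun z => (g z)%:E * f z).
  by apply: emeasurable_funM => //; exact/measurable_EFinP.
have gf0 z : 0 <= (g z)%:E * f z by rewrite mule_ge0// lee_fin.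
rewrite (fubini_tonelli1 (fun z => (g z)%:E * f z))//; apply: eq_integral => u _.
by rewrite /fubini_F ge0_integral_label.
Qed.

Lemma integral_Q z f : measurable_fun setT f -> (forall z, 0 <= f z) ->
  \int[Q z]_z' f z' = \int[mu]_u \sum_j ((q (u, j) z)%:E * f (u, j)).
Proof.
apply: (ge0_integral_ref (g := fun z' => q z' z)) => //.
- exact: (measurableT_comp q_measurable (pair2_measurable z)).
- by move=> C mC; exact: Q_kernel.
Qed.

Definition xpath (z : path_space Z) : path_space X := fun k => (z k).1.
Definition ypath (z : path_space Z) : nat -> Y := fun k => (z k).2.

Lemma measurable_xpath : measurable_fun setT xpath.
Proof.
apply: measurable_path => k.
exact: (measurableT_comp measurable_fst (measurable_coord k)).
Qed.

(** The law of the labels after the last observation, given the last state. *)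
Fixpoint tail_prob (cs : seq (pred Y)) (z : Z) : R :=
  if cs is c :: cs' then fine (\int[Q z]_z' ((c z'.2)%:R * tail_prob cs' z')%:E)
  else 1%R.

Lemma measurable_pred_label (c : pred Y) : measurable_fun setT (fun z : Z => (c z.2)%:R : R).
Proof.
have mc : measurable_fun setT (fun j : Y => (c j)%:R : R) by [].
exact: (measurableT_comp mc measurable_snd).
Qed.

(** The three facts are proved together because the integral that defines the next
    value is finite only when the previous one is measurable and at most 1. *)
Lemma tail_prob_prop cs : [/\ measurable_fun setT (tail_prob cs),
  forall z, (0 <= tail_prob cs z <= 1)%R &
  forall c z, (tail_prob (c :: cs) z)%:E = \int[Q z]_z' ((c z'.2)%:R * tail_prob cs z')%:E].
Proof.
have step cs' : measurable_fun setT (tail_prob cs') -> (forall z, (0 <= tail_prob cs' z <= 1)%R) ->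
   forall c : pred Y, [/\ measurable_fun setT (fun z => \int[Q z]_z' ((c z'.2)%:R * tail_prob cs' z')%:E),
     forall z, 0 <= \int[Q z]_z' ((c z'.2)%:R * tail_prob cs' z')%:E &
     forall z, \int[Q z]_z' ((c z'.2)%:R * tail_prob cs' z')%:E <= 1].
  move=> mt t01 c.
  have mf : measurable_fun setT (fun z' : Z => ((c z'.2)%:R * tail_prob cs' z')%:E).
    by apply/measurable_EFinP; apply: measurable_funM => //; exact: measurable_pred_label.
  have f0 z' : 0 <= ((c z'.2)%:R * tail_prob cs' z')%:E.
    by rewrite lee_fin mulr_ge0//; have /andP[] := t01 z'.
  split.
  - exact: (measurable_fun_integral_kernel (measurable_kernel Q) f0 mf).
  - by move=> z; exact: integral_ge0.
  - have Q1 z : Q z setT = 1 by exact: prob_kernel.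
    move=> z; rewrite -[leRHS](Q1 z) -[leRHS]mul1e -integral_cst//.
    apply: ge0_le_integral => // z' _; rewrite lee_fin.
    have /andP[t0 t1] := t01 z'; rewrite -[leRHS]mulr1.
    by apply: ler_pM => //; case: (c _).
have finQ cs' : measurable_fun setT (tail_prob cs') ->
    (forall z, (0 <= tail_prob cs' z <= 1)%R) -> forall (c : pred Y) z,
    \int[Q z]_z' ((c z'.2)%:R * tail_prob cs' z')%:E \is a fin_num.
  move=> mt t01 c z; have [_ i0 i1] := step cs' mt t01 c.
  by rewrite ge0_fin_numE// (le_lt_trans (i1 z))// ltry.
have [mt t01] : measurable_fun setT (tail_prob cs) /\ forall z, (0 <= tail_prob cs z <= 1)%R.
  elim: cs => [|c cs [mt t01]].
    by split => [|z]; [exact: measurable_cst|rewrite /= ler01 lexx].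
  have [mi i0 i1] := step cs mt t01 c.
  split; first exact: (measurableT_comp (fine_measurable measurableT) mi).
  move=> z; rewrite /= fine_ge0//= -lee_fin fineK//; exact: finQ.
split => // c z; rewrite /= fineK//; exact: finQ.
Qed.

Lemma markov_tail cs k (G : path_space Z -> \bar R) :
  measurable_fun setT G -> (forall z, 0 <= G z) -> upto k G ->
  \int[P]_w (G (path_of W w) * (obeys cs (ypath (drop_path k.+1 (path_of W w))))%:R%:E) =
  \int[P]_w (G (path_of W w) * (tail_prob cs (W k w))%:E).
Proof.
elim: cs k G => [|c cs ih] k G mG G0 Gk //.
have [mt t01 tE] := tail_prob_prop cs.
pose G' (z : path_space Z) := G z * ((c (z k.+1).2)%:R)%:E.
have mc : measurable_fun setT (fun z : path_space Z => ((c (z k.+1).2)%:R)%:E : \bar R).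
  apply/measurable_EFinP.
  exact: (measurableT_comp (measurable_pred_label c) (measurable_coord k.+1)).
have mG' : measurable_fun setT G' by exact: emeasurable_funM.
have G'0 z : 0 <= G' z by rewrite mule_ge0// lee_fin.
have G'k : upto k.+1 G'.
  by move=> x y xy; rewrite /G' xy// (Gk x y)// => j jk; apply: xy; exact: leqW.
transitivity (\int[P]_w (G' (path_of W w) * (obeys cs (ypath (drop_path k.+2 (path_of W w))))%:R%:E)).
  apply: eq_integral => w _; rewrite /G' -muleA -EFinM -natrM mulnb; congr (_ * _%:R%:E).
  rewrite /= /ypath /drop_path /= addn0; congr (nat_of_bool (_ && obeys _ _)).
  by apply/funext => j; rewrite addnS.
rewrite ih//.
rewrite (markov_one_step WQ (F := fun z => G' z * (tail_prob cs (z k.+1))%:E) (n := k)).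
- apply: eq_integral => w _; rewrite tE -ge0_integralZl//.
  + apply: eq_integral => z' _; rewrite /G' /upd_path eqxx EFinM muleA; congr (_ * _ * _).
    exact: (upto_upd _ _ Gk).
  + by apply/measurable_EFinP; apply: measurable_funM => //; exact: measurable_pred_label.
  + by move=> z' _; rewrite lee_fin mulr_ge0//; have /andP[] := t01 z'.
- apply: emeasurable_funM => //; apply/measurable_EFinP.
  exact: (measurableT_comp mt (measurable_coord k.+1)).
- by move=> z; rewrite mule_ge0// lee_fin; have /andP[] := t01 (z k.+1).
- by move=> x y xy; rewrite (G'k x y)// xy.
Qed.

Local Notation h := (fun cs z => tail_prob cs z).

Lemma tail_prob_ge0 cs z : (0 <= tail_prob cs z)%R.
Proof. by have [_ /(_ z)/andP[]] := tail_prob_prop cs. Qed.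

Lemma measurable_tail_prob cs : measurable_fun setT (tail_prob cs).
Proof. by have [] := tail_prob_prop cs. Qed.

Lemma measurable_EFin_weight t cs i k :
  measurable_fun setT (fun x : path_space X => (weight q h t cs i (drop_path k x))%:E).
Proof.
apply/measurable_EFinP.
exact: (measurableT_comp (measurable_weight q_measurable t cs i measurable_tail_prob)
  (measurable_drop_path k)).
Qed.

(** Induction on t, with one application of the Markov property for each observation;
    G carries the past up to time k through the induction. *)
Lemma markov_weights t k cs (G : path_space Z -> \bar R) (F : path_space X -> \bar R) :
  measurable_fun setT G -> (forall z, 0 <= G z) -> upto k G ->
  measurable_fun setT F -> (forall x, 0 <= F x) -> upto (k + t) F ->
  \int[P]_w (G (path_of W w) * F (xpath (path_of W w)) *
     (obeys cs (ypath (drop_path k.+1 (path_of W w))))%:R%:E) =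
  \int[P]_w (G (path_of W w) *
     resample mu k.+1 t (fun x => F x * (weight q h t cs (W k w).2 (drop_path k x))%:E)
       (xpath (path_of W w))).
Proof.
elim: t k cs G => [|t ih] k cs G mG G0 Gk mF F0 Fk.
  rewrite (markov_tail cs (k := k) (G := fun z => G z * F (xpath z))).
  - apply: eq_integral => w _ /=; rewrite -muleA /xpath /drop_path addn0.
    by rewrite -surjective_pairing.
  - by apply: emeasurable_funM => //; exact: (measurableT_comp mF measurable_xpath).
  - by move=> z; rewrite mule_ge0.
  - rewrite addn0 in Fk; move=> x y xy; rewrite (Gk x y)//; congr (_ * _).
    by apply: Fk => j jk; rewrite /xpath xy.
pose G' (z : path_space Z) := G z * (first_constraint R cs (z k.+1).2)%:E.
have mc : measurable_fun setT (fun z : path_space Z => (first_constraint R cs (z k.+1).2)%:E : \bar R).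
  apply/measurable_EFinP.
  exact: (measurableT_comp (measurable_pred_label (head xpredT cs)) (measurable_coord k.+1)).
have mG' : measurable_fun setT G' by exact: emeasurable_funM.
have G'0 z : 0 <= G' z by rewrite mule_ge0// lee_fin.
have G'k : upto k.+1 G'.
  by move=> x y xy; rewrite /G' xy// (Gk x y)// => j jk; apply: xy; exact: leqW.
pose Phi j x := F x * (weight q h t (behead cs) j (drop_path k.+1 x))%:E.
have mPhi j : measurable_fun setT (Phi j).
  by apply: emeasurable_funM => //; exact: measurable_EFin_weight.
have Phi0 j x : 0 <= Phi j x.
  by rewrite mule_ge0// lee_fin weight_ge0//; exact: tail_prob_ge0.
have Phik j : upto (k.+1 + t) (Phi j).
  move=> x y xy; rewrite /Phi (Fk x y); last by rewrite -addSnnS.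
  congr (_ * _%:E); apply: upto_weight => i it; apply: xy.
  by rewrite leq_add2l.
pose Psi j := resample mu k.+2 t (Phi j).
have mPsi j : measurable_fun setT (Psi j) by exact: measurable_resample.
have Psi0 j x : 0 <= Psi j x by exact: resample_ge0.
have Psik j : upto k.+1 (Psi j) by exact: upto_resample.
transitivity (\int[P]_w (G' (path_of W w) * F (xpath (path_of W w)) *
     (obeys (behead cs) (ypath (drop_path k.+2 (path_of W w))))%:R%:E)).
  apply: eq_integral => w _; rewrite /G' -!muleA; congr (_ * _).
  rewrite muleCA; congr (_ * _).
  rewrite -EFinM /first_constraint -natrM mulnb; congr (_%:R%:E).
  rewrite obeys_behead /= /ypath /drop_path /= addn0; congr (nat_of_bool (_ && obeys _ _)).
  by apply/funext => j; rewrite addnS.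
rewrite ih//; last by rewrite addSnnS.
pose FF (z : path_space Z) := G' z * Psi (z k.+1).2 (xpath z).
transitivity (\int[P]_w FF (path_of W w)); first by [].
have mPx : measurable_fun setT (fun z : path_space Z => Psi (z k.+1).2 (xpath z)).
  have mj : measurable_fun setT (fun jx : Y * path_space X => Psi jx.1 jx.2).
    exact: measurable_fun_labelP.
  have mp : measurable_fun setT (fun z : path_space Z => ((z k.+1).2, xpath z)).
    apply: measurable_fun_pair; last exact: measurable_xpath.
    exact: (measurableT_comp measurable_snd (measurable_coord k.+1)).
  exact: (measurableT_comp mj mp).
rewrite (markov_one_step WQ (n := k) (F := FF)).
- apply: eq_integral => w _.
  set x := xpath (path_of W w).
  have xu z' : xpath (upd_path k.+1 (path_of W w) z') = upd_path k.+1 x z'.1.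
    by apply/funext => j; rewrite /xpath /upd_path; case: eqP.
  transitivity (\int[Q (W k w)]_z' (G (path_of W w) *
      ((first_constraint R cs z'.2)%:E * Psi z'.2 (upd_path k.+1 x z'.1)))).
    apply: eq_integral => z' _; rewrite /FF xu /G' /upd_path eqxx -muleA.
    by congr (_ * _); exact: (upto_upd _ _ Gk).
  have mf : measurable_fun setT (fun z' : Z => (first_constraint R cs z'.2)%:E *
      Psi z'.2 (upd_path k.+1 x z'.1)).
    apply: emeasurable_funM.
      by apply/measurable_EFinP; exact: (measurable_pred_label (head xpredT cs)).
    have mj : measurable_fun setT (fun jx : Y * path_space X => Psi jx.1 jx.2).
      exact: measurable_fun_labelP.
    have mp : measurable_fun setT (fun z' : Z => (z'.2, upd_path k.+1 x z'.1)).
      apply: measurable_fun_pair => //.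
      exact: (measurableT_comp (measurable_upd_path k.+1) (measurableT_comp (pair1_measurable x) measurable_fst)).
    exact: (measurableT_comp mj mp).
  have f0 (z' : Z) : 0 <= (first_constraint R cs z'.2)%:E * Psi z'.2 (upd_path k.+1 x z'.1).
    by rewrite mule_ge0// lee_fin.
  rewrite ge0_integralZl//; congr (_ * _).
  rewrite integral_Q//= /resample1; apply: eq_integral => u _.
  pose a j (x : path_space X) := (trans q (W k w).2 j (drop_path k x) * first_constraint R cs j)%R.
  have a0 j y : (0 <= a j y)%R by rewrite mulr_ge0 ?first_constraint_ge0 ?trans_ge0.
  have ak j : upto k.+1 (a j).
    by move=> y y' yy; rewrite /a /trans /drop_path !yy// ?addn0 ?addn1.
  have ma j : measurable_fun setT (a j).
    apply: measurable_funM => //.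
    exact: (measurableT_comp (measurable_trans q_measurable _ _) (measurable_drop_path k)).
  transitivity (resample mu k.+2 t (fun x => \sum_j (a j x)%:E * Phi j x) (upd_path k.+1 x u)).
    rewrite resample_sum.
    + apply: eq_bigr => j _; rewrite resampleZ// muleA -EFinM; congr (_%:E * _).
      rewrite /a /trans /drop_path /upd_path addn1 eqxx addn0; congr (q _ _ * _)%R.
      by rewrite (ltn_eqF (ltnSn k)) -surjective_pairing.
    + by move=> j; apply: emeasurable_funM => //; apply/measurable_EFinP.
    + by move=> j y; rewrite mule_ge0// lee_fin.
  apply: eq_resample => y; rewrite /Phi.
  rewrite (eq_bigr (fun j => F y * (a j y * weight q h t (behead cs) j (drop_path k.+1 y))%:E)); last first.
    by move=> j _; rewrite muleCA -EFinM.
  rewrite -ge0_sume_distrr; last first.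
    by move=> j _; rewrite lee_fin mulr_ge0// weight_ge0//; exact: tail_prob_ge0.
  rewrite sumEFin; congr (_ * _%:E); apply: eq_bigr => j _.
  by rewrite drop_pathD addn1.
- exact: emeasurable_funM.
- by move=> z; rewrite mule_ge0.
- move=> z z' zz; rewrite /FF (G'k z z')// zz//; congr (_ * _).
  by apply: Psik => j jk; rewrite /xpath zz.
Qed.

(** The joint law of the observations up to time t and of the event that the labels
    obey cs has density init_weight.  The point x0 only supplies coordinates that the
    iterated integral overwrites or that lie after time t. *)
Lemma law_weights t cs (F : path_space X -> \bar R) x0 :
  measurable_fun setT F -> (forall x, 0 <= F x) -> upto t F ->
  \int[P]_w (F (xpath (path_of W w)) * (obeys cs (ypath (path_of W w)))%:R%:E) =
  resample mu 0 t.+1 (fun x => F x * (init_weight p q h t cs x)%:E) x0.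
Proof.
move=> mF F0 Ft.
pose G (z : path_space Z) := (first_constraint R cs (z 0%N).2)%:E : \bar R.
have mG : measurable_fun setT G.
  apply/measurable_EFinP.
  exact: (measurableT_comp (measurable_pred_label (head xpredT cs)) (measurable_coord 0%N)).
have G0 z : 0 <= G z by rewrite lee_fin.
have Gk : upto 0 G by move=> x y xy; rewrite /G xy.
transitivity (\int[P]_w (G (path_of W w) * F (xpath (path_of W w)) *
     (obeys (behead cs) (ypath (drop_path 1 (path_of W w))))%:R%:E)).
  apply: eq_integral => w _; rewrite /G [X in _ = X * _]muleC -!muleA; congr (_ * _).
  rewrite -EFinM /first_constraint -natrM mulnb; congr (_%:R%:E).
  by rewrite obeys_behead.
rewrite (markov_weights (t := t) (k := 0%N))//.
pose Phi j x := F x * (weight q h t (behead cs) j x)%:E.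
have mPhi j : measurable_fun setT (Phi j).
  apply: emeasurable_funM => //; apply/measurable_EFinP.
  exact: (measurable_weight q_measurable t _ _ measurable_tail_prob).
have Phi0 j x : 0 <= Phi j x.
  by rewrite mule_ge0// lee_fin weight_ge0//; exact: tail_prob_ge0.
have Phik j : upto t (Phi j).
  by move=> x y xy; rewrite /Phi (Ft x y)//; congr (_ * _%:E); exact: upto_weight.
pose Psi j := resample mu 1 t (Phi j).
have mPsi j : measurable_fun setT (Psi j) by exact: measurable_resample.
have Psi0 j x : 0 <= Psi j x by exact: resample_ge0.
have Psik j : upto 0 (Psi j) by exact: upto_resample.
pose f (z : Z) := (first_constraint R cs z.2)%:E * Psi z.2 (upd_path 0 x0 z.1).
have mf : measurable_fun setT f.
  apply: emeasurable_funM.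
    by apply/measurable_EFinP; exact: (measurable_pred_label (head xpredT cs)).
  have mj : measurable_fun setT (fun jx : Y * path_space X => Psi jx.1 jx.2).
    exact: measurable_fun_labelP.
  have mp : measurable_fun setT (fun z' : Z => (z'.2, upd_path 0 x0 z'.1)).
    apply: measurable_fun_pair => //.
    exact: (measurableT_comp (measurable_upd_path 0) (measurableT_comp (pair1_measurable x0) measurable_fst)).
  exact: (measurableT_comp mj mp).
have f0 z : 0 <= f z by rewrite mule_ge0// lee_fin.
transitivity (\int[P]_w f (W 0%N w)).
  apply: eq_integral => w _; rewrite /f /G; congr (_ * _).
  transitivity (Psi (W 0%N w).2 (xpath (path_of W w))).
    by apply: eq_resample => x; rewrite drop_path0.
  by apply: Psik => j; rewrite leqn0 => /eqP ->.
pose W0 : {mfun Omega >-> Z} := HB.pack (W 0%N) (isMeasurableFun.Build _ _ _ _ _ (WQ.1 0%N)).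
transitivity (\int[distribution P W0]_z f z).
  by rewrite ge0_integral_pushforward.
rewrite (ge0_integral_ref (g := p) (m := distribution P W0))//=.
rewrite /resample1; apply: eq_integral => u _.
pose a j (x : path_space X) := (p (x 0%N, j) * first_constraint R cs j)%R.
have a0 j y : (0 <= a j y)%R by rewrite mulr_ge0 ?first_constraint_ge0.
have ak j : upto 0 (a j) by move=> y y' yy; rewrite /a yy.
have ma j : measurable_fun setT (a j).
  apply: measurable_funM => //.
  exact: (measurableT_comp p_measurable (measurable_coord_label j (measurable_coord 0%N))).
transitivity (resample mu 1 t (fun x => \sum_j (a j x)%:E * Phi j x) (upd_path 0 x0 u)).
  rewrite resample_sum.
  + by apply: eq_bigr => j _; rewrite resampleZ// muleA -EFinM.
  + by move=> j; apply: emeasurable_funM => //; apply/measurable_EFinP.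
  + by move=> j y; rewrite mule_ge0// lee_fin.
apply: eq_resample => y; rewrite /Phi.
rewrite (eq_bigr (fun j => F y * (a j y * weight q h t (behead cs) j y)%:E)); last first.
  by move=> j _; rewrite muleCA -EFinM.
rewrite -ge0_sume_distrr; last first.
  by move=> j _; rewrite lee_fin mulr_ge0// weight_ge0//; exact: tail_prob_ge0.
by rewrite sumEFin.
Qed.

End law.

(** * Contraction of nonnegative linear recursions *)

Section contraction.
Context (R : realType) (I : finType).
Local Open Scope ring_scope.

(** A product support with comparable entries, required only as far as it concerns b:
    nothing is known about the columns at the zeros of b. *)
Definition pinched (A : I -> I -> R) (b : I -> R) (eps : R) : Prop :=
  exists hi (J : pred I), 0 <= hi /\ forall i,
    (forall j, A i j * b j = 0) \/
    (forall j, b j != 0 -> (J j -> eps * hi <= A i j <= hi) /\ (~~ J j -> A i j = 0)).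

(** Doeblin contraction: let th be the ratio of the sums of g and b over
    J.  A row of entries between eps * hi and hi pulls every ratio towards th, so
    that [c, d] may be replaced by [c + eps (th - c), d - eps (d - th)]. *)
Lemma pinched_contracts (A : I -> I -> R) (b g : I -> R) (c d eps : R) :
  0 < eps <= 1 -> (forall j, 0 <= b j) -> c <= d ->
  (forall j, c * b j <= g j <= d * b j) -> pinched A b eps ->
  exists c' d', [/\ c' <= d', d' - c' = (1 - eps) * (d - c) &
    forall i, c' * (\sum_j A i j * b j) <= \sum_j A i j * g j <=
              d' * (\sum_j A i j * b j)].
Proof.
move=> /andP[eps0 e1] b0 cd gb [hi [J [hi0 AJ]]].
pose w := \sum_(j | J j) b j; pose G := \sum_(j | J j) g j.
have w0 : 0 <= w by apply: sumr_ge0.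
have cG : c * w <= G by rewrite mulr_sumr; apply: ler_sum => j _; have /andP[] := gb j.
have Gd : G <= d * w by rewrite mulr_sumr; apply: ler_sum => j _; have /andP[] := gb j.
have g0 j : b j = 0 -> g j = 0.
  by move=> bj; have := gb j; rewrite bj !mulr0 => /andP[? ?]; apply/eqP; rewrite eq_le; apply/andP.
have [th [Gth cth thd]] : exists th, [/\ G = th * w, c <= th & th <= d].
  have [ew|nw] := eqVneq w 0.
    exists c; split => //; move: cG Gd; rewrite ew !mulr0 => ? ?.
    by apply/eqP; rewrite eq_le; apply/andP.
  have wgt0 : 0 < w by rewrite lt0r nw.
  by exists (G / w); rewrite mulfVK// ler_pdivlMr// ler_pdivrMr.
exists (c + eps * (th - c)), (d - eps * (d - th)); split.
- have : 0 <= (1 - eps) * (d - c) by rewrite mulr_ge0// subr_ge0.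
  lra.
- lra.
move=> i; have [A0|Ai] := AJ i.
  have -> : \sum_j A i j * b j = 0 by rewrite big1.
  have -> : \sum_j A i j * g j = 0.
    rewrite big1// => j _; have [bj|bj] := eqVneq (b j) 0; first by rewrite g0// mulr0.
    by have /eqP := A0 j; rewrite mulf_eq0 (negbTE bj) orbF => /eqP ->; rewrite mul0r.
  by rewrite !mulr0 lexx.
have sumJ (f : I -> R) : (forall j, b j = 0 -> f j = 0) ->
    \sum_j A i j * f j = \sum_(j | J j) A i j * f j.
  move=> f0; rewrite (bigID J)/= [X in _ + X]big1 ?addr0// => j nJ.
  have [bj|bj] := eqVneq (b j) 0; first by rewrite f0// mulr0.
  by rewrite ((Ai j bj).2 nJ) mul0r.
rewrite !sumJ//.
set B := \sum_(j | J j) A i j * b j; set H := \sum_(j | J j) A i j * g j.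
have Bhi : B <= hi * w.
  rewrite mulr_sumr; apply: ler_sum => j Jj.
  have [->|bj] := eqVneq (b j) 0; first by rewrite !mulr0.
  by rewrite ler_wpM2r//; have /andP[] := (Ai j bj).1 Jj.
have lo : eps * hi * (G - c * w) <= H - c * B.
  rewrite /G /w mulr_sumr -sumrB mulr_sumr /H /B [in X in _ <= X]mulr_sumr -sumrB.
  apply: ler_sum => j Jj.
  have [bj|bj] := eqVneq (b j) 0; first by rewrite g0// bj !mulr0 subr0 mulr0.
  have -> : A i j * g j - c * (A i j * b j) = A i j * (g j - c * b j) by ring.
  rewrite ler_wpM2r// ?subr_ge0; [by have /andP[] := gb j|by have /andP[] := (Ai j bj).1 Jj].
have up : eps * hi * (d * w - G) <= d * B - H.
  rewrite /G /w mulr_sumr -sumrB mulr_sumr /H /B [in X in _ <= X]mulr_sumr -sumrB.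
  apply: ler_sum => j Jj.
  have [bj|bj] := eqVneq (b j) 0; first by rewrite g0// bj !mulr0 subr0 mulr0.
  have -> : d * (A i j * b j) - A i j * g j = A i j * (d * b j - g j) by ring.
  rewrite ler_wpM2r// ?subr_ge0; [by have /andP[] := gb j|by have /andP[] := (Ai j bj).1 Jj].
have lo2 : eps * (th - c) * B <= eps * hi * (G - c * w).
  have -> : eps * hi * (G - c * w) = eps * (th - c) * (hi * w) by rewrite Gth; ring.
  by rewrite ler_wpM2l// mulr_ge0 ?subr_ge0// ltW.
have up2 : eps * (d - th) * B <= eps * hi * (d * w - G).
  have -> : eps * hi * (d * w - G) = eps * (d - th) * (hi * w) by rewrite Gth; ring.
  by rewrite ler_wpM2l// mulr_ge0 ?subr_ge0// ltW.
by apply/andP; split; rewrite ?mulrDl ?mulrBl; lra.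
Qed.

Lemma bernoulli_ineq (t : R) n : 0 <= t <= 1 -> 1 - n%:R * t <= (1 - t) ^+ n.
Proof.
move=> /andP[t0 t1]; elim: n => [|n ih]; first by rewrite mul0r subr0 expr0.
rewrite exprS; apply: (@le_trans _ _ ((1 - t) * (1 - n%:R * t))); last first.
  by rewrite ler_wpM2l// subr_ge0.
have : 0 <= n%:R * t * t by rewrite !mulr_ge0.
by rewrite -natr1; lra.
Qed.

Variables (L : nat) (eps : R).
Hypotheses (L_gt0 : (0 < L)%N) (eps01 : 0 < eps < 1).

(** Good blocks of length L may overlap.  Instead of selecting disjoint ones, each
    good block is credited with the factor 1 - eps / L: the factor 1 - eps that one
    block yields pays for L consecutive starting times. *)
Definition rate : R := 1 - eps / L%:R.

Lemma rate_gt0 : 0 < rate.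
Proof.
have /andP[e0 e1] := eps01; rewrite subr_gt0 ltr_pdivrMr ?ltr0n// mul1r.
by rewrite (lt_le_trans e1)// ler1n.
Qed.

Lemma rate_lt1 : rate < 1.
Proof. by have /andP[e0 e1] := eps01; rewrite gtrBl divr_gt0 ?ltr0n. Qed.

Lemma rateX : 1 - eps <= rate ^+ L.
Proof.
have L0 : L%:R != 0 :> R by rewrite pnatr_eq0 -lt0n.
apply: le_trans (bernoulli_ineq L _); first by rewrite mulrC divfK.
have /andP[e0 e1] := eps01.
rewrite divr_ge0 ?ler0n ?(ltW e0)//= ler_pdivrMr ?ltr0n// mul1r.
by rewrite (le_trans (ltW e1))// ler1n.
Qed.

Variables (b g : nat -> I -> R) (M A : nat -> I -> I -> R) (e : nat -> bool).
Hypothesis M_ge0 : forall u i j, 0 <= M u i j.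
Hypothesis bM : forall u i, b u.+1 i = \sum_j M u i j * b u j.
Hypothesis gM : forall u i, g u.+1 i = \sum_j M u i j * g u j.
Hypothesis bA : forall u i, b (u + L)%N i = \sum_j A u i j * b u j.
Hypothesis gA : forall u i, g (u + L)%N i = \sum_j A u i j * g u j.
Hypothesis gb0 : forall i, `|g 0%N i| <= b 0%N i.
Hypothesis eA : forall u, e u -> pinched (A u) (b u) eps.

Lemma pinched_ge0 u i : 0 <= b u i.
Proof.
elim: u i => [|u ih] i; first exact: le_trans (gb0 i).
by rewrite bM sumr_ge0// => j _; rewrite mulr_ge0.
Qed.

(** Two vectors b >= 0 and g that follow the same nonnegative recursion: the ratios
    g / b stay in an interval that the recursion cannot enlarge, and that shrinks by
    1 - eps over each pinched block of L steps. *)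
Lemma pinched_contraction u : exists c d, [/\ c <= d,
  d - c <= 2 * rate ^+ (\sum_(k < u.+1 - L) e k) &
  forall i, c * b u i <= g u i <= d * b u i].
Proof.
have /andP[e0 e1] := eps01.
have r0 := ltW rate_gt0; have r1 := ltW rate_lt1.
elim/ltn_ind: u => -[_|u ih].
  exists (-1), 1; split; first by lra.
    by rewrite (_ : (1 - L = 0)%N) ?big_ord0 ?expr0 ?mulr1; [lra|lia].
  by move=> i; rewrite mulN1r mul1r -ler_norml.
have one_step n : (forall c d, d - c <= 2 * rate ^+ (\sum_(k < u.+1 - L) e k) ->
    d - c <= 2 * rate ^+ n) -> exists c d, [/\ c <= d, d - c <= 2 * rate ^+ n &
    forall i, c * b u.+1 i <= g u.+1 i <= d * b u.+1 i].
  move=> Hn; have [c [d [cd dc gb]]] := ih u (ltnSn u).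
  exists c, d; split => //; first exact: Hn.
  move=> i; rewrite bM gM !mulr_sumr; apply/andP; split; apply: ler_sum => j _;
  by rewrite mulrCA ler_wpM2l//; have /andP[] := gb j.
have [uL|Lu] := ltnP u.+1 L.
  by apply: one_step => c d; rewrite (_ : (u.+1 - L = 0)%N) 1?(_ : (u.+2 - L = 0)%N)//; lia.
have [u' uE] : exists u', u.+1 = (u' + L)%N by exists (u.+1 - L)%N; lia.
have -> : (u.+2 - L = u'.+1)%N by lia.
rewrite (_ : (u.+1 - L = u')%N) in one_step; last by lia.
have [eu|neu] := boolP (e u'); last first.
  by apply: one_step => c d; rewrite big_ord_recr /= (negbTE neu) addn0.
have [|c [d [cd dc gb]]] := ih u'; first by lia.
have e01 : 0 < eps <= 1 by rewrite e0 ltW.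
have [c' [d' [cd' dc' gb']]] := pinched_contracts e01 (pinched_ge0 u') cd gb (eA eu).
(* The factor 1 - eps of the block that starts at u' pays for the L blocks that
   start at u' - L + 1, ..., u'. *)
exists c', d'; split => //; last by move=> i; rewrite uE bA gA.
rewrite dc'; apply: (@le_trans _ _ ((1 - eps) * (2 * rate ^+ (\sum_(k < u'.+1 - L) e k)))).
  by rewrite ler_wpM2l// subr_ge0 ltW.
rewrite mulrCA ler_wpM2l//.
apply: (@le_trans _ _ (rate ^+ (L + \sum_(k < u'.+1 - L) e k))).
  by rewrite exprD ler_wpM2r ?exprn_ge0 ?rateX.
apply: ler_wiXn2l; [exact: r0|exact: r1|].
have split_sum n : (\sum_(k < n) e k <= L + \sum_(k < n - L) e k)%N.
  have [nL|Ln] := leqP n L.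
    apply: (@leq_trans n); last by apply: leq_trans nL _; exact: leq_addr.
    by rewrite -[X in (_ <= X)%N]card_ord -sum1_card; apply: leq_sum => k _; case: (e k).
  have [n' ->] : exists n', n = (n' + L)%N by exists (n - L)%N; lia.
  rewrite addnK big_split_ord /= addnC leq_add2r.
  by rewrite -[X in (_ <= X)%N]card_ord -sum1_card; apply: leq_sum => k _; case: (e _).
exact: split_sum.
Qed.

End contraction.

(** Total variation is attained by the sign of the difference, hence it is enough to
    bound signed sums: the first within d of its normalisation, the second at least
    c times its own. *)
Lemma tv_le_of_signed (R : realType) (V : finType) (n1 n2 : V -> R) (D1 D2 B : R) :
  (0 < D1)%R -> (0 < D2)%R ->
  (forall s : V -> R, (forall v, `|s v| <= 1)%R -> exists c d, [/\ (d - c <= B)%R,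
     (\sum_v s v * n1 v <= d * D1)%R & (c * D2 <= \sum_v s v * n2 v)%R]) ->
  (tv_norm (fun v => n1 v / D1 - n2 v / D2) <= B)%R.
Proof.
move=> D10 D20 H; rewrite /tv_norm.
pose s v : R := Num.sg (n1 v / D1 - n2 v / D2)%R.
have [v|c [d [dc h1 h2]]] := H s.
  by rewrite normr_sg; case: (_ == _); rewrite ?ler01 ?lexx.
apply: le_trans dc.
rewrite (eq_bigr (fun v => s v * n1 v / D1 - s v * n2 v / D2)%R); last first.
  by move=> v _; rewrite normrEsg -/(s v) mulrBr !mulrA.
rewrite sumrB -!mulr_suml lerB//.
  by rewrite ler_pdivrMr.
by rewrite ler_pdivlMr.
Qed.

(** * Algebra of the weights *)

Section weight_algebra.
Context d (X : measurableType d) (N : nat) (R : realType).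
Local Notation Y := (label N).
Local Notation Z := (X * label N)%type.
Variables (p : Z -> R) (q : Z -> Z -> R).
Implicit Types (cs : seq (pred Y)) (x : path_space X) (h : seq (pred Y) -> Z -> R).
Local Open Scope ring_scope.

(** The terminal function that selects the final label j; with it the weights become
    matrix entries. *)
Definition at_label (j : Y) : seq (pred Y) -> Z -> R := fun _ z => (z.2 == j)%:R.

(** The entry (i, j) of the product of t transition matrices along x. *)
Definition multi_trans t i j x : R := weight q (at_label j) t [::] i x.

(** The row vector p(x_0, .) times the t first transition matrices along x. *)
Definition forward_weight t j x : R := init_weight p q (at_label j) t [::] x.

Lemma first_constraint_nil (j : Y) : first_constraint R [::] j = 1.
Proof. by []. Qed.

Lemma behead_drop (T : Type) (s : seq T) n : drop n (behead s) = drop n.+1 s.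
Proof. by case: s. Qed.

Lemma sum_at (f : Y -> R) i : \sum_j (i == j)%:R * f j = f i.
Proof.
rewrite (bigD1 i)//= eqxx mul1r big1 ?addr0// => j ji.
by rewrite eq_sym (negbTE ji) mul0r.
Qed.

(** Cutting the words at time t1. *)
Lemma weight_add h t1 t2 cs i x : weight q h (t1 + t2) cs i x =
  \sum_j weight q (at_label j) t1 cs i x * weight q h t2 (drop t1 cs) j (drop_path t1 x).
Proof.
elim: t1 cs i x => [|t1 ih] cs i x.
  by rewrite /= drop0 drop_path0 sum_at.
rewrite addSn /= (eq_bigr (fun k => \sum_j trans q i k x * first_constraint R cs k *
   weight q (at_label j) t1 (behead cs) k (drop_path 1 x) *
   weight q h t2 (drop t1.+1 cs) j (drop_path t1.+1 x))); last first.
  move=> k _; rewrite ih mulr_sumr; apply: eq_bigr => j _.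
  by rewrite behead_drop drop_pathD add1n mulrA.
by rewrite exchange_big /=; apply: eq_bigr => j _; rewrite mulr_suml.
Qed.

Lemma init_weight_add h t1 t2 cs x : init_weight p q h (t1 + t2) cs x =
  \sum_j init_weight p q (at_label j) t1 cs x *
         weight q h t2 (drop t1 (behead cs)) j (drop_path t1 x).
Proof.
rewrite /init_weight (eq_bigr (fun k => \sum_j p (x 0%N, k) * first_constraint R cs k *
   weight q (at_label j) t1 (behead cs) k x *
   weight q h t2 (drop t1 (behead cs)) j (drop_path t1 x))); last first.
  by move=> k _; rewrite weight_add mulr_sumr; apply: eq_bigr => j _; rewrite mulrA.
by rewrite exchange_big /=; apply: eq_bigr => j _; rewrite mulr_suml.
Qed.

Lemma forward_weight_add t1 t2 j x : forward_weight (t1 + t2) j x =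
  \sum_i forward_weight t1 i x * multi_trans t2 i j (drop_path t1 x).
Proof. exact: init_weight_add. Qed.

Hypothesis q_ge0 : forall z' z, 0 <= q z' z.
Hypothesis p_ge0 : forall z, 0 <= p z.

Lemma at_label_ge0 j cs z : 0 <= at_label j cs z. Proof. exact: ler0n. Qed.

Lemma multi_trans_ge0 t i j x : 0 <= multi_trans t i j x.
Proof. by apply: weight_ge0 => // cs z; exact: at_label_ge0. Qed.

Lemma forward_weight_ge0 t j x : 0 <= forward_weight t j x.
Proof. by apply: init_weight_ge0 => // cs z; exact: at_label_ge0. Qed.

Lemma first_constraint_le1 cs j : first_constraint R cs j <= 1.
Proof. by rewrite /first_constraint; case: (head _ _ _). Qed.

Lemma weight_le h t cs i x : (forall cs z, 0 <= h cs z <= h [::] z) ->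
  weight q h t cs i x <= weight q h t [::] i x.
Proof.
move=> h0; elim: t cs i x => [|t ih] cs i x /=; first by have /andP[] := h0 cs (x 0%N, i).
apply: ler_sum => j _; apply: ler_pM => //.
- by rewrite mulr_ge0 ?trans_ge0 ?first_constraint_ge0.
- by apply: weight_ge0 => // cs' z; have /andP[] := h0 cs' z.
- by rewrite first_constraint_nil ler_wpM2l ?trans_ge0 ?first_constraint_le1.
Qed.

Lemma init_weight_le h t cs x : (forall cs z, 0 <= h cs z <= h [::] z) ->
  init_weight p q h t cs x <= init_weight p q h t [::] x.
Proof.
move=> h0; apply: ler_sum => j _; apply: ler_pM.
- by rewrite mulr_ge0 ?p_ge0 ?first_constraint_ge0.
- by apply: weight_ge0 => // cs' z; have /andP[] := h0 cs' z.
- by rewrite first_constraint_nil ler_wpM2l ?first_constraint_le1.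
- exact: weight_le.
Qed.

Definition word_at k m (v : m.-tuple Y) : seq (pred Y) :=
  nseq k (xpredT : pred Y) ++ [seq (pred1 a : pred Y) | a <- v].

Lemma sum_tuple_cons m (F : m.+1.-tuple Y -> R) :
  \sum_v F v = \sum_a \sum_(v : m.-tuple Y) F [tuple of a :: v].
Proof.
rewrite pair_big /= (reindex (fun av : Y * m.-tuple Y => [tuple of av.1 :: av.2]))//=.
exists (fun v : m.+1.-tuple Y => (thead v, [tuple of behead v])).
  by move=> [a v] _; congr (_, _); apply: val_inj.
by move=> v _; rewrite /= -tuple_eta.
Qed.

(** Exactly one word is compatible with each sequence of labels, so summing over the
    words removes the constraint; this lemma is the inductive step on the first
    label, shared by all the weights. *)
Lemma sum_words_step k m j (f : seq (pred Y) -> R) :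
  (forall k' m', (k' + m' <= (k + m).-1)%N -> \sum_(v : m'.-tuple Y) f (word_at k' v) = f [::]) ->
  \sum_(v : m.-tuple Y) first_constraint R (word_at k v) j * f (behead (word_at k v)) = f [::].
Proof.
move=> H; case: k H => [|k] H.
  case: m H => [|m] H.
    rewrite (eq_bigr (fun=> f [::])); last by move=> v _; rewrite tuple0 /= first_constraint_nil mul1r.
    by rewrite big_const card_tuple expn0 /= addr0.
  rewrite sum_tuple_cons (eq_bigr (fun a => (j == a)%:R * f [::])).
    by rewrite sum_at.
  move=> a _; rewrite -(H 0%N m (leqnn _)) mulr_sumr; apply: eq_bigr => v _.
  by rewrite /first_constraint /=.
rewrite -(H k m); last by rewrite addSn.
by apply: eq_bigr => v _; rewrite /first_constraint mul1r.
Qed.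

Lemma sum_words_weight h t k m i x :
  (forall k' m' z, (k' + m' <= k + m - t)%N -> \sum_(v : m'.-tuple Y) h (word_at k' v) z = h [::] z) ->
  \sum_(v : m.-tuple Y) weight q h t (word_at k v) i x = weight q h t [::] i x.
Proof.
elim: t k m i x => [|t ih] k m i x H /=.
  by rewrite H// subn0.
rewrite exchange_big /=; apply: eq_bigr => j _.
rewrite first_constraint_nil mulr1.
rewrite (eq_bigr (fun v => trans q i j x * (first_constraint R (word_at k v) j *
   weight q h t (behead (word_at k v)) j (drop_path 1 x)))); last by move=> v _; rewrite mulrA.
rewrite -mulr_sumr; congr (_ * _).
apply: (@sum_words_step k m j (fun cs => weight q h t cs j (drop_path 1 x))) => k' m' km.
by apply: ih => k'' m'' z km''; apply: H; lia.
Qed.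

Lemma sum_words_init_weight h t k m x :
  (forall k' m' z, (k' + m' <= (k + m).-1 - t)%N -> \sum_(v : m'.-tuple Y) h (word_at k' v) z = h [::] z) ->
  \sum_(v : m.-tuple Y) init_weight p q h t (word_at k v) x = init_weight p q h t [::] x.
Proof.
move=> H; rewrite exchange_big /=; apply: eq_bigr => j _.
rewrite first_constraint_nil mulr1.
rewrite (eq_bigr (fun v => p (x 0%N, j) * (first_constraint R (word_at k v) j *
   weight q h t (behead (word_at k v)) j x))); last by move=> v _; rewrite mulrA.
rewrite -mulr_sumr; congr (_ * _).
apply: (@sum_words_step k m j (fun cs => weight q h t cs j x)) => k' m' km.
by apply: sum_words_weight => k'' m'' z km''; apply: H; lia.
Qed.

Definition path_weight (z : Z) (s : seq Z) : R :=
  \prod_(c <- pairmap (fun a b => q b a) z s) c.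

Lemma multi_trans_gt0 t i j x : 0 < multi_trans t i j x <->
  exists ys : seq Y, [/\ size ys = t, last i ys = j &
    0 < path_weight (x 0%N, i) (zip [seq x k | k <- iota 1 t] ys)].
Proof.
elim: t i x => [|t ih] i x.
  rewrite /multi_trans /= /at_label; split.
    case: eqP => [<-|]; last by rewrite ltxx.
    by move=> _; exists [::]; rewrite /path_weight big_nil ltr01.
  by move=> [ys [/size0nil -> /= -> _]]; rewrite eqxx ltr01.
have iotaE : [seq x k | k <- iota 1 t.+1] = x 1%N :: [seq drop_path 1 x k | k <- iota 1 t].
  by rewrite /= (iotaDl 1 1 t) -map_comp.
have stepE : multi_trans t.+1 i j x = \sum_k trans q i k x * multi_trans t k j (drop_path 1 x).
  by apply: eq_bigr => k _; rewrite first_constraint_nil mulr1.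
split.
  rewrite stepE => s0.
  have [k k0] : exists k, 0 < trans q i k x * multi_trans t k j (drop_path 1 x).
    apply: contrapT => nk; move: s0; rewrite big1 ?ltxx// => k _.
    apply/eqP; rewrite eq_le mulr_ge0 ?trans_ge0 ?multi_trans_ge0// andbT leNgt.
    by apply/negP => k0; apply: nk; exists k.
  have t0 : 0 < trans q i k x.
    by rewrite lt0r trans_ge0// andbT; apply: contraTneq k0 => ->; rewrite mul0r ltxx.
  have w0 : 0 < multi_trans t k j (drop_path 1 x) by rewrite -(pmulr_rgt0 _ t0).
  have [ys [sys lys pys]] := (ih k (drop_path 1 x)).1 w0.
  exists (k :: ys); split => //=; first by rewrite sys.
  by rewrite (iotaDl 1 1 t) -map_comp /path_weight /= big_cons mulr_gt0.
move=> [[|k ys] [//]] /= [sys] lys.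
rewrite (iotaDl 1 1 t) -map_comp /path_weight /= big_cons => pys.
have q0 : 0 < trans q i k x.
  by rewrite lt0r trans_ge0// andbT; apply: contraTneq pys; rewrite /trans => ->; rewrite mul0r ltxx.
rewrite (pmulr_rgt0 _ q0) in pys.
have w0 : 0 < multi_trans t k j (drop_path 1 x) by apply/ih; exists ys.
rewrite stepE (bigD1 k)//= ltr_pwDl ?mulr_gt0//.
by apply: sumr_ge0 => k' _; rewrite mulr_ge0 ?trans_ge0 ?multi_trans_ge0.
Qed.

(** A product of nonnegative matrices has a positive entry exactly when some word of
    labels joins the two indices with positive weight. *)
Lemma Ystar_multi_trans L i j x :
  Ystar p q [tuple x k | k < L.+1] (i, j) <->
  0 < p (x 0%N, i) /\ 0 < multi_trans L i j x.
Proof.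
have xE : val [tuple x k | k < L.+1] = x 0%N :: [seq x k | k <- iota 1 L].
  rewrite /= -[LHS]/(map (fun k : 'I_L.+1 => x k) (enum 'I_L.+1)).
  by rewrite (map_comp x val) val_enum_ord.
have zipE (s : seq Y) : zip [tuple x k | k < L.+1] s = zip (x 0%N :: [seq x k | k <- iota 1 L]) s.
  by rewrite -xE.
split.
  move=> [y [yy]]; rewrite zipE; case: y yy => -[|y0 ys]// sy /= [-> ->] pd.
  have p0 : 0 < p (x 0%N, y0).
    by rewrite lt0r p_ge0// andbT; apply: contraTneq pd => ->; rewrite mul0r ltxx.
  rewrite (pmulr_rgt0 _ p0) in pd; split => //.
  by apply/multi_trans_gt0; exists ys; split => //; move/eqP: sy => [].
move=> [p0 /multi_trans_gt0[ys [sys lys pys]]].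
have sy : size (i :: ys) == L.+1 by rewrite /= sys.
exists (Tuple sy); split; first by rewrite /= lys.
by rewrite zipE /= mulr_gt0.
Qed.

End weight_algebra.

(** * The smoothing formula *)

Lemma ae_forall_countable d (Omega : measurableType d) (R : realType)
    (P : probability Omega R) (V : countType) (F : V -> Omega -> Prop) :
  (forall v, {ae P, forall w, F v w}) -> {ae P, forall w, forall v, F v w}.
Proof.
move=> HF; pose F' n w := forall v, pickle v = n -> F v w.
have : \forall w \ae P, forall n, F' n w.
  apply: ae_foralln => n; have [[v vn]|nv] := pselect (exists v : V, pickle v = n).
    apply: filterS (HF v) => w Fv v' v'n.
    by have -> : v' = v by apply: (pcan_inj pickleK); rewrite v'n vn.
  by apply: aeW => w v vn; exfalso; apply: nv; exists v.
by apply: filterS => w Fw v; exact: (Fw (pickle v)).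
Qed.

(** The set where one version exceeds the other belongs to the conditioning
    sigma-algebra, and the integral of the difference over it vanishes. *)
Lemma cond_prob_version_unique d (Omega : measurableType d) (R : realType)
    (P : probability Omega R) (G : set (set Omega)) (A : set Omega) (f g : Omega -> R) :
  G `<=` measurable -> cond_prob_version P G A (EFin \o f) ->
  cond_prob_version P G A (EFin \o g) -> {ae P, forall w, f w = g w}.
Proof.
move=> Gm.
have sGm B : <<s G >> B -> measurable B.
  by apply: smallest_sub => //; exact: sigma_algebra_measurable.
have half (u v : Omega -> R) : cond_prob_version P G A (EFin \o u) ->
    cond_prob_version P G A (EFin \o v) -> P [set w | (v w < u w)%R] = 0.
  move=> [mu iu Eu] [mv iv Ev].
  set B := [set w | (v w < u w)%R].
  have sB : <<s G >> B.
    have mu' : measurable_fun (setT : set (g_sigma_algebraType G)) u by exact/measurable_EFinP.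
    have mv' : measurable_fun (setT : set (g_sigma_algebraType G)) v by exact/measurable_EFinP.
    have mtrue : measurable [set true] by [].
    by have := measurable_fun_ltr mv' mu' measurableT mtrue; rewrite setTI.
  have mB := sGm _ sB.
  have iuB : P.-integrable B (EFin \o u) by apply: integrableS iu.
  have ivB : P.-integrable B (EFin \o v) by apply: integrableS iv.
  have i0 : \int[P]_(w in B) ((EFin \o u) w - (EFin \o v) w) = 0.
    by rewrite integralB// Ev// -Eu// subee//; exact: integrable_fin_num.
  have mD : measurable_fun B (fun w => (EFin \o u) w - (EFin \o v) w).
    by apply: emeasurable_funB; [move: iuB|move: ivB] => /integrableP[].
  have : \int[P]_(w in B) `|(EFin \o u) w - (EFin \o v) w| = 0.
    rewrite -[RHS]i0; apply: eq_integral => w /[!inE] wB.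
    by rewrite gee0_abs//= -EFinB lee_fin subr_ge0 ltW.
  move=> /(ae_eq_integral_abs _ mB mD)[C [mC C0 sC]].
  apply: (subset_measure0 mB mC _ C0) => w wB; apply: sC => /= /(_ wB)[] /eqP.
  by rewrite subr_eq0 => /eqP uv; move: wB; rewrite /B /= uv ltxx.
move=> Vf Vg; have h1 := half _ _ Vf Vg; have h2 := half _ _ Vg Vf.
have mlt (u v : Omega -> R) : P.-integrable setT (EFin \o u) -> P.-integrable setT (EFin \o v) ->
    measurable [set w | (v w < u w)%R].
  move=> /integrableP[/measurable_EFinP mu _] /integrableP[/measurable_EFinP mv _].
  have mtrue : measurable [set true] by [].
  by have := measurable_fun_ltr mv mu measurableT mtrue; rewrite setTI.
apply: (@negligibleS _ _ _ _ ([set w | (g w < f w)%R] `|` [set w | (f w < g w)%R])).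
  by move=> w /= /eqP; rewrite neq_lt => /orP[?|?]; [right|left].
by apply: negligibleU; apply/negligibleP => //; apply: mlt; [case: Vf|case: Vg|case: Vg|case: Vf].
Qed.

Section observation_events.
Context d (X : measurableType d) d' (Omega : measurableType d') (V : nat -> Omega -> X).

(** Events of the observations up to time t are cylinder events of the trajectory of
    observations, because cylinder events form a sigma-algebra. *)
Lemma observation_event t B :
  <<s coord_events V [set k | (k <= t)%N] >> B ->
  exists B' : set (path_space X), [/\ measurable B', upto t B' &
    B = [set w | B' (V ^~ w)]].
Proof.
move: B; apply: smallest_sub; last first.
  move=> _ [k /= kt [C mC ->]]; exists (at_time k C); split => //.
    exact: measurable_at_time.
  by move=> x y xy; rewrite /at_time /= xy.
split.
- by exists set0; split => //; apply/seteqP; split.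
- move=> B [B' [mB' Bt ->]]; exists (~` B'); split; first exact: measurableC.
    by move=> x y xy; rewrite /setC /= (Bt x y).
  by rewrite setTD.
- move=> B HB.
  pose B' k := projT1 (cid (HB k)).
  have B'P k : [/\ measurable (B' k), upto t (B' k) & B k = [set w | B' k (V ^~ w)]].
    by rewrite /B'; case: cid.
  exists (\bigcup_k B' k); split.
  + by apply: bigcup_measurable => k _; have [] := B'P k.
  + move=> x y xy; rewrite /bigcup /=; apply/propext.
    have E k : B' k x = B' k y by have [_ Bt _] := B'P k; exact: Bt.
    by split => -[k _ Bk]; exists k => //; move: Bk; rewrite E.
  + apply/seteqP; split => w.
      by move=> [k _]; have [_ _ ->] := B'P k; exists k.
    by move=> [k _ Bk]; exists k => //; have [_ _ ->] := B'P k.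
Qed.

End observation_events.

Section versions.
Context d (X : measurableType d) (N : nat) (R : realType).
Local Notation Y := (label N).
Local Notation Z := (X * label N)%type.
Context d' (Omega : measurableType d') (P : probability Omega R)
  (mu : {sigma_finite_measure set X -> \bar R}).
Variables (p : Z -> R) (q : Z -> Z -> R) (Q : R.-pker Z ~> Z) (W : nat -> Omega -> Z).
Hypothesis q_measurable : measurable_fun setT (fun zz : Z * Z => q zz.1 zz.2).
Hypothesis q_ge0 : forall z' z, (0 <= q z' z)%R.
Hypothesis p_measurable : measurable_fun setT p.
Hypothesis p_ge0 : forall z, (0 <= p z)%R.
Hypothesis Q_kernel : forall z C, measurable C ->
  Q z C = \int[ref_measure mu N]_(z' in C) (q z' z)%:E.
Hypothesis W0_density : forall C, measurable C ->
  P (W 0%N @^-1` C) = \int[ref_measure mu N]_(z in C) (p z)%:E.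
Hypothesis WQ : markov_chain P W Q.

Local Notation h := (tail_prob Q).
Local Notation num t cs := (init_weight p q h t cs).
Local Notation den t := (init_weight p q h t [::]).

Definition obs (w : Omega) : path_space X := xpath (path_of W w).
Definition labels (w : Omega) : nat -> Y := ypath (path_of W w).

Lemma measurable_obs : measurable_fun setT obs.
Proof. exact: (measurableT_comp (@measurable_xpath _ X N) (measurable_path_of WQ)). Qed.

Lemma tail_prob_le cs z : (0 <= h cs z <= h [::] z)%R.
Proof. by have [_ + _] := @tail_prob_prop _ X N R Q cs; apply. Qed.

Lemma num_ge0 t cs x : (0 <= num t cs x)%R.
Proof.
by apply: init_weight_ge0 => // cs' z; have /andP[] := tail_prob_le cs' z.
Qed.

Lemma num_le_den t cs x : (num t cs x <= den t x)%R.
Proof. by apply: init_weight_le => // cs' z; exact: tail_prob_le. Qed.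

Lemma measurable_num t cs : measurable_fun setT (num t cs).
Proof. by apply: measurable_init_weight => // cs'; exact: measurable_tail_prob. Qed.

Lemma measurable_obeys cs : measurable [set w | obeys cs (labels w)].
Proof.
have : measurable_fun setT (fun w => obeys cs (labels w)).
  suff H k : measurable_fun setT (fun w => obeys cs (fun j => labels w (k + j)%N)).
    exact: H 0%N.
  elim: cs k => [|c cs ih] k /=; first exact: measurable_cst.
  apply: measurable_and.
    have mc : measurable_fun setT (fun j : Y => c j : bool) by [].
    have := measurableT_comp mc (measurableT_comp measurable_snd (WQ.1 k)).
    by rewrite addn0.
  have := ih k.+1; congr (measurable_fun _ _); apply/funext => w.
  by congr obeys; apply/funext => j; rewrite addSnnS.
have mtrue : measurable [set true] by [].
by move=> /(_ measurableT _ mtrue); rewrite setTI.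
Qed.

Lemma law_obs t cs (F : path_space X -> \bar R) :
  measurable_fun setT F -> (forall x, 0 <= F x) -> upto t F ->
  \int[P]_w (F (obs w) * (obeys cs (labels w))%:R%:E) =
  resample mu 0 t.+1 (fun x => F x * (num t cs x)%:E) point.
Proof. by move=> mF F0 Ft; exact: (law_weights (Q := Q)). Qed.

Lemma law_obs_indic t cs (B : set (path_space X)) : measurable B -> upto t B ->
  P ([set w | obeys cs (labels w)] `&` [set w | B (obs w)]) =
  resample mu 0 t.+1 (fun x => (\1_B x)%:E * (num t cs x)%:E) point.
Proof.
move=> mB Bt; rewrite -law_obs//.
- have mBo : measurable [set w | B (obs w)].
    by have := measurable_obs measurableT mB; rewrite setTI.
  rewrite -[X in P X]setIT -integral_indic//; last by apply: measurableI => //; exact: measurable_obeys.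
  apply: eq_integral => w _; rewrite -EFinM indicI /= mulrC; congr (_ * _)%:E%R.
  by rewrite indicE; congr (_%:R); congr nat_of_bool; apply/idP/idP; rewrite inE.
- exact/measurable_EFinP/measurable_indic.
- move=> x y xy; rewrite !indicE (_ : (x \in B) = (y \in B))//.
  by apply/idP/idP; rewrite !inE (Bt x y).
Qed.

(** Bayes' formula.  The density of the observations is the weight without
    constraint; where it vanishes the constrained weight vanishes too, so that the
    value of the quotient there does not matter. *)
Lemma smoothing_formula t cs :
  cond_prob_version P (coord_events (fun k w => (W k w).1) [set k | (k <= t)%N])
    [set w | obeys cs (labels w)] (EFin \o (fun w => num t cs (obs w) / den t (obs w))%R).
Proof.
have mf : measurable_fun setT (fun x => num t cs x / den t x)%R.
  apply: measurable_funM; first exact: measurable_num.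
  rewrite (_ : (fun x => _) = (fun x => den t x `^ (-1))%R).
    exact: (measurableT_comp (@measurable_powR R (-1)%R) (measurable_num t [::])).
  by apply/funext => x; rewrite powR_inv1// num_ge0.
have f01 x : (0 <= num t cs x / den t x <= 1)%R.
  rewrite divr_ge0 ?num_ge0//=.
  have [->|nd] := eqVneq (den t x) 0%R; first by rewrite invr0 mulr0.
  by rewrite ler_pdivrMr ?mul1r ?num_le_den// lt0r nd num_ge0.
have mfo : measurable_fun setT (fun w => num t cs (obs w) / den t (obs w))%R.
  exact: (measurableT_comp mf measurable_obs).
split.
- apply/measurable_EFinP.
  pose O' := g_sigma_algebraType (coord_events (fun k w => (W k w).1) [set k | (k <= t)%N]).
  pose V (w : O') : path_space X := fun k => (W (minn k t) w).1.
  have mV : measurable_fun (setT : set O') V.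
    apply: measurable_path => k _ B mB; rewrite setTI.
    apply: sub_sigma_algebra; exists (minn k t) => /=; first exact: geq_minr.
    by exists B.
  rewrite (_ : (fun w => num t cs (obs w) / den t (obs w))%R = (fun x => num t cs x / den t x)%R \o V).
    exact: (measurableT_comp mf mV).
  apply/funext => w /=; congr (_ / _)%R; apply: upto_init_weight => k kt;
  by rewrite /V /obs /xpath /path_of (minn_idPl kt).
- apply: (@le_integrable _ _ _ _ _ _ _ (cst 1)) => //.
  + exact/measurable_EFinP.
  + move=> w _ /=; rewrite normr1 lee_fin ger0_norm; by have /andP[] := f01 (obs w).
  + exact: finite_measure_integrable_cst.
move=> B /observation_event[B' [mB' Bt ->]].
have mBo : measurable [set w | B' (obs w)].
  by have := measurable_obs measurableT mB'; rewrite setTI.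
rewrite -[RHS]/(P ([set w | obeys cs (labels w)] `&` [set w | B' (obs w)])).
rewrite (law_obs_indic cs mB' Bt).
pose F x : \bar R := (\1_B' x)%:E * (num t cs x / den t x)%:E.
transitivity (\int[P]_w (F (obs w) * (obeys [::] (labels w))%:R%:E)).
  rewrite integral_mkcond; apply: eq_integral => w _.
  rewrite patchE /F indicE /= mule1.
  have -> : (w \in [set w | B' (fun n => (W n w).1)]) = (obs w \in B') by apply/idP/idP; rewrite !inE.
  by case: (_ \in _); rewrite ?mul1e ?mul0e.
rewrite (law_obs [::] (F := F) (t := t)).
- apply: eq_resample => x; rewrite /F -!EFinM; congr (_%:E); rewrite -mulrA; congr (_ * _)%R.
  have [d0|nd] := eqVneq (den t x) 0%R; last by rewrite divfK.
  rewrite d0 mulr0; apply/esym/eqP; rewrite eq_le num_ge0 andbT -d0; exact: num_le_den.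
- apply: emeasurable_funM; first exact/measurable_EFinP/measurable_indic.
  exact/measurable_EFinP.
- by move=> x; rewrite mule_ge0// lee_fin; have /andP[] := f01 x.
- move=> x y xy; rewrite /F !indicE (_ : (x \in B') = (y \in B')); last first.
    by apply/idP/idP; rewrite !inE (Bt x y).
  by rewrite !(@upto_init_weight _ _ _ _ _ _ _ _ _ _ _ xy).
Qed.

End versions.

(** * Almost sure positivity and good blocks of observations *)

Section resample_more.
Context d (X : measurableType d) (R : realType) (mu : {sigma_finite_measure set X -> \bar R}).
Implicit Types (F G : path_space X -> \bar R) (x y z : path_space X).

Lemma resample_cst0 k t x : resample mu k t (fun=> 0) x = 0.
Proof.
by elim: t k x => //= t ih k x; rewrite /resample1; apply: integral0_eq.
Qed.

(** The coordinates before k are those of z; only the later ones vary. *)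
Lemma eq_resample_past k t F G z :
  (forall y, (forall i, (i < k)%N -> y i = z i) -> F y = G y) ->
  resample mu k t F z = resample mu k t G z.
Proof.
elim: t k F G z => [|t ih] k F G z FG /=; first exact: FG.
apply: eq_integral => u _; apply: ih => y yz; apply: FG => i ik.
by rewrite yz 1?ltnW// /upd_path (ltn_eqF ik).
Qed.

Lemma resample_pow_measure n k (E : set (n.-tuple X)) z :
  resample mu k n (fun x => (\1_E [tuple x (k + j)%N | j < n])%:E) z = pow_measure mu E.
Proof.
elim: n k E z => [|n ih] k E z /=.
  by congr ((\1_E _)%:E); apply: eq_from_tnth => -[].
rewrite /resample1; apply: eq_integral => u _; rewrite -(ih k.+1 _ (upd_path k z u)).
apply: eq_resample_past => y yz; congr (_ %:E); rewrite !indicE.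
congr (_%:R); congr nat_of_bool.
have -> : [tuple y (k + j)%N | j < n.+1] = [tuple of u :: [tuple y (k.+1 + j)%N | j < n]].
  apply: eq_from_tnth => j; rewrite tnth_mktuple.
  have [->|[j' ->]] : j = ord0 \/ exists j', j = lift ord0 j'.
  - by case: (unliftP ord0 j) => [j' ->|->]; [right; exists j'|left].
  - by rewrite tnth0 addn0 yz// /upd_path eqxx.
  - by rewrite tnthS tnth_mktuple /= /bump add1n addSnnS.
by apply/idP/idP; rewrite !inE.
Qed.

End resample_more.

Section almost_sure.
Context d (X : measurableType d) (N : nat) (R : realType).
Local Notation Y := (label N).
Local Notation Z := (X * label N)%type.
Context d' (Omega : measurableType d') (P : probability Omega R)
  (mu : {sigma_finite_measure set X -> \bar R}).
Variables (p : Z -> R) (q : Z -> Z -> R) (Q : R.-pker Z ~> Z) (W : nat -> Omega -> Z).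
Hypothesis q_measurable : measurable_fun setT (fun zz : Z * Z => q zz.1 zz.2).
Hypothesis q_ge0 : forall z' z, (0 <= q z' z)%R.
Hypothesis p_measurable : measurable_fun setT p.
Hypothesis p_ge0 : forall z, (0 <= p z)%R.
Hypothesis Q_kernel : forall z C, measurable C ->
  Q z C = \int[ref_measure mu N]_(z' in C) (q z' z)%:E.
Hypothesis W0_density : forall C, measurable C ->
  P (W 0%N @^-1` C) = \int[ref_measure mu N]_(z in C) (p z)%:E.
Hypothesis WQ : markov_chain P W Q.

Local Notation h := (tail_prob Q).
Local Notation num t cs := (init_weight p q h t cs).
Local Notation den t := (init_weight p q h t [::]).
Local Notation obs := (obs W).
Local Notation labels := (labels W).

Lemma obs_null t (B : set (path_space X)) : measurable B -> upto t B ->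
  (forall x, B x -> den t x = 0%R) -> P [set w | B (obs w)] = 0.
Proof.
move=> mB Bt Bd.
have := law_obs_indic q_measurable q_ge0 p_measurable p_ge0 Q_kernel W0_density WQ [::] mB Bt.
rewrite (_ : _ `&` _ = [set w | B (obs w)]); last by apply/seteqP; split => w // [].
move=> ->; rewrite -[RHS](resample_cst0 mu 0 t.+1 point); apply: eq_resample => x.
rewrite indicE; case: (boolP (x \in B)) => xB; last by rewrite mul0e.
by rewrite Bd ?mule0// -inE.
Qed.

Lemma measurable_obs_event (B : set (path_space X)) : measurable B -> measurable [set w | B (obs w)].
Proof. by move=> mB; have := measurable_obs WQ measurableT mB; rewrite setTI. Qed.

(** The observations avoid the zeros of their own density. *)
Lemma den_gt0_ae t : {ae P, forall w, (0 < den t (obs w))%R}.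
Proof.
pose B : set (path_space X) := [set x | den t x = 0%R].
have mB : measurable B.
  have := measurable_num Q q_measurable p_measurable t [::] measurableT (measurable_set1 (0 : R)%R).
  by rewrite setTI.
exists [set w | B (obs w)]; split.
- exact: measurable_obs_event.
- apply: (obs_null (t := t)) => //.
  by move=> x y xy; rewrite /B /= (upto_init_weight _ _ _ _ xy).
- move=> w /=; apply: contra_notP => nB; rewrite lt0r num_ge0//= andbT.
  by apply/negP => /eqP.
Qed.

Lemma obeys_nseq k cs (y : nat -> Y) :
  obeys (nseq k xpredT ++ cs) y = obeys cs (fun j => y (k + j)%N).
Proof.
elim: k y => [|k ih] y /=.
  by [].
by rewrite ih.
Qed.

Lemma pinned_weight t i j x :
  (first_constraint R (nseq t xpredT ++ [:: (pred1 i : pred Y)]) j *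
   weight q h t (behead (nseq t xpredT ++ [:: (pred1 i : pred Y)])) j x = multi_trans q t j i x)%R.
Proof.
elim: t j x => [|t ih] j x; first by rewrite /= mulr1.
rewrite [X in (X * _)%R](_ : _ = 1%R)// mul1r /multi_trans /=.
by apply: eq_bigr => k _; rewrite first_constraint_nil mulr1 -mulrA ih.
Qed.

(** This identifies the forward weight as the joint density of the observations up to
    time t and of the label at time t. *)
Lemma pinned_init_weight t i x :
  num t (nseq t xpredT ++ [:: (pred1 i : pred Y)]) x = forward_weight p q t i x.
Proof.
by apply: eq_bigr => j _; rewrite first_constraint_nil mulr1 -mulrA pinned_weight.
Qed.

Lemma measurable_forward_weight t i : measurable_fun setT (forward_weight p q t i).
Proof.
apply: measurable_init_weight => // cs.
exact: (@measurable_pred_label _ _ _ R (fun k => k == i)).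
Qed.

(** A pair (observation, label) at which p vanishes is a.s. never visited, and the
    forward weight is the density of the observations jointly with the label. *)
Lemma support_ae : (forall k, P [set w | p (W k w) = 0%R] = 0) ->
  {ae P, forall w, forall k i, (0 < forward_weight p q k i (obs w))%R -> (0 < p (obs w k, i))%R}.
Proof.
move=> p0.
suff H k : {ae P, forall w, forall i, (0 < forward_weight p q k i (obs w))%R -> (0 < p (obs w k, i))%R}.
  exact: ae_foralln H.
apply: ae_forall_countable => i.
pose B0 : set (path_space X) := [set x | p (x k, i) = 0%R].
pose B : set (path_space X) := B0 `&` [set x | (0 < forward_weight p q k i x)%R].
have mB0 : measurable B0.
  have mf : measurable_fun setT (fun x : path_space X => p (x k, i)).
    exact: (measurableT_comp p_measurable (measurable_coord_label i (measurable_coord k))).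
  by have := mf measurableT _ (measurable_set1 (0 : R)%R); rewrite setTI.
have mB : measurable B.
  apply: measurableI => //.
  have mtrue : measurable [set true] by [].
  have := measurable_fun_ltr (measurable_cst (0 : R)%R) (measurable_forward_weight k i).
  by move=> /(_ measurableT _ mtrue); rewrite setTI.
have B0k : upto k B0 by move=> x y xy; rewrite /B0 /= xy.
have Bk : upto k B.
  move=> x y xy; rewrite /B /setI /= (B0k x y xy); congr (_ /\ is_true (_ < _)%R).
  exact: upto_init_weight.
exists [set w | B (obs w)]; split.
- exact: measurable_obs_event.
- have := law_obs_indic q_measurable q_ge0 p_measurable p_ge0 Q_kernel W0_density WQ
    (nseq k xpredT ++ [:: (pred1 i : pred Y)]) mB0 B0k.
  rewrite [X in X = _ -> _](_ : _ = 0); last first.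
    apply: (subset_measure0 _ _ _ (p0 k)).
    + by apply: measurableI; [exact: (measurable_obeys WQ)|exact: measurable_obs_event].
    + have := measurableT_comp p_measurable (WQ.1 k).
      by move=> /(_ measurableT _ (measurable_set1 (0 : R)%R)); rewrite setTI.
    + move=> w [/=]; rewrite obeys_nseq /= addn0 andbT => /eqP yk; rewrite /B0 /= -yk.
      by rewrite /obs /xpath /labels /ypath -surjective_pairing.
  move=> /esym rs0.
  have := law_obs_indic q_measurable q_ge0 p_measurable p_ge0 Q_kernel W0_density WQ [::] mB Bk.
  rewrite (_ : _ `&` _ = [set w | B (obs w)]); last by apply/seteqP; split => w // [].
  move=> ->.
  have mi (C : set (path_space X)) : measurable C -> measurable_fun setT (fun x => (\1_C x)%:E : \bar R).
    by move=> mC; apply/measurable_EFinP; exact: measurable_indic.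
  apply: (resample_eq0 (F := fun x => (\1_B0 x)%:E * (num k (nseq k xpredT ++ [:: (pred1 i : pred Y)]) x)%:E)) rs0.
  + by apply: emeasurable_funM; [exact: mi|apply/measurable_EFinP; exact: measurable_num].
  + by apply: emeasurable_funM; [exact: mi|apply/measurable_EFinP; exact: measurable_num].
  + by move=> x; rewrite mule_ge0// lee_fin ?num_ge0.
  + by move=> x; rewrite mule_ge0// lee_fin ?num_ge0.
  + move=> x; rewrite pinned_init_weight !indicE.
    case: (boolP (x \in B)) => xB; last by rewrite mul0e.
    move: xB; rewrite inE => -[/= xB0 r0].
    by rewrite mem_set//= mul1e => -[]; move: r0 => /[swap] ->; rewrite ltxx.
- move=> w /=; apply: contra_notP => nB r0; rewrite lt0r p_ge0 andbT.
  by apply/negP => /eqP p00; exact: nB.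
Qed.

(** The rows of the labels i with p(x_0, i) = 0 are left out because the admissible
    pairs of end labels carry no information about them. *)
Definition good_block (L : nat) (eps : R) (x : path_space X) : Prop :=
  exists hi (S1 S2 : pred Y), (0 <= hi)%R /\ forall i, (0 < p (x 0%N, i))%R -> forall j,
    (S1 i && S2 j -> (eps * hi <= multi_trans q L i j x <= hi)%R) /\
    (~~ (S1 i && S2 j) -> multi_trans q L i j x = 0%R).

Lemma den_multi_trans L x : den L x = (\sum_i p (x 0%N, i) * \sum_j multi_trans q L i j x)%R.
Proof.
apply: eq_bigr => i _; rewrite first_constraint_nil mulr1; congr (_ * _)%R.
rewrite -[in LHS](addn0 L) weight_add; apply: eq_bigr => j _.
by case: L => [|L]; rewrite /= mulr1.
Qed.

(** Along observations in E the support of the matrix is the fixed product set of the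
    hypothesis.  Each of its finitely many entries is positive there, hence at least
    some eps times the sum of all of them; the events for eps = 1/(k + 2) increase to
    E, whose probability is positive because the density of the observations is
    positive on E and E has positive product measure. *)
Lemma good_block_exists r (E : set (r.-tuple X)) : (1 < r)%N ->
  conditionA1' p q E -> conditionA2' mu E ->
  exists L (eps : R) (e : set (path_space X)), [/\ (0 < L)%N /\ (0 < eps < 1)%R,
    measurable e, upto L e, 0 < P [set w | e (obs w)] &
    forall x, e x -> good_block L eps x].
Proof.
case: r E => [//|L] E L0 [mE [S [ES S0 SX]]] E0.
have {}L0 : (0 < L)%N by rewrite ltnS in L0.
pose E' : set (path_space X) := [set x | E [tuple x k | k < L.+1]].
have mE' : measurable E'.
  by have := @measurable_path_tuple _ X L.+1 id measurableT _ mE; rewrite setTI.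
have E'L : upto L E'.
  move=> x y xy; rewrite /E' /=; congr (E _); apply: eq_from_tnth => i.
  by rewrite !tnth_mktuple xy// -ltnS.
have SE x : E' x -> forall i j, S (i, j) <-> (0 < p (x 0%N, i))%R /\ (0 < multi_trans q L i j x)%R.
  by move=> E'x i j; rewrite -(ES _ E'x); exact: Ystar_multi_trans.
pose eps k : R := (k.+2%:R)^-1%R.
have eps01 k : (0 < eps k < 1)%R.
  by rewrite invr_gt0 ltr0n /= invf_lt1 ?ltr0n// ltr1n.
pose tot x := (\sum_(ij | `[<S ij>]) multi_trans q L ij.1 ij.2 x)%R.
have mmt i j : measurable_fun setT (multi_trans q L i j).
  by apply: measurable_weight => // cs; exact: (@measurable_pred_label _ _ _ R (fun k => k == j)).
have mt0 i j x : (0 <= multi_trans q L i j x)%R by exact: multi_trans_ge0.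
have tot0 x : (0 <= tot x)%R by apply: sumr_ge0.
pose e k : set (path_space X) := E' `&`
  [set x | forall i j, S (i, j) -> (eps k * tot x <= multi_trans q L i j x)%R].
have mtot : measurable_fun setT tot.
  rewrite (_ : tot = fun x => \sum_ij if `[<S ij>] then multi_trans q L ij.1 ij.2 x else 0)%R.
    by apply: measurable_sum => ij; case: asboolP.
  by apply/funext => x; rewrite /tot big_mkcond.
have me k : measurable (e k).
  apply: measurableI => //.
  rewrite (_ : [set x | _] = \bigcap_(ij in S) [set x | (eps k * tot x <= multi_trans q L ij.1 ij.2 x)%R]).
    apply: fin_bigcap_measurable; first exact: finite_finset.
    move=> ij _; have mtrue : measurable [set true] by [].
    have := measurable_fun_ler (measurable_funM (measurable_cst (eps k)) mtot) (mmt ij.1 ij.2).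
    by move=> /(_ measurableT _ mtrue); rewrite setTI.
  apply/seteqP; split => x /= H; first by move=> [i j] /H.
  by move=> i j Sij; exact: (H (i, j)).
have mtL i j : upto L (multi_trans q L i j) by exact: upto_weight.
have eL k : upto L (e k).
  move=> x y xy; rewrite /e /setI /= (E'L x y xy).
  have -> : tot x = tot y by apply: eq_bigr => ij _; exact: mtL.
  by congr (_ /\ _); apply/propext; split => H i j /H; rewrite (mtL i j x y).
have good k x : e k x -> good_block L (eps k) x.
  move=> [E'x ex]; exists (tot x), (fun i => `[<(fst @` S) i>]), (fun j => `[<(snd @` S) j>]).
  split => // i pi j.
  have SP : S (i, j) <-> `[<(fst @` S) i>] && `[<(snd @` S) j>].
    split=> [Sij|/andP[/asboolP S1 /asboolP S2]]; last by rewrite SX.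
    by apply/andP; split; apply/asboolP; exists (i, j).
  split => [/SP Sij|nS].
    rewrite ex//= /tot (bigD1 (i, j))/=; last exact/asboolP.
    by rewrite lerDl; apply: sumr_ge0.
  apply/eqP; rewrite eq_le mt0 andbT leNgt; apply/negP => mtp.
  by move/negP: nS; apply; apply/SP/(SE x E'x).
have E'_pos : P [set w | E' (obs w)] != 0.
  apply/negP => /eqP PE0; move: E0; rewrite /conditionA2'.
  have := law_obs_indic q_measurable q_ge0 p_measurable p_ge0 Q_kernel W0_density WQ [::] mE' E'L.
  rewrite (_ : _ `&` _ = [set w | E' (obs w)]); last by apply/seteqP; split => w // [].
  rewrite PE0 => /esym rs0.
  rewrite -(resample_pow_measure mu 0 E point).
  rewrite (@eq_resample _ _ _ _ _ _ _ (fun x => (\1_E' x)%:E)); last first.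
    by move=> x; rewrite !indicE; congr (_%:R%:E); congr nat_of_bool.
  rewrite (resample_eq0 _ _ _ _ _ rs0) ?ltxx//.
  - apply: emeasurable_funM; first exact/measurable_EFinP/measurable_indic.
    by apply/measurable_EFinP; exact: measurable_num.
  - exact/measurable_EFinP/measurable_indic.
  - by move=> x; rewrite mule_ge0// lee_fin ?num_ge0.
  - move=> x; rewrite indicE; case: (boolP (x \in E')) => //; rewrite inE => E'x /=.
    rewrite mul1e => -[] d0; exfalso.
    have [[i j] Sij] := S0; have [pi mij] := (SE x E'x i j).1 Sij.
    have : (0 < den L x)%R.
      rewrite den_multi_trans (bigD1 i)//= ltr_pwDl//.
        rewrite mulr_gt0// (bigD1 j)//= ltr_pwDl//.
        by apply: sumr_ge0.
      by apply: sumr_ge0 => i' _; rewrite mulr_ge0//; apply: sumr_ge0.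
    by rewrite d0 ltxx.
have [k ek] : exists k, 0 < P [set w | e k (obs w)].
  apply: contrapT => nk; move/negP: E'_pos; apply; apply/eqP.
  have ek0 k : P [set w | e k (obs w)] = 0.
    apply/eqP; rewrite eq_le measure_ge0 andbT leNgt; apply/negP => ?.
    by apply: nk; exists k.
  apply/negligibleP; first exact: measurable_obs_event.
  apply: (@negligibleS _ _ _ _ (\bigcup_k [set w | e k (obs w)])); last first.
    by apply: negligible_bigcup => k; apply/negligibleP; [exact: (measurable_obs_event (me k))|exact: ek0].
  move=> w /= E'w; set x := obs w in E'w *.
  have H (ij : Y * Y) : exists n : nat, S ij -> (tot x <= n.+2%:R * multi_trans q L ij.1 ij.2 x)%R.
    case: (pselect (S ij)) => Sij; last by exists 0%N.
    have [_ mij] := (SE x E'w ij.1 ij.2).1 (ltac:(by rewrite -surjective_pairing)).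
    exists (Num.truncn (tot x / multi_trans q L ij.1 ij.2 x)) => _.
    rewrite -ler_pdivrMr// ltW// (lt_le_trans (truncnS_gt _))// ler_nat.
    exact: leqnSn.
  pose n ij := projT1 (cid (H ij)).
  have nP ij : S ij -> (tot x <= (n ij).+2%:R * multi_trans q L ij.1 ij.2 x)%R.
    by rewrite /n; case: cid.
  exists (\max_ij n ij) => //; split => // i j Sij.
  rewrite /eps mulrC ler_pdivrMr ?ltr0n// mulrC (le_trans (nP _ Sij))//.
  by rewrite ler_wpM2r// ler_nat !ltnS; exact: (leq_bigmax (i, j)).
by exists L, (eps k), (e k); split => //; exact: good.
Qed.

End almost_sure.

(** * Forgetting along one trajectory of observations *)

Section forgetting.
Context d (X : measurableType d) (N : nat) (R : realType).
Local Notation Y := (label N).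
Local Notation Z := (X * label N)%type.
Variables (p : Z -> R) (q : Z -> Z -> R) (Q : R.-pker Z ~> Z).
Hypothesis q_ge0 : forall z' z, (0 <= q z' z)%R.
Hypothesis p_ge0 : forall z, (0 <= p z)%R.
Local Open Scope ring_scope.

Local Notation h := (tail_prob Q).
Local Notation fw := (forward_weight p q).
Local Notation mt := (multi_trans q).

(** The words partition the possible labels, also of those after the last
    observation. *)
Lemma sum_tail_prob k m z : \sum_(v : m.-tuple Y) h (word_at k v) z = 1.
Proof.
have [n] := ubnP (k + m)%N; elim: n k m z => // n ih k m z km.
have [km0|km0] := posnP (k + m).
  have -> : k = 0%N by lia.
  have m0 : m = 0%N by lia.
  subst m; rewrite (eq_bigr (fun=> 1)); last by move=> v _; rewrite tuple0.
  by rewrite sumr_const card_tuple expn0.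
apply: EFin_inj; rewrite -sumEFin.
have cE (v : m.-tuple Y) : ((h (word_at k v) z)%:E =
    \int[Q z]_z' (first_constraint R (word_at k v) z'.2 * h (behead (word_at k v)) z')%:E)%E.
  have [c [cs E]] : exists c cs, word_at k v = c :: cs.
    case: k km km0 => [|k] km km0; last by exists xpredT, (word_at k v).
    case: m km km0 v => [|m] km km0 v; first by lia.
    by rewrite (tuple_eta v) /word_at /=; eexists; eexists.
  by rewrite E; have [_ _ ->] := @tail_prob_prop _ X N R Q cs.
rewrite (eq_bigr _ (fun v _ => cE v)) -ge0_integral_sum//.
- rewrite -[RHS](@prob_kernel _ _ _ _ _ Q z) -[RHS]mul1e -integral_cst//.
  apply: eq_integral => z' _; rewrite sumEFin; congr (_%:E).
  apply: (@sum_words_step N R k m z'.2 (fun cs => h cs z')) => k' m' km'.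
  by apply: ih; lia.
- move=> v; apply/measurable_EFinP; apply: measurable_funM.
    exact: (@measurable_pred_label _ _ _ R (head xpredT (word_at k v))).
  by have [] := @tail_prob_prop _ X N R Q (behead (word_at k v)).
- move=> v z' _; rewrite lee_fin mulr_ge0//.
  by have [_ /(_ z')/andP[]] := @tail_prob_prop _ X N R Q (behead (word_at k v)).
Qed.

Lemma tail_prob_bounds cs z : 0 <= h cs z <= 1.
Proof. by have [_ /(_ z)] := @tail_prob_prop _ X N R Q cs. Qed.

Lemma weight_tail_ge0 t cs i x : 0 <= weight q h t cs i x.
Proof. by apply: weight_ge0 => // cs' z; have /andP[] := tail_prob_bounds cs' z. Qed.

(** Before its first constrained label a word leaves the weight unchanged. *)
Lemma weight_at_nseq t j cs i x :
  weight q (at_label R j) t (nseq t xpredT ++ cs) i x = mt t i j x.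
Proof.
rewrite /multi_trans; elim: t i x => //= t ih i x; apply: eq_bigr => k _.
by rewrite ih.
Qed.

Lemma init_weight_at_nseq t j cs x :
  init_weight p q (at_label R j) t (nseq t.+1 xpredT ++ cs) x = fw t j x.
Proof. by apply: eq_bigr => k _; rewrite /= weight_at_nseq. Qed.

Lemma drop_word_at k t m (v : m.-tuple Y) : drop t (word_at (t + k) v) = word_at k v.
Proof. by rewrite /word_at nseqD -catA drop_size_cat// size_nseq. Qed.

Lemma word_atS k m (v : m.-tuple Y) : word_at k.+1 v = (xpredT : pred Y) :: word_at k v.
Proof. by []. Qed.

Lemma forward_weight_gt0 k t i j x : 0 < fw k i x -> 0 < mt t i j (drop_path k x) ->
  0 < fw (k + t) j x.
Proof.
move=> f0 m0; rewrite forward_weight_add (bigD1 i)//= ltr_pwDl ?mulr_gt0//.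
by apply: sumr_ge0 => i' _; rewrite mulr_ge0 ?forward_weight_ge0 ?multi_trans_ge0.
Qed.

Section past.
Variables (y : nat -> path_space X) (L : nat) (eps : R) (e : set (path_space X)) (m n : nat).
Hypothesis y_drop : forall u, drop_path 1 (y u.+1) = y u.
Hypothesis L_gt0 : (0 < L)%N.
Hypothesis eps01 : 0 < eps < 1.
Hypothesis e_good : forall x, e x -> good_block p q L eps x.

Lemma y_dropD k u : drop_path k (y (k + u)) = y u.
Proof.
elim: k u => [|k ih] u; first by rewrite drop_path0.
by rewrite addSnnS -[k.+1]addn1 -drop_pathD ih y_drop.
Qed.

Lemma y_drop_sub u l : (u <= l)%N -> drop_path (l - u) (y l) = y u.
Proof. by move=> ul; rewrite -{2}(subnK ul) y_dropD. Qed.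

Lemma y_at u l : (u <= l)%N -> y l (l - u)%N = y u 0%N.
Proof. by move=> ul; rewrite -(y_drop_sub ul) /drop_path addn0. Qed.

(** The trajectory y u starts at time -u.  As u grows, the weights of the words from
    time -u to n, with the word v at time 0 or without constraint, follow the same
    backward recursion; numerators and denominators for both windows are the
    pairings of these vectors at time -s with nonnegative vectors. *)
Lemma past_forgetting (s l : nat) : (0 < s)%N -> (s <= l)%N ->
  (forall k i, 0 < fw k i (y l) -> 0 < p (y l k, i)) ->
  (forall k i, 0 < fw k i (y s) -> 0 < p (y s k, i)) ->
  0 < init_weight p q h (l + n) [::] (y l) -> 0 < init_weight p q h (s + n) [::] (y s) ->
  tv_norm (fun v : m.-tuple Y =>
    init_weight p q h (l + n) (word_at l v) (y l) / init_weight p q h (l + n) [::] (y l) -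
    init_weight p q h (s + n) (word_at s v) (y s) / init_weight p q h (s + n) [::] (y s))
  <= 2 * rate L eps ^+ (\sum_(k < s - L) `[<e (y (k + L).+1)>]).
Proof.
move=> s0 sl pl ps Dl Ds; apply: tv_le_of_signed => // sg sg1.
(* U u i: the label i is reached at time -u with positive weight along one of the two
   windows.  The vectors are cut off outside U, since blocks are only good on labels
   of positive density; U is closed under transitions of positive weight, so the cut
   vectors still satisfy the recursion. *)
pose U u i := (u <= s)%N && ((0 < fw (l - u) i (y l)) || (0 < fw (s - u) i (y s))).
have Up u i : U u i -> 0 < p (y u 0%N, i).
  move=> /andP[us /orP[/pl|/ps]]; first by rewrite y_at// (leq_trans us).
  by rewrite y_at.
have Ucl t u i j : U (u + t)%N i -> 0 < mt t i j (y (u + t)) -> U u j.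
  move=> /andP[uts Ui] mij; apply/andP; split; first by lia.
  case/orP: Ui => fwi; apply/orP; [left|right].
    have -> : (l - u = (l - (u + t)) + t)%N by lia.
    apply: forward_weight_gt0 fwi _.
    by rewrite y_drop_sub// (leq_trans uts).
  have -> : (s - u = (s - (u + t)) + t)%N by lia.
  by apply: forward_weight_gt0 fwi _; rewrite y_drop_sub.
(* A weight does not constrain the label that it starts from, so the recursion starts
   at time -1, where the whole word still lies ahead. *)
pose b u i : R := (U u.+1 i)%:R * weight q h (u.+1 + n) [::] i (y u.+1).
pose g u i : R := (U u.+1 i)%:R *
  \sum_(v : m.-tuple Y) sg v * weight q h (u.+1 + n) (word_at u v) i (y u.+1).
pose A t u i j : R := (U (u + t).+1 i)%:R * mt t i j (y (u + t).+1).
have Asplit t u i (f : Y -> R) :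
    \sum_j A t u i j * ((U u.+1 j)%:R * f j) =
    (U (u + t).+1 i)%:R * \sum_j mt t i j (y (u + t).+1) * f j.
  rewrite mulr_sumr; apply: eq_bigr => j _; rewrite /A.
  have [Ui|nUi] := boolP (U (u + t).+1 i); last by rewrite !mul0r.
  rewrite !mul1r; have [Uj|nUj] := boolP (U u.+1 j); first by rewrite mul1r.
  have : ~~ (0 < mt t i j (y (u + t).+1)).
    by apply: contra nUj; rewrite -addSn => mij; apply: Ucl mij; rewrite addSn.
  rewrite lt0r multi_trans_ge0// andbT negbK => /eqP ->.
  by rewrite !mul0r.
have bA t u i : b (u + t)%N i = \sum_j A t u i j * b u j.
  rewrite Asplit /b; congr (_ * _).
  have -> : ((u + t).+1 + n = t + (u.+1 + n))%N by lia.
  rewrite weight_add; apply: eq_bigr => j _; congr (_ * weight _ _ _ _ _ _).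
  by rewrite -addSn addnC y_dropD.
have gA t u i : g (u + t)%N i = \sum_j A t u i j * g u j.
  rewrite Asplit /g; congr (_ * _).
  rewrite (eq_bigr (fun v : m.-tuple Y => \sum_j sg v * (mt t i j (y (u + t).+1) *
      weight q h (u.+1 + n) (word_at u v) j (y u.+1)))); last first.
    move=> v _; rewrite -mulr_sumr; congr (_ * _).
    have -> : ((u + t).+1 + n = t + (u.+1 + n))%N by lia.
    rewrite weight_add; apply: eq_bigr => j _; rewrite (addnC u t) drop_word_at.
    by rewrite /word_at nseqD -catA weight_at_nseq -addnS y_dropD.
  rewrite exchange_big /=; apply: eq_bigr => j _; rewrite mulr_sumr.
  by apply: eq_bigr => v _; rewrite mulrCA.
have M0 u i j : 0 <= A 1%N u i j by rewrite mulr_ge0 ?multi_trans_ge0.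
have bM u i : b u.+1 i = \sum_j A 1%N u i j * b u j by rewrite -addn1 bA.
have gM u i : g u.+1 i = \sum_j A 1%N u i j * g u j by rewrite -addn1 gA.
have gb0 i : `|g 0%N i| <= b 0%N i.
  rewrite /g /b normrM ger0_norm// ler_wpM2l//.
  rewrite -(@sum_words_weight _ _ _ _ q h (1 + n)%N 0%N m i (y 1%N)); last first.
    by move=> k' m' z _; rewrite sum_tail_prob.
  apply: (le_trans (ler_norm_sum _ _ _)); apply: ler_sum => v _.
  by rewrite normrM (ger0_norm (weight_tail_ge0 _ _ _ _)) ler_piMl ?weight_tail_ge0.
have pinchA u : `[<e (y (u + L).+1)>] -> pinched (A L u) (b u) eps.
  move=> /asboolP /e_good[hi [S1 [S2 [hi0 gd]]]].
  exists hi, S2; split => // i; rewrite /A.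
  have [Ui|nUi] := boolP (U (u + L).+1 i); last by left => j; rewrite !mul0r.
  have gi := gd i (Up _ _ Ui).
  have [S1i|nS1i] := boolP (S1 i); last first.
    by left => j; rewrite mul1r ((gi j).2 _) ?mul0r// (negbTE nS1i).
  right => j _; rewrite mul1r; split => [S2j|nS2j].
    by apply: (gi j).1; rewrite S1i.
  by apply: (gi j).2; rewrite S1i.
have [c [dd [cd dc gb]]] := pinched_contraction L_gt0 eps01 M0 bM gM (bA L) (gA L) gb0 pinchA s.-1.
have sE : s = s.-1.+1 by rewrite prednK.
(* Both windows contain the times from -s on; what precedes only enters as the
   forward weights at time -s. *)
have split_init l' (cs : seq (pred Y)) : (s <= l')%N ->
    init_weight p q h (l' + n) cs (y l') =
    \sum_j init_weight p q (at_label R j) (l' - s) cs (y l') *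
       weight q h (s + n) (drop (l' - s) (behead cs)) j (y s).
  move=> sl'; rewrite -[in LHS](subnK sl') -addnA init_weight_add.
  by apply: eq_bigr => j _; rewrite (subnK sl') y_drop_sub.
have split_word l' (v : m.-tuple Y) : (s <= l')%N ->
    init_weight p q h (l' + n) (word_at l' v) (y l') =
    \sum_j fw (l' - s) j (y l') * weight q h (s + n) (word_at s.-1 v) j (y s).
  move=> sl'; rewrite split_init//; apply: eq_bigr => j _; congr (_ * _); last congr (weight _ _ _ _ _ _).
    have -> : word_at l' v = nseq (l' - s).+1 xpredT ++ word_at s.-1 v.
      by rewrite /word_at catA -nseqD; congr (nseq _ _ ++ _); lia.
    exact: init_weight_at_nseq.
  have -> : l' = ((l' - s) + s.-1).+1 by lia.
  rewrite word_atS /=.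
  have -> : ((l' - s + s.-1).+1 - s = l' - s)%N by lia.
  by rewrite drop_word_at.
have sandwich l' : (s <= l')%N -> (forall j, 0 < fw (l' - s) j (y l') -> U s j) ->
    c * init_weight p q h (l' + n) [::] (y l') <=
    \sum_v sg v * init_weight p q h (l' + n) (word_at l' v) (y l') <=
    dd * init_weight p q h (l' + n) [::] (y l').
  move=> sl' HU; rewrite (split_init _ [::] sl').
  rewrite (eq_bigr (fun v : m.-tuple Y => \sum_j fw (l' - s) j (y l') *
     (sg v * weight q h (s + n) (word_at s.-1 v) j (y s)))); last first.
    by move=> v _; rewrite split_word// mulr_sumr; apply: eq_bigr => j _; rewrite mulrCA.
  rewrite exchange_big /= !mulr_sumr.
  have point j : c * (fw (l' - s) j (y l') * weight q h (s + n) [::] j (y s)) <=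
      \sum_(v : m.-tuple Y) fw (l' - s) j (y l') * (sg v * weight q h (s + n) (word_at s.-1 v) j (y s)) <=
      dd * (fw (l' - s) j (y l') * weight q h (s + n) [::] j (y s)).
    rewrite -mulr_sumr ![_ * (fw _ _ _ * _)]mulrCA.
    have f0 := forward_weight_ge0 q_ge0 p_ge0 (l' - s) j (y l').
    have [Uj|nUj] := boolP (U s j).
      have := gb j; rewrite /b /g -sE Uj !mul1r => /andP[? ?].
      by rewrite !ler_wpM2l.
    have -> : fw (l' - s) j (y l') = 0.
      by apply/eqP; rewrite eq_le f0 andbT leNgt; apply: contra nUj => /HU.
    by rewrite !mul0r lexx.
  by apply/andP; split; apply: ler_sum => j _; have /andP[] := point j.
have /andP[_ hl] := sandwich l sl (fun j f0 => ltac:(by rewrite /U leqnn f0)).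
have /andP[hs _] := sandwich s (leqnn s) (fun j f0 => ltac:(by rewrite /U leqnn f0 orbT)).
exists c, dd; split => //.
by rewrite -sE in dc.
Qed.

End past.

Section future.
Variables (y x : path_space X) (L : nat) (eps : R) (e : set (path_space X)) (m n : nat).
Hypothesis m_gt0 : (0 < m)%N.
Hypothesis y_drop : drop_path (n + m.-1) y = x.
Hypothesis L_gt0 : (0 < L)%N.
Hypothesis eps01 : 0 < eps < 1.
Hypothesis e_good : forall x, e x -> good_block p q L eps x.

(** The word ends at time m - 1, where the trajectory x starts.  From then on the
    forward weights, with the word v or without constraint, follow the same forward
    recursion, and the smoothing probabilities pair them with the nonnegative
    weights of the observations after time s. *)
Lemma future_forgetting (s l : nat) : (m <= s)%N -> (s <= l)%N ->
  (forall k i, 0 < fw k i y -> 0 < p (y k, i)) ->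
  0 < init_weight p q h (n + l) [::] y -> 0 < init_weight p q h (n + s) [::] y ->
  tv_norm (fun v : m.-tuple Y =>
    init_weight p q h (n + l) (word_at n v) y / init_weight p q h (n + l) [::] y -
    init_weight p q h (n + s) (word_at n v) y / init_weight p q h (n + s) [::] y)
  <= 2 * rate L eps ^+ (\sum_(k < (s - m.-1).+1 - L) `[<e (drop_path k x)>]).
Proof.
move=> ms sl py Dl Ds; apply: tv_le_of_signed => // sg sg1.
pose t1 := (n + m.-1)%N.
pose fwv u (v : m.-tuple Y) j := init_weight p q (at_label R j) u (word_at n v) y.
pose b u j : R := fw (t1 + u) j y.
pose g u j : R := \sum_(v : m.-tuple Y) sg v * fwv (t1 + u)%N v j.
pose A t u j i : R := mt t i j (drop_path u x).
have yE u : drop_path (t1 + u) y = drop_path u x by rewrite -y_drop drop_pathD.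
have wordE (v : m.-tuple Y) u : (t1 <= u)%N -> drop u (behead (word_at n v)) = [::].
  move=> t1u; rewrite behead_drop drop_oversize// size_cat size_nseq size_map size_tuple.
  by rewrite /t1 in t1u; lia.
have bA t u j : b (u + t)%N j = \sum_i A t u j i * b u i.
  rewrite /b addnA forward_weight_add; apply: eq_bigr => i _.
  by rewrite yE mulrC.
have gA t u j : g (u + t)%N j = \sum_i A t u j i * g u i.
  rewrite /g (eq_bigr (fun v : m.-tuple Y => \sum_i sg v * (A t u j i * fwv (t1 + u)%N v i))).
    rewrite exchange_big /=; apply: eq_bigr => i _; rewrite mulr_sumr.
    by apply: eq_bigr => v _; rewrite mulrCA.
  move=> v _; rewrite -mulr_sumr; congr (_ * _).
  rewrite /fwv addnA init_weight_add; apply: eq_bigr => i _.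
  by rewrite wordE ?leq_addr// yE mulrC.
have M0 u i j : 0 <= A 1%N u i j by exact: multi_trans_ge0.
have bM u i : b u.+1 i = \sum_j A 1%N u i j * b u j by rewrite -addn1 bA.
have gM u i : g u.+1 i = \sum_j A 1%N u i j * g u j by rewrite -addn1 gA.
have fwv0 u v j : 0 <= fwv u v j.
  by apply: init_weight_ge0 => // cs z; exact: at_label_ge0.
have gb0 i : `|g 0%N i| <= b 0%N i.
  rewrite /g /b addn0 /forward_weight -(@sum_words_init_weight _ _ _ _ p q (at_label R i) t1 n m y); last first.
    move=> k' m' z; rewrite (_ : ((n + m).-1 - t1 = 0)%N); last by rewrite /t1; lia.
    rewrite leqn0 addn_eq0 => /andP[_ /eqP m0]; subst m'.
    by rewrite sumr_const card_tuple expn0.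
  apply: (le_trans (ler_norm_sum _ _ _)); apply: ler_sum => v _.
  by rewrite normrM (ger0_norm (fwv0 _ _ _)) ler_piMl.
have pinchA u : `[<e (drop_path u x)>] -> pinched (A L u) (b u) eps.
  move=> /asboolP /e_good[hi [S1 [S2 [hi0 gd]]]].
  exists hi, S1; split => // j; rewrite /A.
  have gi i : b u i != 0 -> 0 < p (drop_path u x 0%N, i).
    move=> bi; have /py : 0 < fw (t1 + u) i y by rewrite lt0r bi forward_weight_ge0.
    by rewrite -yE /drop_path addn0.
  have [S2j|nS2j] := boolP (S2 j); last first.
    left => i; have [->|bi] := eqVneq (b u i) 0; first by rewrite mulr0.
    by rewrite ((gd i (gi i bi) j).2 _) ?mul0r// (negbTE nS2j) andbF.
  right => i bi; split => [S1i|nS1i].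
    by apply: (gd i (gi i bi) j).1; rewrite S1i.
  by apply: (gd i (gi i bi) j).2; rewrite (negbTE nS1i).
pose s' := (s - m.-1)%N.
have [c [dd [cd dc gb]]] := pinched_contraction L_gt0 eps01 M0 bM gM (bA L) (gA L) gb0 pinchA s'.
have s'E : (t1 + s' = n + s)%N by rewrite /t1 /s'; lia.
have sandwich l' : (s <= l')%N ->
    c * init_weight p q h (n + l') [::] y <=
    \sum_v sg v * init_weight p q h (n + l') (word_at n v) y <=
    dd * init_weight p q h (n + l') [::] y.
  move=> sl'; have -> : (n + l' = (t1 + s') + (l' - s))%N by rewrite s'E; lia.
  pose bt j := weight q h (l' - s) [::] j (drop_path (t1 + s') y).
  have bt0 j : 0 <= bt j by exact: weight_tail_ge0.
  rewrite (init_weight_add _ _ _ (t1 + s') _ [::]).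
  rewrite (eq_bigr (fun v : m.-tuple Y => \sum_j bt j * (sg v * fwv (t1 + s')%N v j))); last first.
    move=> v _; rewrite init_weight_add mulr_sumr; apply: eq_bigr => j _.
    by rewrite wordE ?leq_addr// [RHS]mulrC -mulrA.
  rewrite exchange_big /= !mulr_sumr.
  have point j : c * (b s' j * bt j) <= \sum_(v : m.-tuple Y) bt j * (sg v * fwv (t1 + s')%N v j) <=
      dd * (b s' j * bt j).
    rewrite -mulr_sumr -/(g s' j) !(mulrC (b s' j)) !(mulrCA _ (bt j)).
    by have /andP[? ?] := gb j; rewrite !ler_wpM2l.
  by apply/andP; split; apply: ler_sum => j _; have /andP[] := point j.
have /andP[_ hl] := sandwich l sl.
have /andP[hs _] := sandwich s (leqnn s).
by exists c, dd.
Qed.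

End future.

End forgetting.

(** * Laws of trajectories and random geometric bounds *)

Section path_laws.
Context d (T : measurableType d) d' (Omega : measurableType d') (R : realType)
  (P : probability Omega R).

(** The events that bear on finitely many coordinates are stable under intersection
    and generate the sigma-algebra of the path space. *)
Lemma path_law_eq (W W' : nat -> Omega -> T) :
  (forall n, measurable_fun setT (W n)) -> (forall n, measurable_fun setT (W' n)) ->
  (forall n (C : set (n.-tuple T)), measurable C ->
    P [set w | C [tuple W j w | j < n]] = P [set w | C [tuple W' j w | j < n]]) ->
  forall A : set (path_space T), measurable A ->
    P [set w | A (path_of W w)] = P [set w | A (path_of W' w)].
Proof.
move=> mW mW' WW' A mA.
have mp (V : nat -> Omega -> T) : (forall n, measurable_fun setT (V n)) ->
    measurable_fun setT (path_of V) by move=> mV; exact: measurable_path.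
pose V : {mfun Omega >-> path_space T} := HB.pack (path_of W) (isMeasurableFun.Build _ _ _ _ _ (mp _ mW)).
pose V' : {mfun Omega >-> path_space T} := HB.pack (path_of W') (isMeasurableFun.Build _ _ _ _ _ (mp _ mW')).
pose cyl : set (set (path_space T)) := [set B : set (path_space T) |
  exists n (C : set (n.-tuple T)), measurable C /\
    B = [set x : path_space T | C [tuple x (j : nat) | j < n]]].
rewrite -[LHS]/(distribution P V A) -[RHS]/(distribution P V' A).
apply: (measure_unique cyl (fun _ => setT)) => //.
- apply/seteqP; split; apply: smallest_sub; do ?[exact: smallest_sigma_algebra].
  + move=> _ [n _ [B mB ->]]; apply: sub_sigma_algebra.
    exists n.+1, [set t : n.+1.-tuple T | B (tnth t ord_max)]; split.
      by rewrite -[X in measurable X]setTI; exact: measurable_tnth.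
    by apply/funext => x; rewrite /= tnth_mktuple.
  + move=> _ [n [C [mC ->]]].
    by have := @measurable_path_tuple _ T n id measurableT C mC; rewrite setTI.
- move=> _ _ [n1 [C1 [mC1 ->]]] [n2 [C2 [mC2 ->]]].
  pose n := maxn n1 n2.
  have l1 : (n1 <= n)%N by exact: leq_maxl.
  have l2 : (n2 <= n)%N by exact: leq_maxr.
  have mw k (kn : (k <= n)%N) : measurable_fun setT
      (fun t : n.-tuple T => [tuple tnth t (widen_ord kn j) | j < k]).
    apply/measurable_fun_tnthP => i.
    rewrite (_ : _ \o _ = fun t : n.-tuple T => tnth t (widen_ord kn i)); first exact: measurable_tnth.
    by apply/funext => t; rewrite /= tnth_mktuple.
  have wE k (kn : (k <= n)%N) (x : path_space T) :
      [tuple tnth [tuple x (j : nat) | j < n] (widen_ord kn j) | j < k] = [tuple x (j : nat) | j < k].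
    by apply: eq_from_tnth => i; rewrite !tnth_mktuple.
  exists n, [set t | C1 [tuple tnth t (widen_ord l1 j) | j < n1] /\
                     C2 [tuple tnth t (widen_ord l2 j) | j < n2]]; split.
    apply: measurableI.
      by have := mw _ l1 measurableT C1 mC1; rewrite setTI.
    by have := mw _ l2 measurableT C2 mC2; rewrite setTI.
  by apply/funext => x; rewrite /= !wE.
- by move=> _; exists 0%N, setT; split => //; apply/seteqP; split.
- by rewrite bigcup_const.
- by move=> _ [n [C [mC ->]]]; exact: WW'.
- by move=> _; rewrite /= -ge0_fin_numE//; exact: fin_num_measure.
Qed.

End path_laws.

Section dominating_variable.
Context d (Omega : measurableType d) (R : realType) (P : probability Omega R).
Variables (G : set (set Omega)) (good : nat -> set Omega) (a : nat -> nat) (k : nat) (gam : R).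
Hypothesis Ggood : forall i, <<s G >> (good i).
Hypothesis gam01 : (0 < gam < 1)%R.

Definition good_count (s : nat) (w : Omega) : nat := (\sum_(i < a s) `[<good i w>])%N.

Hypothesis good_count_linear : {ae P, forall w, exists C : nat, forall s : nat,
  (s%:R <= k%:R * (good_count s w)%:R + C%:R :> R)%R}.

(** With alpha = 1 - (1 - gam) / (k + 1) one has gam <= alpha ^ (k + 1), so that the
    linear growth of the count bounds 2 gam ^ count_s by a multiple of alpha ^ s.
    The least multiple that works for all s is a supremum of functions of the events
    good_i, hence measurable, however C depends on the sample point. *)
Lemma dominating_variable : exists (C0 : Omega -> R) (alpha : R),
  [/\ measurable_fun [set: g_sigma_algebraType G] C0, (0 < alpha < 1)%R &
  {ae P, forall w, forall s : nat, (2 * gam ^+ good_count s w <= C0 w * alpha ^+ s)%R}].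
Proof.
have /andP[g0 g1] := gam01.
have g01 : (0 < 1 - gam < 1)%R by rewrite subr_gt0 g1 ltrBlDr ltrDl.
pose alpha := rate k.+1 (1 - gam).
have a0 : (0 < alpha)%R by exact: (rate_gt0 (ltn0Sn k) g01).
have a1 : (alpha < 1)%R by exact: (rate_lt1 (ltn0Sn k) g01).
have aX : (gam <= alpha ^+ k.+1)%R.
  by apply: le_trans (rateX (ltn0Sn k) g01); rewrite subKr.
pose f (s : nat) (w : g_sigma_algebraType G) : R := (2 * gam ^+ good_count s w * alpha^-1 ^+ s)%R.
have f0 s w : (0 <= f s w)%R by rewrite !mulr_ge0// exprn_ge0 ?invr_ge0// ltW.
have mf s : measurable_fun setT (f s).
  apply: measurable_funM => //; apply: measurable_funM => //.
  rewrite /good_count; elim: (a s) => [|n ih].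
    rewrite (_ : (fun w => _) = cst 1%R); first exact: measurable_cst.
    by apply/funext => w; rewrite big_ord0 expr0.
  rewrite (_ : (fun w => _) = fun w : g_sigma_algebraType G =>
     (gam ^+ (\sum_(i < n) `[<good i w>]) * (1 - (1 - gam) * \1_(good n) w))%R).
    apply: measurable_funM; first exact: ih.
    apply: measurable_funB => //; apply: measurable_funM => //.
    by apply: measurable_indic; exact: Ggood.
  apply/funext => w; rewrite big_ord_recr exprD /=; congr (_ * _)%R.
  rewrite indicE; case: asboolP => [gw|ngw].
    by rewrite mem_set// expr1 mulr1 subKr.
  by rewrite memNset// expr0 mulr0 subr0.
pose C (w : g_sigma_algebraType G) : \bar R := esups (fun s => (f s w)%:E) 0%N.
exists (fun w => fine (C w)), alpha; split.
- apply: (measurableT_comp (fine_measurable measurableT)).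
  by apply: measurable_fun_esups => s; exact/measurable_EFinP.
- by rewrite a0 a1.
apply: filterS good_count_linear => w [c Hc] s.
have fle i : (f i w <= 2 * alpha^-1 ^+ c)%R.
  rewrite /f -mulrA ler_pM2l//.
  have h1 : (i <= k.+1 * good_count i w + c)%N.
    rewrite -(ler_nat R) natrD natrM; apply: (le_trans (Hc i)).
    by rewrite lerD2r ler_wpM2r// ler_nat.
  have h2 : (gam ^+ good_count i w <= alpha ^+ (k.+1 * good_count i w))%R.
    by rewrite exprM; apply: lerXn2r => //; rewrite nnegrE ?exprn_ge0 ?(ltW g0)// ltW.
  have ai0 : (0 <= alpha^-1 ^+ i)%R by rewrite exprn_ge0 ?invr_ge0 ?ltW.
  apply: (le_trans (ler_wpM2r ai0 h2)).
  rewrite !exprVn ler_pdivrMr ?exprn_gt0// mulrC ler_pdivlMr ?exprn_gt0// -exprD.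
  by apply: ler_wiXn2l; rewrite ?ltW.
have Cub : C w <= (2 * alpha^-1 ^+ c)%:E.
  by apply: ge_ereal_sup => _ /= [i _ <-]; rewrite lee_fin.
have Clb i : (f i w)%:E <= C w by apply: ereal_sup_ubound; exists i.
have Cfin : C w \is a fin_num.
  rewrite ge0_fin_numE; first exact: le_lt_trans Cub (ltry _).
  by apply: le_trans (Clb 0%N); rewrite lee_fin.
have := Clb s; rewrite -(fineK Cfin) lee_fin /f => fs.
by rewrite -ler_pdivrMr ?exprn_gt0// -exprVn.
Qed.

End dominating_variable.

(** * Stationary two-sided chains *)

Section two_sided.
Context d (T : measurableType d) d' (Omega : measurableType d') (R : realType)
  (P : probability Omega R).
Variables (Z : int -> Omega -> T) (K : R.-pker T ~> T).
Hypothesis Z_markov : two_sided_markov_chain P Z K.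
Hypothesis Z_stationary : stationary P Z.

Definition from_time (l : int) (k : nat) : Omega -> T := Z (l + k%:Z)%R.

Lemma markov_from l : markov_chain P (from_time l) K.
Proof.
split=> [n|n C mC]; first exact: Z_markov.1.
have [_ fint fE] := Z_markov.2 (l + n%:Z)%R C mC.
have -> : from_time l n.+1 = Z (l + n%:Z + 1)%R.
  by rewrite /from_time -addrA; congr Z; lia.
split=> //.
  apply: (measurableT_comp (measurable_kernel K C mC)) => _ B mB; rewrite setTI.
  by apply: sub_sigma_algebra; exists n => //=; exists B.
move=> B GB; apply: fE; apply: sub_sigma_algebra2 GB => _ [k kn [B' mB' ->]].
by exists (l + k%:Z)%R; [rewrite /= lerD2l lez_nat | exists B'].
Qed.

Lemma law_from l l' (A : set (path_space T)) : measurable A ->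
  P [set w | A (path_of (from_time l) w)] = P [set w | A (path_of (from_time l') w)].
Proof.
apply: path_law_eq => [n|n|n C mC]; [exact: Z_markov.1..|].
have := Z_stationary l' (l - l')%R mC; rewrite [(l' + _)%R]addrC subrK.
exact.
Qed.

Lemma marginal_from l k (C : set T) : measurable C ->
  P (Z l @^-1` C) = P (Z k @^-1` C).
Proof.
move=> mC; have mA : measurable [set x : path_space T | C (x 0%N)].
  by have := measurable_coord 0%N measurableT mC; rewrite setTI.
by have := law_from l k mA; rewrite /path_of /from_time /= !addr0.
Qed.

(** A block of the reversed process is a block of the process read from its other
    end. *)
Lemma reversed_shift (A : set (path_space T)) : measurable A ->
  P [set w | A (drop_path 1 (path_of (fun k : nat => Z (- k%:Z)%R) w))] =
  P [set w | A (path_of (fun k : nat => Z (- k%:Z)%R) w)].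
Proof.
pose W (k : nat) := Z (- k%:Z)%R.
change (measurable A -> P [set w | A (path_of (fun k => W k.+1) w)] =
  P [set w | A (path_of W w)]).
apply: path_law_eq => [n|n|n C mC]; [exact: Z_markov.1..|].
pose C' := [set t : n.-tuple T | C [tuple tnth t (rev_ord j) | j < n]].
have mC' : measurable C'.
  have mr : measurable_fun setT (fun t : n.-tuple T => [tuple tnth t (rev_ord j) | j < n]).
    apply/measurable_fun_tnthP => i.
    rewrite (_ : _ \o _ = fun t : n.-tuple T => tnth t (rev_ord i)).
      exact: measurable_tnth.
    by apply/funext => t; rewrite /= tnth_mktuple.
  by have := mr measurableT C mC; rewrite setTI.
have := Z_stationary (- n.-1%:Z)%R (- 1)%R mC'.
rewrite /C' /=; congr (P _ = P _); apply/seteqP; split=> w /=;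
  by congr C; apply: eq_from_tnth => j; rewrite !tnth_mktuple /W;
     congr (Z _ w); rewrite /=; have := ltn_ord j; lia.
Qed.

End two_sided.

Section stationary_model.
Context d (X : measurableType d) (N : nat) (R : realType).
Local Notation Y := (label N).
Local Notation T := (X * label N)%type.
Context d' (Omega : measurableType d') (P : probability Omega R)
  (mu : {sigma_finite_measure set X -> \bar R}).
Variables (p : T -> R) (q : T -> T -> R) (Q : R.-pker T ~> T) (Z : int -> Omega -> T).
Hypothesis q_measurable : measurable_fun setT (fun zz : T * T => q zz.1 zz.2).
Hypothesis q_ge0 : forall z' z, (0 <= q z' z)%R.
Hypothesis p_measurable : measurable_fun setT p.
Hypothesis p_ge0 : forall z, (0 <= p z)%R.
Hypothesis Q_kernel : forall z C, measurable C ->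
  Q z C = \int[ref_measure mu N]_(z' in C) (q z' z)%:E.
Hypothesis Z_markov : two_sided_markov_chain P Z Q.
Hypothesis Z_stationary : stationary P Z.
Hypothesis Z1_density : forall C, measurable C ->
  P (Z 1%R @^-1` C) = \int[ref_measure mu N]_(z in C) (p z)%:E.

Local Notation h := (tail_prob Q).
Local Notation from := (from_time Z).

Lemma from_density l C : measurable C ->
  P (from l 0%N @^-1` C) = \int[ref_measure mu N]_(z in C) (p z)%:E.
Proof. by move=> mC; rewrite -Z1_density// (marginal_from Z_markov Z_stationary _ 1%R). Qed.

Lemma density_pos k : P [set w | p (Z k w) = 0%R] = 0.
Proof.
have mC : measurable (p @^-1` [set 0%R]) by rewrite -[X in measurable X]setTI; exact: p_measurable.
rewrite [LHS](marginal_from Z_markov Z_stationary k 1%R mC) Z1_density//.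
by apply: integral0_eq => z /= ->.
Qed.

Lemma obs_from l k w : drop_path k (obs (from l) w) = obs (from (l + k%:Z)%R) w.
Proof.
apply/funext => j; rewrite /drop_path /obs /xpath /path_of /from_time.
by rewrite -addrA.
Qed.

Lemma good_event_from a (D : set int) (L : nat) (e : set (path_space X)) :
  measurable e -> upto L e -> (forall i : nat, (i <= L)%N -> D (a + i%:Z)%R) ->
  <<s coord_events (fun k w => (Z k w).1) D >> [set w | e (obs (from a) w)].
Proof.
move=> me eL HD; have := @upto_sigma _ _ _ _ (fun k w => (from a k w).1) L e me eL.
apply: sub_sigma_algebra2 => _ [k kL [B mB ->]].
by exists (a + k%:Z)%R; [exact: HD|exists B].
Qed.

Lemma obeys_pred1 (s : seq Y) (y : nat -> Y) :
  obeys [seq (pred1 a : pred Y) | a <- s] y = (mkseq y (size s) == s).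
Proof.
elim: s y => //= a s ih y; rewrite ih /mkseq /= eqseq_cons; congr (_ && (_ == _)).
by rewrite -[1%N]/(1 + 0)%N iotaDl -map_comp.
Qed.

(** The smoothing probabilities for the window from -u to n, as ratios of weights along
    the observations from -u on: time 0 is the index u of that trajectory. *)
Lemma smoothing_at (m : nat) (nu : int -> int -> int -> Omega -> m.-tuple Y -> R) u n :
  smoothing_versions P Z nu ->
  {ae P, forall w, forall v, nu 0%R (- u%:Z)%R n%:Z w v =
    (init_weight p q h (u + n) (word_at u v) (obs (from (- u%:Z)%R) w) /
     init_weight p q h (u + n) [::] (obs (from (- u%:Z)%R) w))%R}.
Proof.
move=> nu_version; apply: ae_forall_countable => v.
have WQ := markov_from Z_markov (- u%:Z)%R.
have := smoothing_formula q_measurable q_ge0 p_measurable p_ge0 Q_kernel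
  (from_density (- u%:Z)%R) WQ (u + n) (word_at u v).
have un : (- u%:Z <= n%:Z)%R by lia.
have GE : coord_events (fun (k : nat) w => (from (- u%:Z)%R k w).1) [set k | (k <= u + n)%N] =
    coord_events (fun k w => (Z k w).1) [set k : int | (- u%:Z <= k <= n%:Z)%R].
  apply/seteqP; split=> _ [k kn [B mB ->]].
    by exists (- u%:Z + k%:Z)%R; [rewrite /= in kn *; lia | exists B].
  exists (absz (k + u%:Z)%R); first by rewrite /= in kn *; lia.
  exists B => //; rewrite /from_time (_ : (- u%:Z + (absz (k + u%:Z)%R)%:Z)%R = k)//.
  by rewrite /= in kn; lia.
have AE : [set w | obeys (word_at u v) (labels (from (- u%:Z)%R) w)] =
    [set w | [tuple (Z (0 + j%:Z)%R w).2 | j < m] = v].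
  apply/seteqP; split=> w /=; rewrite obeys_nseq obeys_pred1 size_tuple.
    move=> /eqP E; apply: eq_from_tnth => i; rewrite tnth_mktuple.
    rewrite (tnth_nth (v`_0)) -E nth_mkseq// /labels /ypath /path_of /from_time.
    by congr (Z _ w).2; lia.
  move=> <-; apply/eqP; apply: (@eq_from_nth _ ord0).
    by rewrite size_mkseq size_tuple.
  rewrite size_mkseq => i im; rewrite nth_mkseq// -[i]/(val (Ordinal im)) -tnth_nth tnth_mktuple.
  by rewrite /labels /ypath /path_of /from_time; congr (Z _ w).2; rewrite /=; lia.
rewrite GE AE => cp.
apply: cond_prob_version_unique (nu_version 0%R _ _ v un) cp.
move=> _ [k _ [B mB ->]].
have mk : measurable_fun setT (fun w => (Z k w).1).
  exact: (measurableT_comp measurable_fst (Z_markov.1 k)).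
by rewrite -[X in measurable X]setTI; exact: mk.
Qed.

End stationary_model.

(** * Forgetting of the past and of the future *)

Lemma visit_countE d (T : measurableType d) (R : realType) (e : set (path_space T)) n x :
  visit_count R e n x = (\sum_(i < n) `[<e (drop_path i x)>])%:R.
Proof.
rewrite /visit_count natr_sum; apply: eq_bigr => i _; rewrite indicE.
by case: asboolP => [ei|nei]; [rewrite mem_set | rewrite memNset].
Qed.

Section both_directions.
Context d (X : measurableType d) (N : nat) (R : realType).
Local Notation Y := (label N).
Local Notation T := (X * label N)%type.
Context d' (Omega : measurableType d') (P : probability Omega R)
  (mu : {sigma_finite_measure set X -> \bar R}).
Variables (p : T -> R) (q : T -> T -> R) (Q : R.-pker T ~> T) (Z : int -> Omega -> T).
Hypothesis q_measurable : measurable_fun setT (fun zz : T * T => q zz.1 zz.2).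
Hypothesis q_ge0 : forall z' z, (0 <= q z' z)%R.
Hypothesis p_measurable : measurable_fun setT p.
Hypothesis p_ge0 : forall z, (0 <= p z)%R.
Hypothesis Q_kernel : forall z C, measurable C ->
  Q z C = \int[ref_measure mu N]_(z' in C) (q z' z)%:E.
Hypothesis Z_markov : two_sided_markov_chain P Z Q.
Hypothesis Z_stationary : stationary P Z.
Hypothesis Z1_density : forall C, measurable C ->
  P (Z 1%R @^-1` C) = \int[ref_measure mu N]_(z in C) (p z)%:E.
Variables (m : nat) (nu : int -> int -> int -> Omega -> m.-tuple Y -> R).
Hypothesis nu_version : smoothing_versions P Z nu.
Variables (L : nat) (eps : R) (e : set (path_space X)).
Hypothesis L_gt0 : (0 < L)%N.
Hypothesis eps01 : (0 < eps < 1)%R.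
Hypothesis e_measurable : measurable e.
Hypothesis e_upto : upto L e.
Hypothesis e_pos : 0 < P [set w | e (obs (from_time Z 0) w)].
Hypothesis e_good : forall x, e x -> good_block p q L eps x.

Local Notation h := (tail_prob Q).
Local Notation from := (from_time Z).

Let gam01 : (0 < rate L eps < 1)%R.
Proof. by rewrite (rate_gt0 L_gt0 eps01) (rate_lt1 L_gt0 eps01). Qed.

Let e_pos_from l : 0 < P [set w | e (obs (from l) w)].
Proof.
have mA : measurable [set x : path_space T | e (xpath x)].
  by have := @measurable_xpath _ X N measurableT e e_measurable; rewrite setTI.
rewrite -[X in _ < X]/(P [set w | [set x : path_space T | e (xpath x)] (path_of (from l) w)]).
by rewrite (law_from Z_markov Z_stationary l 0%R mA).
Qed.

(** The almost sure properties of one window that the deterministic estimates use. *)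
Let regular u n : {ae P, forall w,
  [/\ forall v, nu 0%R (- u%:Z)%R n%:Z w v =
        (init_weight p q h (u + n) (word_at u v) (obs (from (- u%:Z)%R) w) /
         init_weight p q h (u + n) [::] (obs (from (- u%:Z)%R) w))%R,
      (0 < init_weight p q h (u + n) [::] (obs (from (- u%:Z)%R) w))%R
    & forall k i, (0 < forward_weight p q k i (obs (from (- u%:Z)%R) w))%R ->
        (0 < p (obs (from (- u%:Z)%R) w k, i))%R]}.
Proof.
have WQ := markov_from Z_markov (- u%:Z)%R.
have W0 := from_density Z_markov Z_stationary Z1_density (- u%:Z)%R.
apply: filterS3 (smoothing_at q_measurable q_ge0 p_measurable p_ge0 Q_kernel Z_markov
  Z_stationary Z1_density u n nu_version)
  (den_gt0_ae q_measurable q_ge0 p_measurable p_ge0 Q_kernel W0 WQ (u + n))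
  (support_ae q_measurable q_ge0 p_measurable p_ge0 Q_kernel W0 WQ _) => //.
move=> k; exact: (density_pos p_measurable Z_markov Z_stationary Z1_density).
Qed.

(** The good blocks of the past are the visits of the reversed chain to the reversed
    good event; this is where the Harris recurrence of the reversed chain enters. *)
Lemma forgetting_the_past (K : R.-pker T ~> T) :
  markov_chain P (fun k : nat => Z (- k%:Z)%R) K -> harris_recurrent K ->
  exists (C0 : Omega -> R) (alpha : R),
    [/\ measurable_fun [set: g_sigma_algebraType
          (coord_events (fun k w => (Z k w).1) [set k : int | (k <= 0)%R])] C0,
        (0 < alpha < 1)%R
      & forall s l : nat, (0 < s)%N -> (s <= l)%N ->
        {ae P, forall w,
          ereal_sup (range (fun n : nat =>
            (tv_norm (fun v => nu 0 (- l%:Z) n%:Z w v - nu 0 (- s%:Z) n%:Z w v))%R%:E))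
          <= (C0 w * alpha ^+ s)%:E}].
Proof.
move=> WK KH.
(* The good event, read from its last observation backwards. *)
pose e' := [set x : path_space T | e (fun j => (x (L - j)%N).1)].
have me' : measurable e'.
  have mx : measurable_fun setT (fun x : path_space T =>
      (fun j => (x (L - j)%N).1) : path_space X).
    apply: measurable_path => k.
    exact: (measurableT_comp measurable_fst (measurable_coord (L - k)%N)).
  by have := mx measurableT e e_measurable; rewrite setTI.
pose good k := [set w | e (obs (from (- (k + L).+1%:Z)%R) w)].
have e'E i w : e' (drop_path i (path_of (fun k : nat => Z (- k%:Z)%R) w)) =
    e (obs (from (- (i + L)%:Z)%R) w).
  apply: e_upto => j jL; rewrite /obs /xpath /path_of /from_time /drop_path.
  by congr (Z _ w).1; lia.
have e'0 : 0 < P [set w | e' (path_of (fun k : nat => Z (- k%:Z)%R) w)].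
  rewrite (_ : [set w | _] = [set w | e (obs (from (- (0 + L)%:Z)%R) w)])//.
  by apply/funext => w; rewrite /= -e'E drop_path0.
have [kap lin] := linear_visits WK (reversed_shift Z_markov Z_stationary) KH me' e'0.
have lin' : {ae P, forall w, exists C : nat, forall s : nat,
    (s%:R <= kap%:R * (good_count good (fun s => s - L)%N s w)%:R + C%:R :> R)%R}.
  apply: filterS lin => w [C HC]; exists (kap + C + L)%N => s.
  (* The visit of index 0 has no counterpart among the good blocks, which costs kap. *)
  have := HC (s - L).+1; rewrite visit_countE -natrM -natrD ler_nat big_ord_recl.
  rewrite -natrM -natrD ler_nat => le1.
  have b1 (b : bool) : (b <= 1)%N by case: b.
  have {le1} : ((s - L).+1 <= kap * (1 + good_count good (fun s => s - L)%N s w) + C)%N.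
    apply: leq_trans le1 _; rewrite leq_add2r leq_mul2l leq_add ?orbT//.
    by apply: leq_sum => i _; rewrite e'E.
  by lia.
have [|C0 [alpha [mC0 a01 dom]]] := @dominating_variable _ _ _ P
    (coord_events (fun k w => (Z k w).1) [set k : int | (k <= 0)%R])
    good (fun s => s - L)%N kap (rate L eps) _ gam01 lin'.
  by move=> i; apply: good_event_from e_measurable e_upto _ => j jL /=; lia.
exists C0, alpha; split=> // s l s0 sl.
have Hl := ae_foralln (regular l); have Hs := ae_foralln (regular s).
apply: filterS3 dom Hl Hs => w Hw Rl Rs.
apply: ge_ereal_sup => _ /= [n _ <-]; rewrite lee_fin.
apply: le_trans (Hw s).
have [nl dl sl'] := Rl n; have [ns ds ss'] := Rs n.
under [X in tv_norm X]funext => v do rewrite nl ns.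
apply: (@past_forgetting _ _ _ _ p q Q q_ge0 p_ge0 (fun u => obs (from (- u%:Z)%R) w) L eps e) => //.
by move=> u; rewrite obs_from; congr (obs (from _) w); lia.
Qed.

(** Here the blocks start at the times m - 1, m, ..., so that the visits of the chain
    started at time m - 1 are counted. *)
Lemma forgetting_the_future : harris_recurrent Q -> (0 < m)%N ->
  exists (Cbar : Omega -> R) (alphabar : R),
    [/\ measurable_fun [set: g_sigma_algebraType
          (coord_events (fun k w => (Z k w).1) [set k : int | (m%:Z - 1 <= k)%R])] Cbar,
        (0 < alphabar < 1)%R
      & forall s l : nat, (m <= s)%N -> (s <= l)%N ->
        {ae P, forall w,
          ereal_sup (range (fun n : nat =>
            (tv_norm (fun v => nu 0 (- n%:Z) l%:Z w v - nu 0 (- n%:Z) s%:Z w v))%R%:E))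
          <= (Cbar w * alphabar ^+ (s - (m - 1)))%:E}].
Proof.
move=> QH m0; pose a := (m%:Z - 1)%R : int.
pose e' := [set x : path_space T | e (xpath x)].
have me' : measurable e'.
  by have := @measurable_xpath _ X N measurableT e e_measurable; rewrite setTI.
pose good k := [set w | e (obs (from (a + k%:Z)%R) w)].
have e'E i w : e' (drop_path i (path_of (from a) w)) = e (obs (from (a + i%:Z)%R) w).
  by rewrite -obs_from.
have shift (A : set (path_space T)) : measurable A ->
    P [set w | A (drop_path 1 (path_of (from a) w))] = P [set w | A (path_of (from a) w)].
  move=> mA; rewrite -(law_from Z_markov Z_stationary (a + 1)%R a mA).
  congr (P _); apply/funext => w /=; congr A; apply/funext => k.
  by rewrite /drop_path /path_of /from_time; congr (Z _ w); lia.
have [kap lin] := linear_visits (markov_from Z_markov a) shift QH me' (e_pos_from a).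
have lin' : {ae P, forall w, exists C : nat, forall s : nat,
    (s%:R <= kap%:R * (good_count good (fun u => u.+1 - L)%N s w)%:R + C%:R :> R)%R}.
  apply: filterS lin => w [C HC]; exists (C + L)%N => s.
  have := HC (s.+1 - L)%N; rewrite visit_countE -!natrM -!natrD !ler_nat => le1.
  have {le1} : (s.+1 - L <= kap * good_count good (fun u => u.+1 - L)%N s w + C)%N.
    apply: leq_trans le1 _; rewrite leq_add2r leq_mul2l; apply/orP; right.
    by apply: leq_sum => i _; rewrite e'E.
  by lia.
have [|Cb [alpha [mC a01 dom]]] := @dominating_variable _ _ _ P
    (coord_events (fun k w => (Z k w).1) [set k : int | (m%:Z - 1 <= k)%R])
    good (fun u => u.+1 - L)%N kap (rate L eps) _ gam01 lin'.
  by move=> i; apply: good_event_from e_measurable e_upto _ => j jL /=; rewrite /a; lia.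
exists Cb, alpha; split=> // s l ms sl.
have Hl := ae_foralln (fun n => regular n l); have Hs := ae_foralln (fun n => regular n s).
apply: filterS3 dom Hl Hs => w Hw Rl Rs.
apply: ge_ereal_sup => _ /= [n _ <-]; rewrite lee_fin.
apply: le_trans (Hw _).
have [nl dl sup] := Rl n; have [ns ds _] := Rs n.
under [X in tv_norm X]funext => v do rewrite nl ns.
rewrite /good_count (eq_bigr (fun k : 'I__ => nat_of_bool `[<e (drop_path k (obs (from a) w))>])).
  rewrite subn1; apply: (@future_forgetting _ _ _ _ p q Q q_ge0 p_ge0 _ _ L eps e) => //.
  by rewrite obs_from; congr (obs (from _) w); rewrite /a; lia.
by move=> k _; rewrite obs_from.
Qed.

End both_directions.

Theorem theorem3p2 (R : realType) (X : ptopologicalType) (N : nat)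
  (d : measure_display) (Omega : measurableType d) (P : probability Omega R)
  (mu : {sigma_finite_measure set (borel X) -> \bar R})
  (q : borel X * label N -> borel X * label N -> R)
  (p : borel X * label N -> R)
  (Q : R.-pker (borel X * label N)%type ~> (borel X * label N)%type)
  (Z : int -> Omega -> borel X * label N)
  (r : nat) (E : set (r.-tuple (borel X)))
  (m : nat)
  (nu : int -> int -> int -> Omega -> m.-tuple (label N) -> R)
  (X_polish : polish_space R X)
  (q_measurable : measurable_fun setT
     (fun zz : (borel X * label N) * (borel X * label N) => q zz.1 zz.2))
  (q_ge0 : forall z' z, (0 <= q z' z)%R)
  (q_density : forall z, \int[ref_measure mu N]_z' (q z' z)%:E = 1)
  (Q_kernel : forall z C, measurable C ->
     Q z C = \int[ref_measure mu N]_(z' in C) (q z' z)%:E)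
  (Z_markov : two_sided_markov_chain P Z Q)
  (Z_stationary : stationary P Z)
  (p_measurable : measurable_fun setT p)
  (p_ge0 : forall z, (0 <= p z)%R)
  (Z1_density : forall C, measurable C ->
     P (Z 1%R @^-1` C) = \int[ref_measure mu N]_(z in C) (p z)%:E)
  (Z_harris : positive_harris Q)
  (r_gt1 : (1 < r)%N)
  (A1' : conditionA1' p q E)
  (A2' : conditionA2' mu E)
  (Zrev_harris : harris_recurrent_process P (fun k : nat => Z (- k%:Z)%R))
  (m_ge1 : (1 <= m)%N)
  (nu_version : smoothing_versions P Z nu) :
  (exists (C0 : Omega -> R) (alpha : R),
     [/\ measurable_fun
           [set: g_sigma_algebraType
              (coord_events (fun k w => (Z k w).1) [set k : int | (k <= 0)%R])]
           C0,
         (0 < alpha < 1)%R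
       & forall s l : nat, (0 < s)%N -> (s <= l)%N ->
         {ae P, forall w,
           ereal_sup (range (fun n : nat =>
             (tv_norm (fun v => nu 0 (- l%:Z) n%:Z w v
                              - nu 0 (- s%:Z) n%:Z w v))%R%:E))
           <= (C0 w * alpha ^+ s)%:E}]) /\
  (exists (Cbar : Omega -> R) (alphabar : R),
     [/\ measurable_fun
           [set: g_sigma_algebraType
              (coord_events (fun k w => (Z k w).1)
                 [set k : int | (m%:Z - 1 <= k)%R])]
           Cbar,
         (0 < alphabar < 1)%R
       & forall s l : nat, (m <= s)%N -> (s <= l)%N ->
         {ae P, forall w,
           ereal_sup (range (fun n : nat =>
             (tv_norm (fun v => nu 0 (- n%:Z) l%:Z w v
                              - nu 0 (- n%:Z) s%:Z w v))%R%:E))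
           <= (Cbar w * alphabar ^+ (s - (m - 1)))%:E}]).
Proof.
have [L [eps [e [[L_gt0 eps01] me eL e0 e_good]]]] :=
  good_block_exists q_measurable q_ge0 p_measurable p_ge0 Q_kernel
    (from_density Z_markov Z_stationary Z1_density 0%R) (markov_from Z_markov 0%R)
    r_gt1 A1' A2'.
split.
  have [K ZK KH] := Zrev_harris.
  exact: (forgetting_the_past q_measurable q_ge0 p_measurable p_ge0 Q_kernel Z_markov
    Z_stationary Z1_density nu_version L_gt0 eps01 me eL e0 e_good ZK KH).
exact: (forgetting_the_future q_measurable q_ge0 p_measurable p_ge0 Q_kernel Z_markov
  Z_stationary Z1_density nu_version L_gt0 eps01 me eL e0 e_good Z_harris.1 m_ge1).
Qed.
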